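(* Let $\Xi=(\mathbb{X},\rho,\mu^*,\{\lambda_k\}_{k=0}^\infty,\{\phi_k\}_{k=0}^\infty)$ be a data-defined space with exponent $q$. Let $1\le p\le\infty$, $\beta>q/p$, and let $G$ be a kernel of type $\beta$. For a measure $\nu$ put $$M_p(\nu)=\left\|\int_{\mathbb{X}}G(x,\circ)\,d\nu(x)-\int_{\mathbb{X}}G(x,\circ)\,d\mu^*(x)\right\|_{p'} .$$ Let $C_1,C_2,C_3>0$ be constants and $0<\gamma<\beta$. Then there is a constant $A>0$, depending on $C_1,C_2,C_3,\gamma$ and the fixed data ($\Xi$, $p$, $\beta$, $G$) but not on $n$, $K$, $\nu^\#$ or $P$, such that the following holds. Let $n>0$ and let $K$ be any compact set of measures such that $\sup_{\nu\in K}|\nu|(\mathbb{X})\le C_1$ and $\sup_{\nu\in K}|\!|\!|\nu|\!|\!|_{R,2^{-n}}\le C_2$. If $K$ contains a quadrature measure $\nu^*$ of order $2^n$, and $\nu^\#\in K$ satisfies $$M_p(\nu^\#)\le C_3\inf_{\nu\in K}M_p(\nu),$$ then $$\left|\int_{\mathbb{X}}P\,d\mu^*-\int_{\mathbb{X}}P\,d\nu^\#\right|\le A\,\frac{\|P\|_{H_\gamma^p}}{2^{n\gamma}},\qquad P\in\Pi_{2^n}.$$ In particular, $\nu^\#$ is an approximate quadrature measure of order $2^n$ of class $\mathcal{A}(\gamma,p)$, i.e., $\nu^\#\in\mathcal{A}(\gamma,p,2^n)$: it satisfies $|\nu^\#|(\mathbb{X})\le C_1$, $|\!|\!|\nu^\#|\!|\!|_{R,2^{-n}}\le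 C_2$, and $\left|\int_{\mathbb{X}}P\,d\mu^*-\int_{\mathbb{X}}P\,d\nu^\#\right|\le A\,2^{-n\gamma}\|P\|_{H_\gamma^p}$ for all $P\in\Pi_{2^n}$, with constants independent of $n$.
   Context: Data-defined space. $\mathbb{X}$ is a non-empty set with a quasi-metric $\rho$: $\rho\ge0$, $\rho(x,y)=0$ iff $x=y$, $\rho(x,y)=\rho(y,x)$, and $\rho(x,y)\le\kappa_1(\rho(x,z)+\rho(z,y))$ for a constant $\kappa_1\ge1$. The sets $\{y:\rho(x,y)<r\}$ ($x\in\mathbb{X}$, $r>0$) form a basis of the topology of $\mathbb{X}$. Write $\mathbb{B}(x,r)=\{y\in\mathbb{X}:\rho(x,y)\le r\}$. $\mu^*$ is a probability measure on $\mathbb{X}$; $\{\lambda_k\}_{k\ge0}$ is a non-decreasing sequence with $\lambda_0=0$, $\lambda_k\uparrow\infty$; $\{\phi_k\}_{k\ge 0}$ are continuous, bounded, integrable real-valued functions, orthonormal in $L^2(\mu^* )$, with $\phi_0\equiv1$. The system is a data-defined space if: (1) every ball $\mathbb{B}(x,r)$ is compact; (2) there are $q>0,\kappa_2>0$ with $\mu^*(\mathbb{B}(x,r))\le\kappa_2r^q$ for all $x\in\mathbb{X}$, $r>0$; (3) the series $K_t(x,y)=\sum_{k=0}^\infty \exp(-\lambda_k^2t)\phi_k(x)\phi_k(y)$ converges for all $t\in(0,1]$, $x,y\in\mathbb{X}$, and there are $\kappa_3,\kappa_4>0$ with $|K_t(x,y)|\le\kappa_3t^{-q/2}\exp(-\kappa_4\rho(x,y)^2/t)$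 for all $x,y\in\mathbb{X}$, $0<t\le1$ (same $q$). The number $q$ is the exponent. Measures. All measures are signed (finite total variation) or positive, complete, sigma-finite Borel measures on $\mathbb{X}$; $|\nu|$ is the total variation measure of $\nu$. For $d>0$, $\nu$ is $d$-regular if there is a constant $C$ with $|\nu|(\mathbb{B}(x,d))\le Cd^q$ for all $x\in\mathbb{X}$; the infimum of all such $C$ is $|\!|\!|\nu|\!|\!|_{R,d}$. A set $K$ of measures is ''compact'' with respect to any fixed topology on the space of measures. Function spaces. $\Pi_n=\mathrm{span}\{\phi_j:\lambda_j<n\}$; elements of $\bigcup_n\Pi_n$ are diffusion polynomials. $L^p=L^p(\mu^* )$ with norm $\|\cdot\|_p$; $X^p$ is the $L^p$-closure of the set of diffusion polynomials; $p'=p/(p-1)$ ($1'=\infty$, $\infty'=1$). $\hat f(k)=\int f\phi_k\,d\mu^*$. For $r>0$, $W_r^p$ is the set of $f\in X^p$ for which there is $\Delta^rf\in X^p$ with $\widehat{\Delta^rf}(k)=(\lambda_k+1)^r\hat f(k)$ for all $k$. For $f\in X^p$, $\delta>0$, $\omega_r(p;f,\delta)=\inf\{\|f-f_1\|_p+\delta^r\|\Delta^rf_1\|_p: f_1\in W_r^p\}$. For $\gamma>0$ fix any $r>\gamma$; $H_\gamma^p$ is the set of $f\in X^p$ with $\|f\|_{H_\gamma^p}:=\|f\|_p+\sup_{\delta\in(0,1]}\delta^{-\gamma}\omega_r(p;f,\delta)<\infty$ (different $r>\gamma$ give equivalent norms). Quadrature measures. $\nu$ is a quadrature measure of order $N$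 ($N\ge1$) if $\int P\,d\nu=\int P\,d\mu^*$ for all $P\in\Pi_N$. A sequence $\{\nu_n\}_{n\ge1}$ is of class $\mathcal{A}(\gamma,p)$ (approximate quadrature measures) if $\sup_n|\nu_n|(\mathbb{X})<\infty$, $\sup_n|\!|\!|\nu_n|\!|\!|_{R,1/n}<\infty$, and $|\int P\,d\mu^*-\int P\,d\nu_n|\le A\|P\|_{H_\gamma^p}n^{-\gamma}$ for all $n\geq 1$, $P\in\Pi_n$, with $A$ independent of $n$ and $P$; one writes $\nu\in\mathcal{A}(\gamma,p,N)$ when $\nu$ satisfies these conditions for order $N$, as a member of such a family with uniform constants. Kernels of type $\beta$. Fix an integer $S>q$. A mask of type $\beta\in\mathbb{R}$ is an even, $S$ times continuously differentiable $b:\mathbb{R}\to\mathbb{R}$ such that $b(t)=(1+t)^{-\beta}F_b(\log t)$ for $t>0$, where $F_b:\mathbb{R}\to\mathbb{R}$ satisfies $|F_b^{(k)}(t)|\le c(b)$ for $t\in\mathbb{R}$, $k=0,\dots,S$, and $F_b(t)\ge c_1(b)>0$ for $t\in\mathbb{R}$. A kernel of type $\beta>0$ is a function $G:\mathbb{X}\times\mathbb{X}\to\mathbb{R}$ with formal expansion $G(x,y)=\sum_{j=0}^\infty b(\lambda_j)\phi_j(x)\phi_j(y)$ for some mask $b$ of type $\beta$. When $\beta>q/p$ this means: for every $x\in\mathbb{X}$, $G(x,\circ)$ is the (unique) element of $X^{p'}$ with $\int G(x,y)\phi_k(y)\,d\mu^*(y)=b(\lambda_k)\phi_k(x)$ for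 all $k$ (these satisfy $\sup_x\|G(x,\circ)\|_{p'}<\infty$), and $\int G(x,\circ)\,d\nu(x)$ is understood as an $L^{p'}$-valued integral. *)

(* Defs.v *)
From HB Require Import structures.
From mathcomp Require Import all_boot all_order all_algebra.
From mathcomp Require Import all_classical all_reals all_analysis.

Set Implicit Arguments.
Unset Strict Implicit.
Unset Printing Implicit Defensive.

Import Order.TTheory GRing.Theory Num.Theory.
Import numFieldNormedType.Exports.

Local Open Scope classical_set_scope.
Local Open Scope ring_scope.

Notation borel T := (g_sigma_algebraType (@open T)).

(** Finite Borel measures on [T], positive or signed. *)
Notation signed_measure T R := (charge (borel T) R).

(** ** Signed measures *)

Section signed_measures.
Context {R : realType} {d : measure_display} {T : measurableType d}.
Implicit Type nu : {charge set T -> \bar R}.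

Definition hahn_pos nu : set T := projT1 (cid (Hahn_decomposition nu)).

Definition hahn_neg nu : set T :=
  projT1 (cid (projT2 (cid (Hahn_decomposition nu)))).

Lemma hahnP nu : hahn_decomposition nu (hahn_pos nu) (hahn_neg nu).
Proof. exact: (projT2 (cid (projT2 (cid (Hahn_decomposition nu))))). Qed.

Definition variation_measure nu : {measure set T -> \bar R} :=
  charge_variation (hahnP nu).

Definition charge_integral nu (f : T -> R) : R :=
  (\int[jordan_pos (hahnP nu)]_x f x - \int[jordan_neg (hahnP nu)]_x f x)%R.

End signed_measures.

(** ** Bochner integral of an [L^p(mu)]-valued function against a charge

    An [L^p(mu)]-valued function on [T] is given by [F : T -> U -> R], [F x]
    being a representative of the value at [x].  Joint measurability of [F]
    is neither required nor implied. *)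

Section bochner_integral.
Context {R : realType} {d d' : measure_display}
  {T : measurableType d} {U : measurableType d'}.
Variables (mu : {measure set U -> \bar R}) (p : \bar R).

Record Lsimple := MkLsimple {
  Lsimple_size : nat ;
  Lsimple_set : 'I_Lsimple_size -> set T ;
  Lsimple_val : 'I_Lsimple_size -> U -> R ;
  Lsimple_measurable : forall i, measurable (Lsimple_set i) ;
  Lsimple_Lfun : forall i, Lsimple_val i \in Lfun mu p }.

Definition Lsimple_fun (s : Lsimple) (x : T) (y : U) : R :=
  \sum_(i < Lsimple_size s) \1_(Lsimple_set i) x * @Lsimple_val s i y.

Variable nu : {charge set T -> \bar R}.

Definition Lsimple_integral (s : Lsimple) (y : U) : R :=
  \sum_(i < Lsimple_size s) fine (nu (Lsimple_set i)) * @Lsimple_val s i y.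

Definition Ldist (f g : U -> R) : \bar R :=
  ('N[mu]_p[EFin \o (fun y => (f y - g y)%R)])%E.

Definition is_bochner (F : T -> U -> R) (h : U -> R) : Prop :=
  h \in Lfun mu p /\
  exists s : nat -> Lsimple,
  [/\ {ae variation_measure nu, forall x,
        Ldist (F x) (Lsimple_fun (s n) x) @[n --> \oo] --> 0%E},
      (\int[variation_measure nu]_x Ldist (F x) (Lsimple_fun (s n) x))%E
        @[n --> \oo] --> 0%E &
      Ldist (Lsimple_integral (s n)) h @[n --> \oo] --> 0%E].

(** A representative of the integral (unique up to [mu]-a.e. equality), and
    [0] if [F] is not integrable. *)
Definition bochner (F : T -> U -> R) : U -> R :=
  xget (fun=> 0) [set h | is_bochner F h].

End bochner_integral.

(** ** Data-defined spaces *)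

Record system (R : realType) := System {
  carrier :> ptopologicalType ;
  rho : carrier -> carrier -> R ;
  mustar : probability (borel carrier) R ;
  lam : nat -> R ;
  phi : nat -> borel carrier -> R }.

Section data_defined_space.
Context {R : realType} (Xi : system R).

Definition cball (x : Xi) (r : R) : set Xi := [set y | rho x y <= r].

Definition quasi_metric : Prop :=
  [/\ forall x y : Xi, 0 <= rho x y,
      forall x y : Xi, rho x y = 0 <-> x = y,
      forall x y : Xi, rho x y = rho y x &
      exists2 k1 : R, 1 <= k1 &
        forall x y z : Xi, rho x y <= k1 * (rho x z + rho z y)].

Definition heat_series (t : R) (x y : Xi) : nat -> R :=
  series (fun k => expR (- (lam Xi k ^+ 2 * t)) * phi k x * phi k y).

Record data_defined (q : R) : Prop := DataDefined {
  dd_quasi_metric : quasi_metric ;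
  dd_basis : basis [set A : set Xi |
    exists x r, 0 < r /\ A = [set y | rho x y < r]] ;
  dd_lam_nondecreasing : forall j k, (j <= k)%N -> lam Xi j <= lam Xi k ;
  dd_lam0 : lam Xi 0%N = 0 ;
  dd_lam_infty : lam Xi k @[k --> \oo] --> +oo ;
  dd_phi_continuous : forall k, continuous (phi k : Xi -> R) ;
  dd_phi_bounded : forall k, exists B : R, forall x : Xi, `|phi k x| <= B ;
  dd_phi_integrable : forall k,
    (mustar Xi).-integrable setT (EFin \o phi k) ;
  dd_phi_orthonormal : forall j k,
    (\int[mustar Xi]_x (phi j x * phi k x))%R = (j == k)%:R ;
  dd_phi0 : forall x : Xi, phi 0%N x = 1 ;
  dd_compact_ball : forall (x : Xi) (r : R), 0 < r -> compact (cball x r) ;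
  dd_exponent_gt0 : 0 < q ;
  dd_ball_measure : exists2 k2 : R, 0 < k2 &
    forall (x : Xi) (r : R), 0 < r ->
      (mustar Xi (cball x r) <= (k2 * r `^ q)%:E)%E ;
  dd_heat_cvg : forall (t : R) (x y : Xi), 0 < t <= 1 ->
    cvgn (heat_series t x y) ;
  dd_heat_bound : exists k3 k4 : R, [/\ 0 < k3, 0 < k4 &
    forall (t : R) (x y : Xi), 0 < t <= 1 ->
      `|limn (heat_series t x y)| <=
        k3 * t `^ (- (q / 2)) * expR (- (k4 * rho x y ^+ 2 / t))] }.

(** ** Function spaces *)

Definition Pi (N : R) (P : borel Xi -> R) : Prop :=
  exists (m : nat) (c : nat -> R),
    P = fun x => \sum_(j < m | lam Xi j < N) c j * phi j x.

Definition diffusion_polynomial (P : borel Xi -> R) : Prop :=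
  exists N : R, Pi N P.

Definition normp (p : \bar R) (f : borel Xi -> R) : \bar R :=
  ('N[mustar Xi]_p[EFin \o f])%E.

Definition Xspace (p : \bar R) (f : borel Xi -> R) : Prop :=
  f \in Lfun (mustar Xi) p /\
  forall e : R, 0 < e -> exists2 P, diffusion_polynomial P &
    (normp p (fun x => (f x - P x)%R) < e%:E)%E.

Definition coef (f : borel Xi -> R) (k : nat) : R :=
  (\int[mustar Xi]_x (f x * phi k x))%R.

(** [f] is in the smoothness space of order [r], with [r]-th (fractional)
    derivative [g]. *)
Definition is_Delta (r : R) (p : \bar R) (f g : borel Xi -> R) : Prop :=
  [/\ Xspace p f, Xspace p g &
      forall k, coef g k = (lam Xi k + 1) `^ r * coef f k].

Definition omega (r : R) (p : \bar R) (f : borel Xi -> R) (delta : R)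
    : \bar R :=
  ereal_inf [set z | exists f1 g, is_Delta r p f1 g /\
    z = (normp p (fun x => (f x - f1 x)%R) + (delta `^ r)%:E * normp p g)%E].

(** The norm of the smoothness class of order [gamma], computed with the
    K-functional of order [r]. *)
Definition normH (r gamma : R) (p : \bar R) (f : borel Xi -> R) : \bar R :=
  (normp p f +
   ereal_sup [set (delta `^ (- gamma))%:E * omega r p f delta |
              delta in [set delta : R | (0 < delta <= 1)%R]])%E.

(** ** Kernels *)

Definition continuously_differentiable (S : nat) (f : R -> R) : Prop :=
  (forall k, (k < S)%N -> forall t : R, derivable (f^`(k))%classic t 1) /\
  continuous (f^`(S))%classic.

Definition kernel_mask (S : nat) (beta : R) (b : R -> R) : Prop :=
  [/\ forall t, b (- t) = b t,
      continuously_differentiable S b &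
      exists F : R -> R,
      [/\ forall t, 0 < t -> b t = (1 + t) `^ (- beta) * F (ln t),
          forall k, (k < S)%N -> forall t : R, derivable (F^`(k))%classic t 1,
          exists c : R, forall k, (k <= S)%N -> forall t, `|(F^`(k))%classic t| <= c &
          exists2 c1 : R, 0 < c1 & forall t, c1 <= F t]].

(** The formal expansion is read through the Fourier coefficients of the
    sections, which is meaningful when [q / p < beta]. *)
Definition kernel_of_type (S : nat) (beta : R) (p : \bar R)
    (G : borel Xi -> borel Xi -> R) : Prop :=
  exists2 b, kernel_mask S beta b &
    forall x, Xspace (hoelder_conjugate p) (G x) /\
      forall k, coef (G x) k = b (lam Xi k) * phi k x.

(** ** Measures *)

(** The infimum is over the real constants [C] that witness [d]-regularity. *)
Definition regnorm (q d : R) (nu : signed_measure Xi R) : \bar R :=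
  ereal_inf [set C%:E | C in [set C : R |
    forall x : Xi, (variation_measure nu (cball x d) <= (C * d `^ q)%:E)%E]].

Definition quadrature_measure (N : R) (nu : signed_measure Xi R) : Prop :=
  forall P, Pi N P -> charge_integral nu P = (\int[mustar Xi]_x P x)%R.

(** The three bounds that define membership, for order [N], in the class of
    approximate quadrature measures, with the constants made explicit so that
    they can be required to be uniform. *)
Definition approx_quadrature_measure (q r gamma : R) (p : \bar R)
    (C1 C2 A N : R) (nu : signed_measure Xi R) : Prop :=
  [/\ (variation_measure nu setT <= C1%:E)%E,
      (regnorm q N^-1 nu <= C2%:E)%E &
      forall P, Pi N P ->
        (`|(\int[mustar Xi]_x P x)%R - charge_integral nu P|%:E <=
         A%:E * normH r gamma p P * (N `^ (- gamma))%:E)%E].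

Definition Mp (p : \bar R) (G : borel Xi -> borel Xi -> R)
    (nu : signed_measure Xi R) : \bar R :=
  let p' := hoelder_conjugate p in
  normp p' (fun y =>
    (bochner (mustar Xi) p' nu G y -
     bochner (mustar Xi) p' (charge_of_finite_measure (mustar Xi)) G y)%R).

End data_defined_space.

(** Compactness with respect to an explicitly given topology on [T]. *)
Definition compact_for (T : Type) (tau : Topological T) (K : set T) : Prop :=
  @compact (Topological.Pack tau) K.

(* Main.v *)
Require Import Defs.
From HB Require Import structures.
From mathcomp Require Import all_boot all_order all_algebra.
From mathcomp Require Import all_classical all_reals all_analysis measurable_realfun ess_sup_inf.
From mathcomp Require Import ring lra zify.

Set Implicit Arguments.
Unset Strict Implicit.
Unset Printing Implicit Defensive.

Import Order.TTheory GRing.Theory Num.Theory.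
Import numFieldNormedType.Exports.

Local Open Scope classical_set_scope.
Local Open Scope ring_scope.

(** Write mu for [mustar], b for the mask of G and, for a diffusion polynomial P, DP for the sum of
    (coef P k / b(lam_k)) phi_k. The Bochner integral of G against nu has Fourier coefficients
    b(lam_k) int phi_k dnu ([bochner_potential]), so int P dnu - int P dmu is the pairing of DP with
    the difference of the potentials of nu and mu, and Hoelder's inequality bounds it by ||DP||_p
    M_p(nu) ([error_bound]). Two estimates remain. First, ||DP||_p <= C 2^(n(beta - gamma)) ||P||_H
    for P in Pi_(2^n), an inequality of Bernstein type ([bernstein]). Second, M_p <= C 2^(-n beta)
    for a quadrature measure of order 2^n that is regular at scale 2^-n ([Mp_quadrature]): its
    potential and that of mu have the same low-pass part, and both remainders are that small. The
    near-minimiser inherits the second estimate up to the factor C3, and the product of the two is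
    of order 2^(-n gamma).

    Both estimates are sums over dyadic frequency bands. A smooth multiplier g living at frequencies
    below 2^m has a kernel, the sum of g(k) phi_k(x) phi_k(y), of size at most 2^(mq) and decaying
    like (2^m rho)^-S ([ker_localized]). As S > q, such kernels have bounded L^1 norms; by Schur's
    test the multipliers are bounded on every L^p ([multop_bound]). Integrated against a measure
    regular at scale 2^-m0 they are bounded in L^1, and in the supremum norm up to 2^((m - m0)q), so
    by interpolation they cost 2^((m - m0)q/p) in L^p' ([charge_ker_bound]). On the m-th band b has
    size 2^(-m beta), and beta > q/p makes the bands of a potential a geometric series
    ([potential]).

    Localisation is drawn from the heat kernel bound alone. A multiplier is written as w psi(w) with
    w = exp(-lam^2/4^m), and psi is replaced by a polynomial: w^(i+1) is the heat multiplier at time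
    (i+1)/4^m, whose kernel has a Gaussian bound. This requires a form of Jackson's theorem in which
    the coefficients grow only exponentially with the degree ([jackson]), so that the Gaussian
    factor wins ([ker_poly_bound]).

    The low-pass kernel has integral 1, which forces balls to have measure at least c d^q
    ([ball_lower]); a packing argument then carries the regularity of a measure from one scale to
    all coarser ones ([covering_bound]). *)

(** * Coefficient norm of polynomials *)

Section poly_l1.
Context {R : realFieldType}.
Implicit Types p q : {poly R}.

(** This norm is submultiplicative, hence easy to follow through products and compositions. It is
    the relevant one because the polynomials are later evaluated at a heat multiplier, where each
    power is estimated separately. *)
Definition l1 p : R := \sum_(x <- p) `|x|.

Lemma l1E n p : (size p <= n)%N -> l1 p = \sum_(i < n) `|p`_i|.
Proof.
move=> pn; rewrite /l1 (big_nth 0) big_mkord.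
rewrite (big_ord_widen _ (fun i => `|p`_i|) pn) big_mkcond.
apply: eq_bigr => i _; case: ltnP => // pi.
by rewrite nth_default// normr0.
Qed.

Lemma l1_ge0 p : 0 <= l1 p.
Proof. exact: sumr_ge0. Qed.

Lemma l10 : l1 0 = 0.
Proof. by rewrite /l1 polyseq0 big_nil. Qed.

Lemma l1D p q : l1 (p + q) <= l1 p + l1 q.
Proof.
pose n := maxn (size p) (size q).
have pn : (size p <= n)%N by rewrite leq_maxl.
have qn : (size q <= n)%N by rewrite leq_maxr.
rewrite (l1E pn) (l1E qn) (@l1E n) ?(leq_trans (size_polyD _ _))//.
rewrite -big_split; apply: ler_sum => i _; rewrite coefD; exact: ler_normD.
Qed.

Lemma l1Z a p : l1 (a *: p) = `|a| * l1 p.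
Proof.
rewrite (@l1E (size p)) ?size_scale_leq// (@l1E (size p) p)// mulr_sumr.
by apply: eq_bigr => i _; rewrite coefZ normrM.
Qed.

Lemma l1N p : l1 (- p) = l1 p.
Proof. by rewrite -scaleN1r l1Z normrN1 mul1r. Qed.

Lemma l1C a : l1 a%:P = `|a|.
Proof.
rewrite /l1 polyseqC; case: eqP => [->|_]; first by rewrite big_nil normr0.
by rewrite /= big_seq1.
Qed.

Lemma l1_cons p a : l1 (p * 'X + a%:P) = l1 p + `|a|.
Proof.
rewrite -cons_poly_def /l1 polyseq_cons; case: ifPn => [_|].
  by rewrite big_cons addrC.
by rewrite negbK nilpE => /eqP ->; rewrite big_nil add0r; exact: l1C.
Qed.

Lemma l1MX p : l1 (p * 'X) = l1 p.
Proof. by rewrite -[p * 'X]addr0 -(polyC0 R) l1_cons normr0 addr0. Qed.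

Lemma l1M p q : l1 (p * q) <= l1 p * l1 q.
Proof.
elim/poly_ind: p => [|p c IH]; first by rewrite mul0r l10 mul0r.
rewrite mulrDl l1_cons mulrDl -mulrA (mulrC 'X) mulrA.
apply: (le_trans (l1D _ _)); rewrite l1MX lerD//.
by rewrite mul_polyC l1Z.
Qed.

Lemma l1X p n : l1 (p ^+ n) <= l1 p ^+ n.
Proof.
elim: n => [|n IH]; first by rewrite !expr0 -polyC1 l1C normr1.
by rewrite !exprS (le_trans (l1M _ _))// ler_wpM2l// l1_ge0.
Qed.

Lemma l1_sum (I : Type) (r : seq I) (P : pred I) (F : I -> {poly R}) :
  l1 (\sum_(i <- r | P i) F i) <= \sum_(i <- r | P i) l1 (F i).
Proof.
elim/big_rec2: _ => [|i x y _ IH]; first by rewrite l10.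
by rewrite (le_trans (l1D _ _))// lerD2l.
Qed.

Lemma l1_comp p q n : 1 <= l1 q -> (size p <= n)%N ->
  l1 (p \Po q) <= l1 p * l1 q ^+ n.
Proof.
move=> q1 pn; rewrite comp_polyE (le_trans (l1_sum _ _ _))//.
rewrite (@l1E (size p) p)// mulr_suml ler_sum// => i _.
rewrite l1Z ler_wpM2l// (le_trans (l1X _ _))// ler_weXn2l//.
by rewrite (leq_trans _ pn)// ltnW.
Qed.

Lemma ler_l1_horner p n x : (size p <= n)%N -> 0 <= x <= 1 -> `|p.[x]| <= l1 p.
Proof.
move=> pn /andP[x0 x1]; rewrite horner_coef (@l1E (size p))//.
apply: (le_trans (ler_norm_sum _ _ _)); apply: ler_sum => i _.
rewrite normrM ler_piMr// normrX exprn_ile1// ger0_norm//.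
Qed.

Definition antideriv p : {poly R} :=
  \poly_(i < (size p).+1) (if i is j.+1 then p`_j / j.+1%:R else 0).

Lemma size_antideriv p : (size (antideriv p) <= (size p).+1)%N.
Proof. exact: size_poly. Qed.

Lemma coef_antideriv p i : (antideriv p)`_i.+1 = p`_i / i.+1%:R.
Proof.
rewrite coef_poly ltnS; case: ltnP => // pi.
by rewrite nth_default// mul0r.
Qed.

Lemma antiderivK p : (antideriv p)^`() = p.
Proof.
by apply/polyP => i; rewrite coef_deriv coef_antideriv -[(_ / _) *+ _]mulr_natr divfK// pnatr_eq0.
Qed.

Lemma antideriv0 p : (antideriv p).[0] = 0.
Proof. by rewrite horner_coef0 coef_poly. Qed.

Lemma l1_antideriv p : l1 (antideriv p) <= l1 p.
Proof.
rewrite (l1E (size_antideriv p)) big_ord_recl coef_poly /= normr0 add0r.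
rewrite (@l1E (size p))// ler_sum// => i _.
rewrite coef_antideriv normrM ler_piMr// normrV ?unitfE ?pnatr_eq0//.
by rewrite invf_le1 ?normr_gt0 ?pnatr_eq0// ger0_norm// ler1n.
Qed.

End poly_l1.

(** * Polynomial approximation of a unit step *)

Section step_polynomials.
Context {R : realType}.

(* [(chebUV n).1.[sin t] = sin ((2 n + 1) t) / sin t] and
   [(chebUV n).2.[sin t] = cos ((2 n + 1) t) / cos t]. *)
Fixpoint chebUV (n : nat) : {poly R} * {poly R} :=
  if n is m.+1 then
    let: (U, V) := chebUV m in
    (U * (1%:P - 2 *: 'X^2) + 2 *: (1%:P - 'X^2) * V,
     V * (1%:P - 2 *: 'X^2) - 2 *: 'X^2 * U)
  else (1%:P, 1%:P).

Notation U n := (chebUV n).1.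
Notation V n := (chebUV n).2.

Let hE := (hornerD, hornerN, hornerM, hornerZ, hornerX, hornerC).

Lemma chebUS n x :
  (U n.+1).[x] = (U n).[x] * (1 - 2 * x ^+ 2) + 2 * (1 - x ^+ 2) * (V n).[x].
Proof. by rewrite /=; case: (chebUV n) => u v /=; rewrite !hE; ring. Qed.

Lemma chebVS n x :
  (V n.+1).[x] = (V n).[x] * (1 - 2 * x ^+ 2) - 2 * x ^+ 2 * (U n).[x].
Proof. by rewrite /=; case: (chebUV n) => u v /=; rewrite !hE; ring. Qed.

(** With x = sin t this is sin^2 + cos^2 = 1 at the angle (2n+1)t; it gives |x U_n(x)| <= 1 on
    [-1, 1]. *)
Lemma cheb_circle n x :
  x ^+ 2 * (U n).[x] ^+ 2 + (1 - x ^+ 2) * (V n).[x] ^+ 2 = 1.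
Proof.
elim: n => [|n IH]; first by rewrite /= hE; ring.
by rewrite -[RHS]IH chebUS chebVS; ring.
Qed.

Lemma cheb_bound n x : -1 <= x <= 1 -> x ^+ 4 * (U n).[x] ^+ 4 <= 1.
Proof.
move=> x1; have x2 : 0 <= 1 - x ^+ 2 by nra.
have h : (x * (U n).[x]) ^+ 2 <= 1.
  rewrite -(cheb_circle n x) exprMn lerDl mulr_ge0//; exact: sqr_ge0.
by rewrite -exprMn -(expr1n _ 2) (exprM _ 2 2) ler_pXn2r// nnegrE ?sqr_ge0.
Qed.

(** Near t = 0 the quotient sin((2n+1)t) / sin t is close to 2n+1. The recurrence is followed
    algebraically, without trigonometry. *)
Lemma cheb_lower n x : `|x| <= (4 * n.+1%:R)^-1 -> n.+1%:R <= (U n).[x].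
Proof.
move=> xn; pose N : R := n.+1%:R; have N1 : 1 <= N by rewrite ler1n.
have x2 : 16 * x ^+ 2 * N ^+ 2 <= 1.
  have : `|4 * N * x| <= 1.
    by rewrite normrM ger0_norm ?mulr_ge0// -ler_pdivlMl ?mulr_gt0// mulr1.
  by rewrite ler_norml => /andP[]; nra.
(* The induction closes only if two-sided bounds for U and V are carried together; [x2] keeps the
   correction 2 x^2 j(j+1) below 1/8. *)
suff H j : (j <= n)%N -> [/\ j.+1%:R <= (U j).[x], (U j).[x] <= 2 * j%:R + 1,
    1 - 2 * x ^+ 2 * (j%:R * (j%:R + 1)) <= (V j).[x] & (V j).[x] <= 1].
  by have [] := H n (leqnn n).
elim: j => [_|j IH jn].
  by rewrite /= hE; split; lra.
have [u1 u2 v1 v2] := IH (ltnW jn).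
rewrite chebUS chebVS -!natr1.
move: u1 u2 v1 v2; rewrite -natr1.
set u := (U j).[x]; set v := (V j).[x]; set i : R := j%:R.
have i0 : 0 <= i by [].
have iN : i + 2 <= N by rewrite /N /i -(natrD _ j 2) ler_nat addn2 ltnS.
set y := x ^+ 2 in x2 *.
have y0 : 0 <= y by exact: sqr_ge0.
have y1 : 16 * y * (i + 1) ^+ 2 <= 1 by nra.
have y2 : y * (i * (i + 1)) <= 16^-1 by nra.
have y3 : y * (2 * i + 2) <= 8^-1 by nra.
move=> u1 u2 v1 v2.
have y4 : y * (u + v) <= 8^-1 by nra.
have v0 : 0 <= v by nra.
have y5 : 0 <= y * (u + v) by nra.
split; nra.
Qed.

End step_polynomials.

Section mean_value.
Context {R : realType}.

Lemma derive_le_incr (f g df dg : R -> R) (a b : R) : a <= b ->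
  (forall x, a <= x <= b -> is_derive x 1 f (df x)) ->
  (forall x, a <= x <= b -> is_derive x 1 g (dg x)) ->
  (forall x, a <= x <= b -> df x <= dg x) -> f b - f a <= g b - g a.
Proof.
move=> ab hf hg fg.
have hd x : a <= x <= b -> is_derive x 1 (g - f) (dg x - df x).
  by move=> xab; have := hf x xab; have := hg x xab; move=> ? ?; exact: is_deriveB.
have [||c cab] := @MVT_segment R (g - f) (fun x => dg x - df x) a b ab.
- by move=> x; rewrite in_itv /= => /andP[ax xb]; apply: hd; rewrite !ltW.
- apply: derivable_within_continuous => x; rewrite in_itv /= => xab.
  by have [] := hd x xab.
rewrite !fctE => h; rewrite -subr_ge0.
have -> : g b - g a - (f b - f a) = g b - f b - (g a - f a) by ring.
rewrite h mulr_ge0// subr_ge0//; apply: fg; by move: cab; rewrite in_itv.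
Qed.

Lemma derive_lip (f df : R -> R) (M a b x y : R) : a <= x <= b -> a <= y <= b ->
  (forall x, a <= x <= b -> is_derive x 1 f (df x)) ->
  (forall x, a <= x <= b -> `|df x| <= M) -> `|f x - f y| <= M * `|x - y|.
Proof.
wlog xy : x y / x <= y.
  move=> H xab yab hf hM; case: (leP x y) => [xy|/ltW xy]; first exact: H.
  by rewrite distrC (distrC x y); apply: H.
move=> /andP[ax xb] /andP[ay yb] hf hM.
have sub z : x <= z <= y -> a <= z <= b.
  by move=> /andP[? ?]; rewrite (le_trans ax)//= (le_trans _ yb).
rewrite distrC (distrC x y) (ger0_norm (_ : 0 <= y - x)) ?subr_ge0//.
have hM' z : a <= z <= b -> - M <= df z <= M by move=> /hM; rewrite ler_norml.
have dl (c z : R) : is_derive z 1 ( *%R c) c.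
  by rewrite -[X in is_derive _ _ _ X]mulr1; exact: is_deriveZ.
rewrite ler_norml; apply/andP; split.
  rewrite -mulNr mulrBr.
  apply: (derive_le_incr (f := *%R (- M)) (df := fun=> - M) xy) => // z /sub zab.
    exact: hf.
  by have /andP[] := hM' z zab.
rewrite mulrBr.
apply: (derive_le_incr (g := *%R M) (dg := fun=> M) xy) => // z /sub zab.
  exact: hf.
by have /andP[] := hM' z zab.
Qed.

End mean_value.

Section step_polynomials2.
Context {R : realType}.

Section step.
Variable n : nat.
Let nu : R := n.+1%:R.
(** The fourth power of the Dirichlet kernel in the variable x = sin t, as in Jackson's kernel:
    nonnegative, of mass at least nu^3/2 on [-1, 1], and at most x^-4 there. Its normalised
    antiderivative is therefore a step from 0 to 1 with tails of order (nu x)^-3. *)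
Let k : {poly R} := (chebUV n).1 ^+ 4.
Let A := antideriv k.

Let nu1 : 1 <= nu. Proof. by rewrite ler1n. Qed.

Let dA (x : R) : is_derive x 1 (horner A) k.[x].
Proof. by rewrite -[k]antiderivK; exact: is_derive_poly. Qed.

Let k_ge0 x : 0 <= k.[x].
Proof. by rewrite horner_exp (exprM _ 2 2) sqr_ge0. Qed.

Let A_ndecr (x y : R) : x <= y -> A.[x] <= A.[y].
Proof.
move=> xy; rewrite -subr_ge0 -[X in X <= _](subrr (cst 0 x)).
by apply: (derive_le_incr (f := cst 0) (g := horner A) (df := fun=> 0) (dg := horner k) xy) => z _ //.
Qed.

Let Z := A.[1] - A.[-1].

(** On |x| <= 1/(4 nu), an interval of length 1/(2 nu), [cheb_lower] makes the integrand at least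
    nu^4. *)
Lemma step_mass_lower : nu ^+ 3 / 2 <= Z.
Proof.
pose a := (4 * nu)^-1.
have a0 : 0 < a by rewrite invr_gt0 mulr_gt0// (lt_le_trans _ nu1).
have nu1' := nu1.
have a1 : a <= 1.
  by rewrite invf_le1; lra.
have dl (c z : R) : is_derive z 1 ( *%R c) c.
  by rewrite -[X in is_derive _ _ _ X]mulr1; exact: is_deriveZ.
have : nu ^+ 4 * a - nu ^+ 4 * (- a) <= A.[a] - A.[- a].
  have aa : - a <= a by lra.
  apply: (derive_le_incr (f := *%R (nu ^+ 4)) (g := horner A) (df := fun=> nu ^+ 4) (dg := horner k) aa) => // z za.
  have h : nu <= (chebUV n).1.[z] by apply: cheb_lower; rewrite ler_norml.
  by rewrite horner_exp ler_pXn2r// nnegrE; lra.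
have -> : nu ^+ 4 * a - nu ^+ 4 * - a = nu ^+ 3 / 2.
  by rewrite /a; field; rewrite gt_eqF//; lra.
move=> /le_trans; apply; rewrite /Z lerB// A_ndecr//; lra.
Qed.

Let Z_gt0 : 0 < Z.
Proof. by rewrite (lt_le_trans _ step_mass_lower)// divr_gt0// exprn_gt0// (lt_le_trans _ nu1). Qed.

(** Away from 0 the integrand is at most z^-4 by [cheb_bound], and -1/(3 z^3) is an antiderivative
    of that. *)
Let A_tail (x y : R) : 0 < x -> x <= y -> y <= 1 ->
  A.[y] - A.[x] <= (3 * x ^+ 3)^-1 /\ A.[- x] - A.[- y] <= (3 * x ^+ 3)^-1.
Proof.
move=> x0 xy y1.
have dg z : x <= z <= y -> is_derive z 1 (fun z => - (3 * z ^+ 3)^-1) (z ^- 4).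
  move=> /andP[xz zy].
  have z0 : z != 0 by rewrite gt_eqF// (lt_le_trans x0).
  have z3 : 3 * z ^+ 3 != 0 by rewrite mulf_neq0 ?expf_neq0// pnatr_eq0.
  have d3 : is_derive z 1 (fun z : R => 3 * z ^+ 3) (3 * (3 * z ^+ 2)).
    have -> : (fun z => 3 * z ^+ 3) = ((3 \*: (@id R) ^+ 3) : R -> R).
      by apply/funext => t; rewrite /= fctE.
    by apply: is_derive_eq; rewrite /GRing.scale /= mulr1.
  refine (is_derive_eq (is_deriveN (@is_deriveV R (fun z => 3 * z ^+ 3) z _ 1 z3 d3)) _).
  by rewrite /GRing.scale /=; field.
have kle z : x <= z <= y -> k.[z] <= z ^- 4.
  move=> /andP[xz zy]; have z0 : 0 < z by rewrite (lt_le_trans x0).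
  rewrite -[leRHS]mul1r ler_pdivlMr ?exprn_gt0// mulrC horner_exp.
  by apply: cheb_bound; lra.
have kle' z : x <= z <= y -> k.[- z] <= z ^- 4.
  move=> /andP[xz zy]; have z0 : 0 < z by rewrite (lt_le_trans x0).
  rewrite -[leRHS]mul1r ler_pdivlMr ?exprn_gt0// mulrC horner_exp.
  have -> : z ^+ 4 = (- z) ^+ 4 by ring.
  by apply: cheb_bound; lra.
have up : - (3 * y ^+ 3)^-1 - - (3 * x ^+ 3)^-1 <= (3 * x ^+ 3)^-1.
  rewrite opprK gerDr oppr_le0 invr_ge0 mulr_ge0// exprn_ge0//.
  by rewrite (le_trans (ltW x0)).
split; first by apply: le_trans up; exact: (derive_le_incr xy _ dg kle).
apply: le_trans up.
have -> : A.[- x] - A.[- y] = (- A.[- y]) - (- A.[- x]) by ring.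
apply: (derive_le_incr (f := fun z => - A.[- z]) xy _ dg kle') => z _.
refine (is_derive_eq (is_deriveN
  (@is_derive1_comp R (horner A) -%R z _ _ (dA (- z)) (is_deriveNid z 1))) _).
by ring.
Qed.

Definition step_poly : {poly R} := Z^-1 *: (A - A.[-1]%:P).

Lemma step_polyE x : step_poly.[x] = (A.[x] - A.[-1]) / Z.
Proof. by rewrite /step_poly hornerZ hornerD hornerN hornerC mulrC. Qed.

Lemma step_poly01 x : -1 <= x <= 1 -> 0 <= step_poly.[x] <= 1.
Proof.
move=> /andP[x1 x2]; rewrite step_polyE; apply/andP; split.
  by rewrite divr_ge0 ?subr_ge0 ?A_ndecr ?(ltW Z_gt0).
by rewrite ler_pdivrMr ?Z_gt0// mul1r lerB// A_ndecr.
Qed.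

Lemma step_poly_tail x : 0 < x <= 1 ->
  1 - step_poly.[x] <= (nu * x) ^- 3 /\ step_poly.[- x] <= (nu * x) ^- 3.
Proof.
move=> /andP[x0 x1]; have [t1 t2] := A_tail x0 x1 (lexx 1).
have bnd : (3 * x ^+ 3)^-1 <= Z * (nu * x) ^- 3.
  have nx : 0 < x ^+ 3 by rewrite exprn_gt0.
  have n3 : 0 < nu ^+ 3 by rewrite exprn_gt0// (lt_le_trans _ nu1).
  have zl := step_mass_lower.
  have -> : (nu * x) ^+ 3 = nu ^+ 3 * x ^+ 3 by rewrite exprMn.
  move: nx n3 zl.
  generalize (x ^+ 3) (nu ^+ 3) => X N X0 N0 zl.
  have -> : (3 * X)^-1 = 3^-1 / X by rewrite invfM.
  have -> : Z / (N * X) = Z / N / X by rewrite invfM mulrA.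
  by rewrite ler_pM2r ?invr_gt0// ler_pdivlMr//; apply: le_trans zl; lra.
rewrite !step_polyE; split.
  have -> : 1 - (A.[x] - A.[-1]) / Z = (A.[1] - A.[x]) / Z.
    by rewrite /Z; field; exact: lt0r_neq0 Z_gt0.
  by rewrite ler_pdivrMr ?Z_gt0// mulrC; apply: le_trans bnd; exact: t1.
by rewrite ler_pdivrMr ?Z_gt0// mulrC; apply: le_trans bnd; exact: t2.
Qed.

End step.

Lemma chebUV_size n : (size (@chebUV R n).1 <= 2 * n + 1)%N /\
  (size (@chebUV R n).2 <= 2 * n + 1)%N.
Proof.
have s2 (c : R) (p : {poly R}) m : (size p <= m)%N ->
    (size ((1%:P - c *: 'X^2) * p)%R <= m.+2)%N.
  move=> pm; apply: (leq_trans (size_polyMleq _ _)).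
  have : (size (1%:P - c *: 'X^2 : {poly R})%R <= 3)%N.
    rewrite (leq_trans (size_polyD _ _))// geq_max size_polyN.
    rewrite (leq_trans (size_polyC_leq1 _))//=.
    by rewrite (leq_trans (size_scale_leq _ _))// size_polyXn.
  by move=> h; rewrite -subn1 leq_subLR -[(1 + _)%N]/(3 + m)%N leq_add.
elim: n => [|n [IHU IHV]] /=; first by rewrite !size_polyC oner_eq0.
case: (chebUV n) IHU IHV => U V /= IHU IHV.
have e : (2 * n.+1 + 1 = (2 * n + 1).+2)%N by lia.
rewrite e; split; apply: (leq_trans (size_polyD _ _)); rewrite geq_max.
- rewrite mulrC s2//= -scalerAl (leq_trans (size_scale_leq _ _))//.
  by rewrite -['X^2]scale1r s2.
- rewrite mulrC s2//= size_polyN -scalerAl (leq_trans (size_scale_leq _ _))//.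
  by rewrite (leq_trans (size_polyMleq _ _))// size_polyXn /= !addSn add0n !ltnS.
Qed.

Lemma step_poly_size n : (size (@step_poly n) <= 8 * n + 6)%N.
Proof.
rewrite (leq_trans (size_scale_leq _ _))// (leq_trans (size_polyD _ _))//.
rewrite geq_max size_polyN (leq_trans (size_polyC_leq1 _)) ?andbT; last by lia.
rewrite (leq_trans (size_antideriv _))//.
have h := (chebUV_size n).1.
apply: (@leq_trans ((2 * n + 1).-1 * 4).+2); last by lia.
rewrite ltnS (leq_trans (size_poly_exp_leq _ _))//.
by rewrite ltnS leq_mul2r /= -!subn1 leq_sub2r.
Qed.

(** The recurrence enlarges the sum of the two norms by a bounded factor; 9 is generous. *)
Lemma chebUV_l1 n : l1 (@chebUV R n).1 + l1 (@chebUV R n).2 <= (9 : R) ^+ n.+1.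
Proof.
have l1s (c : R) : l1 (1%:P - c *: 'X^2) <= 1 + `|c|.
  rewrite (le_trans (l1D _ _))// l1C normr1 lerD2l l1N l1Z.
  by rewrite ler_piMr// (le_trans (l1X _ _))// -['X]mul1r l1MX -polyC1 l1C normr1 expr1n.
have l1x2 : l1 ('X^2 : {poly R}) <= 1.
  by rewrite (le_trans (l1X _ _))// -['X]mul1r l1MX -polyC1 l1C normr1 expr1n.
elim: n => [|n] /=; first by rewrite l1C normr1; lra.
case: (chebUV n) => U V /= IH; rewrite exprS.
apply: le_trans (_ : 9 * (l1 U + l1 V) <= _); last by rewrite ler_wpM2l.
have u0 := l1_ge0 U; have v0 := l1_ge0 V.
have b1 : l1 (U * (1%:P - 2 *: 'X^2)) <= 3 * l1 U.
  rewrite (le_trans (l1M _ _))// mulrC ler_wpM2r// (le_trans (l1s _))//.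
  by rewrite ger0_norm//; lra.
have b2 : l1 (V * (1%:P - 2 *: 'X^2)) <= 3 * l1 V.
  rewrite (le_trans (l1M _ _))// mulrC ler_wpM2r// (le_trans (l1s _))//.
  by rewrite ger0_norm//; lra.
have b3 : l1 (2 *: (1%:P - 'X^2) * V) <= 4 * l1 V.
  rewrite (le_trans (l1M _ _))// ler_wpM2r// l1Z ger0_norm//.
  have := l1s 1; rewrite scale1r normr1; lra.
have b4 : l1 (2 *: 'X^2 * U) <= 2 * l1 U.
  rewrite (le_trans (l1M _ _))// ler_wpM2r// l1Z ger0_norm//; lra.
have := l1D (U * (1%:P - 2 *: 'X^2)) (2 *: (1%:P - 'X^2) * V).
have := l1D (V * (1%:P - 2 *: 'X^2)) (- (2 *: 'X^2 * U)).
rewrite l1N; lra.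
Qed.

(** Exponential growth in the degree is affordable, since a Gaussian factor will absorb it. Dividing
    by the mass is harmless because the mass is at least 1/2. *)
Lemma step_poly_l1 : exists2 C : R, 1 <= C & forall n, l1 (@step_poly n) <= C ^+ n.+1.
Proof.
exists (4 * 9 ^+ 4); first by rewrite !exprS; lra.
move=> n; rewrite l1Z; set Z := (X in X^-1).
have nu1 : 1 <= n.+1%:R :> R by rewrite ler1n.
have Z1 : 2^-1 <= Z.
  apply: le_trans (step_mass_lower n); rewrite -[leLHS]mul1r ler_pM2r ?invr_gt0//.
  exact: exprn_ege1.
have Zi : `|Z^-1| <= 2.
  rewrite ger0_norm ?invr_ge0; last by lra.
  by rewrite -[2]invrK lef_pV2 ?posrE ?invr_gt0//; lra.
rewrite exprMn; apply: (le_trans (y := 2 * (2 * (9 ^+ 4) ^+ n.+1))); last first.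
  rewrite mulrA ler_wpM2r// ?exprn_ge0//.
  by rewrite exprS -[leLHS]mulr1 -mulrA mulrA ler_pM ?exprn_ege1//; lra.
apply: ler_pM => //; first exact: l1_ge0.
rewrite (le_trans (l1D _ _))// l1N l1C.
have h : l1 (antideriv ((@chebUV R n).1 ^+ 4)) <= ((9:R) ^+ 4) ^+ n.+1.
  rewrite (le_trans (l1_antideriv _))// (le_trans (l1X _ _))// exprAC.
  rewrite ler_pXn2r ?nnegrE ?l1_ge0 ?exprn_ge0// (le_trans _ (chebUV_l1 n))//.
  by rewrite lerDl l1_ge0.
suff : `|(antideriv ((@chebUV R n).1 ^+ 4)).[-1]| <= l1 (antideriv ((@chebUV R n).1 ^+ 4) : {poly R}) by lra.
rewrite horner_coef (@l1E _ (size (antideriv ((@chebUV R n).1 ^+ 4))))//.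
rewrite (le_trans (ler_norm_sum _ _ _))// ler_sum// => i _.
by rewrite normrM normrX normrN1 expr1n mulr1.
Qed.

End step_polynomials2.

(** * Jackson's theorem with control of the coefficients *)

Section jackson.
Context {R : realType}.

(** With truncated subtraction, (m - i) + (i - m) is |m - i|. Both sides of m telescope through
    1/(k+2)^2 <= 1/(k+1) - 1/(k+2). *)
Lemma sum_inv_dist_sqr (m N : nat) :
  \sum_(i < N) (((m - i) + (i - m)).+1%:R ^- 2 : R) <= 3.
Proof.
have key (k : nat) : (k.+2%:R ^- 2 : R) <= k.+1%:R^-1 - k.+2%:R^-1.
  have k0 : 0 < k.+1%:R :> R by [].
  rewrite -!natr1 in k0 *; move: (k%:R) k0 => t t0.
  rewrite -subr_ge0.
  have -> : (t + 1)^-1 - (t + 1 + 1)^-1 - (t + 1 + 1) ^- 2 =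
     ((t + 1) * (t + 1 + 1) ^+ 2)^-1.
    by field; apply/andP; split; rewrite gt_eqF//; lra.
  by rewrite invr_ge0 mulr_ge0 ?sqr_ge0// ltW.
have A n : (n <= m)%N ->
    \sum_(i < n) (((m - i) + (i - m)).+1%:R ^- 2 : R) <= (m - n).+1%:R^-1.
  elim: n => [_|n IH nm]; first by rewrite big_ord0 invr_ge0.
  rewrite big_ord_recr /=; have {}IH := IH (ltnW nm).
  have -> : ((m - n + (n - m)).+1 = (m - n.+1).+2)%N by lia.
  apply: le_trans (lerD IH (key _)) _.
  have -> : ((m - n).+1 = (m - n.+1).+2)%N by lia.
  by rewrite addrC subrK.
have B j : \sum_(i < m + j.+1) (((m - i) + (i - m)).+1%:R ^- 2 : R) <= 3 - j.+1%:R^-1.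
  elim: j => [|j IH].
    rewrite addn1 big_ord_recr /= subnn addn0 expr1n invr1.
    by have := A m (leqnn m); rewrite subnn invr1; lra.
  rewrite addnS big_ord_recr /=.
  have -> : ((m - (m + j.+1) + (m + j.+1 - m)).+1 = j.+2)%N by lia.
  by apply: le_trans (lerD IH (key _)) _; rewrite addrA subrK.
case: (leqP N m) => [/A /le_trans|mN].
  apply; apply: le_trans (_ : 1 <= _); last by lra.
  by rewrite invf_le1 ?ler1n.
have := B (N - m.+1)%N; have -> : (m + (N - m.+1).+1 = N)%N by lia.
move/le_trans; apply; rewrite gerBl invr_ge0//.
Qed.

(** Here m is the cell of x in the grid of mesh 1/N, and the shifted step polynomial imitates the
    indicator of i < m. The cubic tail leaves a summable inverse square; at the two nodes i = m and
    i = m + 1 only the trivial bound 1 is available. *)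
Lemma step_poly_node (n m i : nat) (x a N : R) : N = n.+1%:R ->
  N * a = i%:R -> m%:R <= x * N -> x * N < m.+1%:R ->
  0 <= x <= 1 -> 0 <= a <= 1 ->
  `|(i < m)%:R - (@step_poly R n).[x - a]| <= 48 * ((m - i) + (i - m)).+1%:R ^- 2.
Proof.
move=> NE aN xm1 xm2 /andP[x0 x1] /andP[a0 a1].
have N1 : 1 <= N by rewrite NE ler1n.
have s01 : 0 <= (@step_poly R n).[x - a] <= 1 by apply: step_poly01; lra.
have tail := @step_poly_tail R n; rewrite -NE in tail.
have dk k u : (k >= 1)%N -> k%:R <= N * u ->
    (N * u) ^- 3 <= 48 * (k.+3%:R ^- 2 : R).
  move=> k1; have : 1 <= k%:R :> R by rewrite ler1n.
  rewrite -!natr1.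
  clear k1; move: (k%:R) (N * u) => {}k {}u k1 ku.
  apply: le_trans (_ : k ^- 3 <= _).
    by rewrite lef_pV2 ?posrE ?exprn_gt0 ?ler_pXn2r ?nnegrE//; lra.
  rewrite ler_pdivlMr ?exprn_gt0//; last by lra.
  rewrite mulrC ler_pdivrMr ?exprn_gt0//; last by lra.
  nra.
case: ltnP => im.
  have mi1 : 1 <= (m - i)%:R :> R by rewrite ler1n subn_gt0.
  have xi : (m - i)%:R <= N * (x - a).
    by rewrite natrB ?(ltnW im)// mulrBr aN (mulrC N) lerB.
  have -> : (i - m = 0)%N by apply/eqP; rewrite subn_eq0 ltnW.
  have xi0 : 0 < x - a <= 1 by apply/andP; split; nra.
  rewrite -[true%:R]/(1 : R) ger0_norm; last by lra.
  have [+ _] := tail _ xi0; move/le_trans; apply.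
  apply: le_trans (dk (m - i)%N _ _ xi) _; first by rewrite subn_gt0.
  rewrite addn0 ler_pM2l// lef_pV2 ?posrE ?exprn_gt0//.
  by rewrite ler_pXn2r ?nnegrE// ler_nat ltnS leqW.
have -> : (m - i = 0)%N by apply/eqP; rewrite subn_eq0.
rewrite add0n -[false%:R]/(0 : R) sub0r normrN ger0_norm; last by lra.
have [|k1] := leqP (i - m) 1%N.
  move=> k1; apply: le_trans (_ : 1 <= _); first by lra.
  have : (i - m).+1%:R <= 2 :> R by rewrite (ler_nat R _ 2).
  have : 1 <= (i - m).+1%:R :> R by rewrite ler1n.
  move: ((i - m).+1%:R) => t t1 t2; rewrite ler_pdivlMr ?exprn_gt0//; [nra|].
  exact: lt_le_trans t1.
have [k ek] : exists k, (i - m = k.+2)%N.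
  by exists (i - m).-2; case: (i - m)%N k1 => [|[]].
have ei : (i = m.+1 + k.+1)%N by rewrite addSnnS -ek subnKC.
have mi1 : 1 <= k.+1%:R :> R by rewrite ler1n.
have xi : k.+1%:R <= N * (a - x).
  rewrite mulrBr aN ei natrD (mulrC N); lra.
have xi0 : 0 < a - x <= 1 by apply/andP; split; nra.
have [_ +] := tail _ xi0; rewrite opprB ek; move/le_trans; apply.
apply: le_trans (dk k.+1 _ _ xi) _ => //.
rewrite ler_pM2l// lef_pV2 ?posrE ?exprn_gt0//.
by rewrite ler_pXn2r ?nnegrE// ler_nat.
Qed.

(** The staircase of h on the grid i/N has jumps of at most e/N. Each jump is carried by a shifted
    step polynomial, and the errors sum to a constant times e/N by [sum_inv_dist_sqr]. *)
Lemma lip_approx : exists2 C : R, 1 <= C &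
  forall (h : R -> R) (e H : R) (n : nat), 0 <= e ->
    (forall x y, 0 <= x <= 1 -> 0 <= y <= 1 -> `|h x - h y| <= e * `|x - y|) ->
    `|h 0| <= H ->
  exists Q : {poly R}, [/\ (size Q <= 8 * n + 6)%N,
    forall x, 0 <= x <= 1 -> `|h x - Q.[x]| <= 200 * e / n.+1%:R &
    l1 Q <= (H + e) * C ^+ n.+1].
Proof.
have [C0 C01 SC] := @step_poly_l1 R.
(* [C0] comes from the step polynomial; the shift by a node has coefficient norm at most 2, raised
   to the size bound 8n + 6 <= 8(n + 1). *)
exists (C0 * 2 ^+ 8); first by rewrite !exprS; lra.
move=> h e H n e0 hl hH.
pose N : R := n.+1%:R; have N1 : 1 <= N by rewrite ler1n.
pose a (i : nat) : R := i%:R / N.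
have N0 : 0 < N by apply: lt_le_trans N1.
have aN i : N * a i = i%:R by rewrite /a mulrC divfK// gt_eqF.
have a01 i : (i <= n.+1)%N -> 0 <= a i <= 1.
  move=> iN; rewrite /a divr_ge0//= ?ler_pdivrMr ?mul1r ?ler_nat//; lra.
pose D (i : nat) := h (a i.+1) - h (a i).
have aS i : a i.+1 - a i = N^-1 by rewrite /a -mulrBl -natrB// subSnn mul1r.
have Dle i : (i < n.+1)%N -> `|D i| <= e / N.
  move=> iN; rewrite (le_trans (hl _ _ _ _)) ?a01//; first exact: ltnW.
  by rewrite aS ger0_norm// invr_ge0; lra.
exists ((h 0)%:P + \sum_(i < n.+1) D i *: (step_poly n \Po ('X - (a i)%:P))).
split.
- rewrite (leq_trans (size_polyD _ _))// geq_max.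
  rewrite (leq_trans (size_polyC_leq1 _)) /=; last by lia.
  apply: (leq_trans (size_sum _ _ _)); apply/bigmax_leqP => i _.
  rewrite (leq_trans (size_scale_leq _ _))// size_comp_poly2 ?size_XsubC//.
  exact: step_poly_size.
- move=> x /andP[x0 x1].
  pose m := Num.truncn (x * N).
  have [xm1 xm2] : m%:R <= x * N /\ x * N < m.+1%:R.
    by apply/andP; apply: truncn_itv; rewrite mulr_ge0//; lra.
  have mN : (m <= n.+1)%N.
    rewrite -(ler_nat R) (le_trans xm1)// -[leRHS]mul1r ler_wpM2r//; lra.
  have am : a m <= x by rewrite /a ler_pdivrMr//; lra.
  have xa : x - a m <= N^-1.
    have e1 : a m + N^-1 = (m%:R + 1) / N by rewrite /a mulrDl mul1r.
    rewrite lerBlDl e1 ler_pdivlMr; last by lra.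
    by rewrite natr1 ltW.
  have tel k : h (a k) - h 0 = \sum_(i < k) D i.
    elim: k => [|k IH]; first by rewrite big_ord0 /a mul0r subrr.
    by rewrite big_ord_recr /= -IH /D; ring.
  have tel2 : h (a m) - h 0 = \sum_(i < n.+1) D i * (i < m)%:R.
    rewrite tel (big_ord_widen _ D mN) big_mkcond; apply: eq_bigr => i _ /=.
    by case: (i < m)%N; rewrite ?mulr1 ?mulr0.
  have stp i : (i < n.+1)%N ->
      `|(i < m)%:R - (@step_poly R n).[x - a i]| <= 48 * ((m - i) + (i - m)).+1%:R ^- 2.
    by move=> iN; apply: (@step_poly_node _ _ _ _ _ N); rewrite ?x0// a01// ltnW.
  rewrite hornerD hornerC horner_sum.
  have -> : h x - (h 0 + \sum_(i < n.+1) (D i *: (step_poly n \Po ('X - (a i)%:P))).[x]) =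
      (h x - h (a m)) + \sum_(i < n.+1) D i * ((i < m)%:R - (@step_poly R n).[x - a i]).
    have -> : \sum_(i < n.+1) D i * ((i < m)%:R - (@step_poly R n).[x - a i]) =
        \sum_(i < n.+1) D i * (i < m)%:R -
        \sum_(i < n.+1) (D i *: (step_poly n \Po ('X - (a i)%:P))).[x].
      rewrite -sumrB; apply: eq_bigr => i _; rewrite mulrBr.
      by congr (_ - _); rewrite [RHS]hornerZ horner_comp hornerXsubC.
    by rewrite -tel2; ring.
  rewrite (le_trans (ler_normD _ _))//.
  have e1 : `|h x - h (a m)| <= e / N.
    rewrite (le_trans (hl _ _ _ _)) ?a01 ?x0//.
    by rewrite ler_wpM2l// ger0_norm// subr_ge0.
  have eN : 0 <= e / N by rewrite divr_ge0// ltW.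
  have e2 : `|\sum_(i < n.+1) D i * ((i < m)%:R - (@step_poly R n).[x - a i])| <= e / N * (48 * 3).
    rewrite (le_trans (ler_norm_sum _ _ _))//.
    apply: le_trans (_ : \sum_(i < n.+1) e / N * (48 * ((m - i) + (i - m)).+1%:R ^- 2) <= _).
      by apply: ler_sum => i _; rewrite normrM ler_pM// ?Dle ?stp.
    rewrite -mulr_sumr ler_wpM2l//.
    by rewrite -mulr_sumr ler_pM2l// sum_inv_dist_sqr.
  apply: le_trans (lerD e1 e2) _.
  have -> : 200 * e / N = 200 * (e / N) by rewrite mulrA.
  move: (e / N) eN => t; lra.
rewrite (le_trans (l1D _ _))// l1C mulrDl lerD//.
  by rewrite (le_trans hH)// ler_peMr ?exprn_ege1// ?(le_trans (normr_ge0 _) hH)// !exprS; lra.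
rewrite (le_trans (l1_sum _ _ _))//.
apply: le_trans (_ : \sum_(i < n.+1) (e / N * (C0 * 2 ^+ 8) ^+ n.+1) <= _); last first.
  rewrite sumr_const card_ord -[X in X <= _]mulr_natr.
  move: ((_ * _) ^+ _) => B; rewrite -[n.+1%:R]/N.
  by have -> : e / N * B * N = e * B by field; rewrite gt_eqF.
apply: ler_sum => i _; rewrite l1Z ler_pM ?l1_ge0 ?Dle//.
have la : l1 ('X - (a i)%:P) = 1 + `|a i|.
  by rewrite -[X in X - _]mul1r -polyCN l1_cons -polyC1 l1C normr1 normrN.
have /andP[ai0 ai1] := a01 i (ltnW (ltn_ord i)).
rewrite (le_trans (l1_comp _ (step_poly_size n)))//; first by rewrite la lerDl.
rewrite exprMn ler_pM ?l1_ge0 ?exprn_ge0 ?l1_ge0//.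
rewrite la ger0_norm// -exprM (le_trans (_ : _ <= 2 ^+ (8 * n + 6)))//.
  apply: lerXn2r; rewrite ?nnegrE ?addr_ge0//.
  by rewrite -[2]/(1 + 1) lerD2l.
apply: ler_weXn2l; first by lra.
by rewrite mulnS addnC leq_add2r.
Qed.

End jackson.

Section jackson2.
Context {R : realType}.

(** Induction on k: if P' approximates the derivative of f within e, then f minus the antiderivative
    of P' is e-Lipschitz, and [lip_approx] gains one more factor 1/(n+1). *)
Lemma jackson (k : nat) : exists2 C : R, 1 <= C &
  forall (f : R -> R) (M : R) (n : nat),
    (forall j x, (j < k)%N -> 0 <= x <= 1 -> derivable (f^`(j))%classic x 1) ->
    (forall j x, (j <= k)%N -> 0 <= x <= 1 -> `|(f^`(j))%classic x| <= M) ->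
  exists P : {poly R}, [/\ (size P <= 8 * n + 6 + k)%N,
    forall x, 0 <= x <= 1 -> `|f x - P.[x]| <= C * M / n.+1%:R ^+ k &
    l1 P <= M * C ^+ n.+1].
Proof.
elim: k => [|k [C C1 IH]].
  exists 1 => // f M n _ fM; exists 0; split; first by rewrite size_poly0.
    by move=> x x01; rewrite horner0 subr0 mul1r expr0 divr1 (fM 0%N).
  rewrite l10 expr1n mulr1; apply: le_trans (fM 0%N 0 _ _) => //.
  by rewrite lexx ler01.
have [D D1 lip] := @lip_approx R.
pose B := 200 * (1 + C) * D.
have B1 : 1 <= B by rewrite /B; nra.
exists (2 * B); first by lra.
move=> f M n fd fM.
have M0 : 0 <= M.
  by apply: le_trans (fM 0%N 0 _ _); rewrite ?lexx ?ler01.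
have [||P' [sP' eP' lP']] := IH (f^`())%classic M n.
- by move=> j x jk x01; rewrite -derive1Sn; exact: fd.
- by move=> j x jk x01; rewrite -derive1Sn; exact: fM.
pose e := C * M / n.+1%:R ^+ k.
have nk : 1 <= n.+1%:R ^+ k :> R by rewrite exprn_ege1// ler1n.
have e0 : 0 <= e by rewrite /e divr_ge0 ?mulr_ge0//; lra.
have eCM : e <= C * M by rewrite /e ler_piMr ?mulr_ge0// ?invf_le1//; lra.
pose h x := f x - (antideriv P').[x].
have hd (x : R) : 0 <= x <= 1 -> is_derive x 1 h ((f^`())%classic x - P'.[x]).
  move=> x01; apply: is_deriveB.
    rewrite derive1E; exact/derivableP/(fd 0%N).
  by rewrite -[P' in P'.[x]]antiderivK; exact: is_derive_poly.
have [||Q [sQ eQ lQ]] := lip h e M n e0.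
- move=> x y x01 y01.
  by apply: (derive_lip x01 y01 hd) => z z01; exact: eP'.
- by rewrite /h antideriv0 subr0 (fM 0%N)// lexx ler01.
exists (antideriv P' + Q); split.
- rewrite (leq_trans (size_polyD _ _))// geq_max; apply/andP; split.
    by rewrite (leq_trans (size_antideriv _))// addnS ltnS.
  by rewrite (leq_trans sQ)// leq_addr.
- move=> x x01; rewrite hornerD opprD addrA -/(h x).
  apply: le_trans (eQ x x01) _.
  have -> : 200 * e / n.+1%:R = 200 * C * M / n.+1%:R ^+ k.+1.
    have N0 : n.+1%:R != 0 :> R by rewrite pnatr_eq0.
    rewrite /e exprS; move: (n.+1%:R) N0 => N N0.
    by field; rewrite N0 expf_neq0.
  by rewrite ler_wpM2r ?invr_ge0 ?exprn_ge0// ler_wpM2r// /B; nra.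
rewrite (le_trans (l1D _ _))//.
have h1 : l1 (antideriv P') <= M * B ^+ n.+1.
  rewrite (le_trans (l1_antideriv _))// (le_trans lP')// ler_wpM2l//.
  by apply: lerXn2r; rewrite ?nnegrE /B; nra.
have h2 : l1 Q <= M * B ^+ n.+1.
  rewrite (le_trans lQ)//; apply: le_trans (_ : M * ((1 + C) * D ^+ n.+1) <= _).
    rewrite mulrA ler_wpM2r ?exprn_ge0//; first by lra.
    by rewrite mulrDr mulr1 lerD2l mulrC.
  rewrite ler_wpM2l// /B exprMn ler_wpM2r ?exprn_ge0//; first by lra.
  apply: le_trans (_ : 200 * (1 + C) <= _); first by lra.
  by apply: ler_eXnr => //; lra.
apply: le_trans (lerD h1 h2) _; rewrite (exprMn _ 2 B).
have -> : M * B ^+ n.+1 + M * B ^+ n.+1 = M * (2 * B ^+ n.+1) by ring.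
rewrite ler_wpM2l// ler_wpM2r ?exprn_ge0//; first by lra.
by rewrite exprS ler_peMr// exprn_ege1//; lra.
Qed.

End jackson2.

(** * Families of functions with uniform bounds on derivatives *)

Section uniformly_smooth.
Context {R : realType} {I : Type}.
Implicit Types (f g : I -> R -> R) (D E : set R).

(* [f] is a family of functions of class C^k on [D], with bounds on the
   derivatives that are uniform over the family. *)
Fixpoint usmooth (k : nat) (D : set R) (f : I -> R -> R) : Prop :=
  (exists M : R, forall i t, D t -> `|f i t| <= M) /\
  if k is k'.+1 then
    (forall i t, D t -> derivable (f i) t 1) /\
    usmooth k' D (fun i => (f i)^`()%classic)
  else True.

Lemma usmooth_bound k D f : usmooth k D f ->
  exists M : R, forall i t, D t -> `|f i t| <= M.
Proof. by case: k => [|k] []. Qed.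

Lemma usmoothW k D f : usmooth k.+1 D f -> usmooth k D f.
Proof.
elim: k f => [|k IH] f [fM [df sf]]; first by split.
by split => //; split => //; exact: IH.
Qed.

Lemma usmooth_le j k D f : (j <= k)%N -> usmooth k D f -> usmooth j D f.
Proof.
move=> jk sf; rewrite -(subnKC jk) in sf; move: sf; elim: (k - j)%N => [|m IH]; first by rewrite addn0.
by rewrite addnS => /usmoothW.
Qed.

Lemma usmooth_sub k D E f : E `<=` D -> usmooth k D f -> usmooth k E f.
Proof.
move=> ED; elim: k f => [|k IH] f [[M fM] h].
  by split => //; exists M => i t /ED; exact: fM.
case: h => df sf; split; first by exists M => i t /ED; exact: fM.
by split; [move=> i t /ED; exact: df|exact: IH].
Qed.

Lemma usmooth_eq k D f g : open D -> (forall i t, D t -> f i t = g i t) ->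
  usmooth k D f -> usmooth k D g.
Proof.
move=> oD; elim: k f g => [|k IH] f g fg [[M fM] h].
  by split => //; exists M => i t Dt; rewrite -fg//; exact: fM.
have nfg i t : D t -> \forall y \near t, f i y = g i y.
  by move=> Dt; apply: filterS (open_nbhs_nbhs (conj oD Dt)) => y; exact: fg.
case: h => df sf; split; first by exists M => i t Dt; rewrite -fg//; exact: fM.
split.
  move=> i t Dt; apply: (near_eq_derivable (f := f i)) => //; [exact: nfg|exact: df].
apply: IH sf => i t Dt; rewrite !derive1E; apply: near_eq_derive; exact: nfg.
Qed.

Lemma usmoothU k D E f : usmooth k D f -> usmooth k E f -> usmooth k (D `|` E) f.
Proof.
elim: k f => [|k IH] f [[M fM] h] [[M' fM'] h'].
  split => //; exists (Num.max M M') => i t [] ?.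
    by rewrite le_max fM.
  by rewrite le_max fM' ?orbT.
split.
  exists (Num.max M M') => i t [] ?.
    by rewrite le_max fM.
  by rewrite le_max fM' ?orbT.
case: h h' => df sf [df' sf']; split; last exact: IH.
by move=> i t [] ?; [exact: df|exact: df'].
Qed.

Lemma usmoothD k D f g : open D -> usmooth k D f -> usmooth k D g ->
  usmooth k D (fun i => f i + g i).
Proof.
move=> oD; elim: k f g => [|k IH] f g [[M fM] h] [[M' gM'] h'].
  split => //; exists (M + M') => i t Dt.
  by rewrite (le_trans (ler_normD _ _))// lerD ?fM ?gM'.
split.
  exists (M + M') => i t Dt.
  by rewrite (le_trans (ler_normD _ _))// lerD ?fM ?gM'.
case: h h' => df sf [dg sg]; split.
  by move=> i t Dt; apply: derivableD; [exact: df|exact: dg].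
apply: usmooth_eq (IH _ _ sf sg) => // i t Dt.
by rewrite !fctE !derive1E deriveD//; [exact: df|exact: dg].
Qed.

Lemma usmoothM k D f g : open D -> usmooth k D f -> usmooth k D g ->
  usmooth k D (fun i => f i * g i).
Proof.
move=> oD; elim: k f g => [|k IH] f g.
  move=> [[M fM] h] [[M' gM'] h'].
  split => //; exists (M * M') => i t Dt.
  by rewrite normrM ler_pM ?fM ?gM'.
move=> sf sg; have [[M fM] [df sdf]] := sf; have [[M' gM'] [dg sdg]] := sg.
split.
  exists (M * M') => i t Dt.
  by rewrite normrM ler_pM ?fM ?gM'.
split.
  by move=> i t Dt; apply: derivableM; [exact: df|exact: dg].
have := usmoothD oD (IH _ _ (usmoothW sf) sdg) (IH _ _ (usmoothW sg) sdf).
apply: usmooth_eq => // i t Dt.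
by rewrite !fctE !derive1E deriveM//; [exact: df|exact: dg].
Qed.

Lemma usmooth_cst k D (c : I -> R) (M : R) : (forall i, `|c i| <= M) ->
  usmooth k D (fun i => cst (c i)).
Proof.
have z : forall j, usmooth j D (fun=> cst 0).
  elim=> [|j IH]; split => //; try by exists 0 => i t _; rewrite normr0.
  split; first by move=> i t _; exact: derivable_cst.
  rewrite (_ : (fun=> _) = (fun=> cst 0))//.
  by apply/funext => i; apply/funext => t; rewrite derive1_cst.
move=> cM; case: k => [|k]; split => //; try by exists M => i t _; exact: cM.
split; first by move=> i t _; exact: derivable_cst.
rewrite (_ : (fun=> _) = (fun=> cst 0))//.
by apply/funext => i; apply/funext => t; rewrite derive1_cst.
Qed.

Lemma usmooth_id k D (M : R) : (forall t, D t -> `|t| <= M) ->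
  usmooth k D (fun=> id).
Proof.
move=> DM; case: k => [|k]; split => //; try by exists M => i t; exact: DM.
split; first by move=> i t _; exact: derivable_id.
rewrite (_ : (fun=> _) = (fun=> cst 1)); last first.
  by apply/funext => i; apply/funext => t; rewrite derive1_id.
by apply: (@usmooth_cst _ _ (fun=> 1) 1) => i; rewrite normr1.
Qed.

Lemma usmooth_comp k D E f g : open D -> (forall i t, D t -> E (g i t)) ->
  usmooth k E f -> usmooth k D g -> usmooth k D (fun i => f i \o g i).
Proof.
move=> oD DE; elim: k f => [|k IH] f.
  by move=> [[M fM] _] _; split => //; exists M => i t Dt; apply: fM; exact: DE.
move=> sf sg; have [[M fM] [df sdf]] := sf; have [_ [dg sdg]] := sg.
split; first by exists M => i t Dt; apply: fM; exact: DE.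
split.
  move=> i t Dt; apply/derivable1_diffP/differentiable_comp.
    by apply/derivable1_diffP; exact: dg.
  by apply/derivable1_diffP; apply: df; exact: DE.
have := usmoothM oD (IH _ sdf (usmoothW sg)) sdg.
apply: usmooth_eq => // i t Dt.
by rewrite (derive1_comp (dg i t Dt) (df i _ (DE i t Dt))).
Qed.

Lemma usmooth_derive1n k D f j : (j <= k)%N -> usmooth k D f ->
  usmooth (k - j) D (fun i => (f i)^`(j)%classic).
Proof.
elim: j => [_|j IH jk]; first by rewrite subn0.
move=> /(IH (ltnW jk)); by rewrite -(subnSK jk) => -[_ [_]].
Qed.

Lemma usmooth_uniform k D f : usmooth k D f ->
  (forall i j t, (j < k)%N -> D t -> derivable ((f i)^`(j))%classic t 1) /\
  exists M : R, forall i j t, (j <= k)%N -> D t -> `|((f i)^`(j))%classic t| <= M.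
Proof.
move=> sf; split.
  move=> i j t jk; have := usmooth_derive1n (ltnW jk) sf.
  by rewrite -(subnSK jk) => -[_ [+ _]]; exact.
have H j : (j <= k)%N ->
    exists M, forall i t, D t -> `|((f i)^`(j))%classic t| <= M.
  by move=> jk; exact: usmooth_bound (usmooth_derive1n jk sf).
elim: {-2}k (leqnn k) => [_|m IH mk].
  have [M hM] := H 0%N (leq0n _); exists M => i j t; rewrite leqn0 => /eqP ->; exact: hM.
have [M hM] := IH (ltnW mk); have [M' hM'] := H _ mk.
exists (Num.max M M') => i j t; rewrite leq_eqVlt => /predU1P[->|jm] Dt.
  by rewrite le_max hM' ?orbT.
by rewrite le_max hM.
Qed.

Lemma usmooth_of_bounds k D f M :
  (forall i j t, (j < k)%N -> D t -> derivable ((f i)^`(j))%classic t 1) ->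
  (forall i j t, (j <= k)%N -> D t -> `|((f i)^`(j))%classic t| <= M) ->
  usmooth k D f.
Proof.
elim: k f => [|k IH] f fd fM.
  by split => //; exists M => i t Dt; exact: (fM i 0%N).
split; first by exists M => i t Dt; exact: (fM i 0%N).
split; first by move=> i t Dt; exact: (fd i 0%N).
apply: IH => i j t jk Dt; rewrite -derive1Sn; [exact: fd|exact: fM].
Qed.

End uniformly_smooth.

Lemma usmooth_reindex (R : realType) (I J : Type) (h : J -> I) k (D : set R)
  (f : I -> R -> R) : usmooth k D f -> usmooth k D (fun j => f (h j)).
Proof.
elim: k f => [|k IH] f [[M fM] H].
  by split => //; exists M => j; exact: fM.
case: H => df sf; split; first by exists M => j; exact: fM.
by split; [move=> j; exact: df|exact: (IH (fun i => (f i)^`()%classic))].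
Qed.

Section smooth_examples.
Context {R : realType} {I : Type}.

Definition oo (a b : R) : set R := [set x | a < x < b].

Lemma open_oo a b : open (oo a b).
Proof.
rewrite (_ : oo a b = `]a, b[%classic); first exact: itv_open.
by apply/seteqP; split => x; rewrite /oo /= in_itv.
Qed.

Lemma usmooth_opp k (D : set R) (f : I -> R -> R) : open D ->
  usmooth k D f -> usmooth k D (fun i t => - f i t).
Proof.
move=> oD sf.
have := usmoothM oD (@usmooth_cst R I k D (fun=> -1) 1 _) sf.
rewrite normrN1 lexx => /(_ (fun=> isT)).
by apply: usmooth_eq => // i t _; rewrite fctE mulN1r.
Qed.

Lemma usmooth_inv k (d : R) : 0 < d ->
  usmooth k (oo d (d^-1)) (fun (_ : I) x => x^-1).
Proof.
move=> d0.
have b0 : exists M : R, forall (_ : I) t, oo d d^-1 t -> `|t^-1| <= M.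
  exists d^-1 => _ t /andP[dt _].
  by rewrite ger0_norm ?lef_pV2 ?posrE ?invr_ge0 ?ltW// (lt_trans d0).
elim: k => [|k IH]; first by split.
split => //; split => [_ t /andP[dt _]|].
  by apply: derivableV; [rewrite gt_eqF// (lt_trans d0)|exact: derivable_id].
have := usmooth_opp (@open_oo _ _) (usmoothM (@open_oo _ _) IH IH).
apply: usmooth_eq; first exact: open_oo.
move=> i t /andP[dt _]; have t0 : t != 0 by rewrite gt_eqF// (lt_trans d0).
rewrite fctE derive1E (deriveV (f := id))//.
by rewrite derive_id /GRing.scale /= mulr1 -invfM.
Qed.

Lemma usmooth_ln k (d : R) : 0 < d ->
  usmooth k (oo d (d^-1)) (fun _ : I => @ln R).
Proof.
move=> d0; have lnb : exists M : R, forall (_ : I) t, oo d d^-1 t -> `|ln t| <= M.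
  exists (ln (d^-1)) => _ t /andP[dt td]; have t0 := lt_trans d0 dt.
  rewrite ler_norml -lnV ?posrE ?invr_gt0// invrK.
  by rewrite !ler_ln ?posrE ?invr_gt0// !ltW.
case: k => [|k]; first by split.
split => //; split => [_ t /andP[dt _]|].
  by have [] := is_derive1_ln (lt_trans d0 dt).
apply: usmooth_eq (usmooth_inv k d0); first exact: open_oo.
move=> i t /andP[dt _]; rewrite derive1E.
by have [_ ->] := is_derive1_ln (lt_trans d0 dt).
Qed.

Lemma usmooth_expR k (b : R) : usmooth k [set x | x < b] (fun _ : I => @expR R).
Proof.
have eb : exists M : R, forall (_ : I) t, [set x | x < b] t -> `|expR t| <= M.
  by exists (expR b) => _ t /= tb; rewrite ger0_norm ?expR_ge0// ler_expR ltW.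
elim: k => [|k IH]; first by split.
split => //; split => [_ t _|]; first exact: derivable_expR.
rewrite (_ : (fun _ => _) = (fun _ => @expR R))//.
by apply/funext => _; apply/funext => t; rewrite derive1E derive_val.
Qed.

(** The truncated power, of class C^n. Only finitely many derivatives are ever used, so no
    infinitely smooth bump is required. *)
Definition pospow (n : nat) (x : R) : R := if 0 <= x then x ^+ n.+1 else 0.

Lemma pospow_ge0 n x : 0 <= pospow n x.
Proof. by rewrite /pospow; case: ifPn => // x0; rewrite exprn_ge0. Qed.

Lemma pospow_is_derive n (x : R) :
  is_derive x 1 (pospow n.+1) (n.+2%:R * pospow n x).
Proof.
have [x0|x0|->] := ltgtP x 0.
- apply: (near_eq_is_derive (f := cst 0)).
    near=> y; rewrite /pospow leNgt; have -> : y < 0 by near: y; exact: lt_nbhsl.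
    by [].
  by rewrite /pospow leNgt x0 mulr0; exact: is_derive_cst.
- apply: (near_eq_is_derive (f := (@id R) ^+ n.+2)).
    near=> y; rewrite /pospow ltW ?fctE//; near: y; exact: lt_nbhsr.
  by apply: is_derive_eq; rewrite /pospow (ltW x0) /GRing.scale /= mulr1.
have -> : n.+2%:R * pospow n 0 = 0 :> R.
  by rewrite /pospow lexx expr0n mulr0.
have lim0 : h^-1 *: (pospow n.+1 (h *: 1 + 0) - pospow n.+1 0) @[h --> 0^'] --> (0 : R).
  apply/cvgrPdist_le => e e0.
  near=> h.
  have h1 : `|h| <= 1 by near: h; apply: dnbhs0_le.
  have he : `|h| <= e by near: h; apply: dnbhs0_le.
  have h0 : h != 0 by near: h; exact: nbhs_dnbhs_neq.
  rewrite sub0r normrN /pospow lexx [0 ^+ _]expr0n /= subr0 addr0.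
  rewrite /GRing.scale /= mulr1; case: ifPn => _; last by rewrite mulr0 normr0 ltW.
  rewrite exprSr mulrC mulfK// normrX (le_trans _ he)// exprS.
  by rewrite ler_piMr// exprn_ile1.
by constructor; [apply/cvg_ex; exists 0|exact: cvg_lim].
Unshelve. all: by end_near. Qed.

Lemma usmooth_pospow k (b : R) : usmooth k (oo (- b) b) (fun _ : I => pospow k).
Proof.
have pb n : exists M : R, forall (_ : I) t, oo (- b) b t -> `|pospow n t| <= M.
  exists (b ^+ n.+1) => _ t /andP[tb1 tb2]; have b0 : 0 < b by lra.
  rewrite ger0_norm ?pospow_ge0// /pospow; case: ifPn => t0.
    by apply: lerXn2r; rewrite ?nnegrE// ltW.
  by rewrite exprn_ge0// ltW.
elim: k => [|k IH]; first by split.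
split => //; split => [_ t _|]; first by have [] := pospow_is_derive k t.
have c : usmooth k (oo (- b) b) (fun _ : I => cst k.+2%:R).
  by apply: (@usmooth_cst R I k _ (fun=> k.+2%:R) k.+2%:R) => _; rewrite ger0_norm.
apply: usmooth_eq (usmoothM (@open_oo _ _) c IH); first exact: open_oo.
by move=> i t _; rewrite fctE /= derive1E; have [_ ->] := pospow_is_derive k t.
Qed.

End smooth_examples.

(** * Smooth frequency filters as functions of a heat multiplier *)

Section cutoff.
Context {R : realType}.
Implicit Types (w l : R).

(** A transition of class C^k from 0 on w <= 1/2 to 1 on w >= 3/4; the two truncated powers of the
    denominator never vanish together. *)
Definition cutoff (k : nat) w : R :=
  pospow k (w - 2^-1) / (pospow k (w - 2^-1) + pospow k (3 / 4 - w)).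

Lemma pospow_le0 k (x : R) : x <= 0 -> pospow k x = 0.
Proof.
rewrite /pospow le_eqVlt => /predU1P[->|x0]; first by rewrite lexx expr0n.
by rewrite leNgt x0.
Qed.

Lemma pospow_gt0 k (x : R) : 0 < x -> 0 < pospow k x.
Proof. by move=> x0; rewrite /pospow ltW// exprn_gt0. Qed.

Lemma cutoff_eq0 k w : w <= 2^-1 -> cutoff k w = 0.
Proof. by move=> w1; rewrite /cutoff pospow_le0 ?mul0r// subr_le0. Qed.

Lemma cutoff_eq1 k w : 3 / 4 <= w -> cutoff k w = 1.
Proof.
move=> w1; rewrite /cutoff (@pospow_le0 _ (_ - w)) ?subr_le0// addr0 divff//.
by rewrite gt_eqF// pospow_gt0//; lra.
Qed.

Lemma cutoff01 k w : 0 <= cutoff k w <= 1.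
Proof.
rewrite /cutoff; set a := pospow k _; set b := pospow k _.
have a0 : 0 <= a by exact: pospow_ge0.
have b0 : 0 <= b by exact: pospow_ge0.
rewrite divr_ge0 ?addr_ge0//=.
have [->|ab] := eqVneq (a + b) 0; first by rewrite invr0 mulr0 ler01.
by rewrite ler_pdivrMr ?lt0r ?ab ?addr_ge0// mul1r lerDl.
Qed.

Lemma usmooth_cutoff (I : Type) k : usmooth k (oo (-1) 2) (fun _ : I => cutoff k).
Proof.
have oD : open (oo (-1) 2 : set R) by exact: open_oo.
have sid : usmooth k (oo (-1) 2) (fun _ : I => @id R).
  by apply: (usmooth_id _ (M := 2)) => t /andP[t1 t2]; rewrite ler_norml; lra.
have sc (c : R) : usmooth k (oo (-1) 2) (fun _ : I => cst c).
  exact: (@usmooth_cst R I k _ (fun=> c) `|c| (fun=> lexx _)).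
have s1 : usmooth k (oo (-1) 2) (fun _ : I => pospow k \o (fun w : R => w - 2^-1)).
  apply: (usmooth_comp (E := oo (-4) 4)) => //.
  - by move=> _ t /andP[t1 t2]; apply/andP; split; lra.
  - exact: usmooth_pospow.
  - exact: (usmoothD oD sid (sc (- 2^-1))).
have s2 : usmooth k (oo (-1) 2) (fun _ : I => pospow k \o (fun w : R => 3 / 4 - w)).
  apply: (usmooth_comp (E := oo (-4) 4)) => //.
  - by move=> _ t /andP[t1 t2]; apply/andP; split; lra.
  - exact: usmooth_pospow.
  - exact: (usmoothD oD (sc (3 / 4)) (usmooth_opp oD sid)).
have s3 := usmoothD oD s1 s2.
apply: (usmoothM oD s1).
have [M hM] := usmooth_bound s3.
(* One of w - 1/2 and 3/4 - w is at least 1/8, which bounds the denominator below; [M] bounds it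
   above. *)
pose d : R := Num.min ((8^-1) ^+ k.+2) (`|M| + 1)^-1.
have M1 : 0 < `|M| + 1 by rewrite ltr_wpDl.
have d0 : 0 < d by rewrite lt_min exprn_gt0 ?invr_gt0.
apply: (usmooth_comp (E := oo d d^-1) oD _ (@usmooth_inv R I k d d0) s3).
move=> i t tD; apply/andP; split.
  have e (x : R) : 8^-1 <= x -> (8^-1) ^+ k.+2 < pospow k x.
    move=> x8; have x0 : 0 <= x by apply: le_trans x8.
    rewrite /pospow x0; apply: lt_le_trans (_ : (8^-1) ^+ k.+1 <= _).
      by rewrite ltr_iXn2l// ?invr_gt0//; lra.
    by apply: lerXn2r; rewrite ?nnegrE.
  rewrite gt_min; apply/orP; left; rewrite fctE /=.
  have [t1|t1] := leP (8^-1) (t - 2^-1).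
    by rewrite (lt_le_trans (e _ t1))// lerDl pospow_ge0.
  have t2 : 8^-1 <= 3 / 4 - t by lra.
  by rewrite (lt_le_trans (e _ t2))// lerDr pospow_ge0.
apply: lt_le_trans (_ : `|M| + 1 <= _).
  have := hM i t tD; move=> h; rewrite (le_lt_trans (ler_norm _))//.
  by rewrite (le_lt_trans h)// (le_lt_trans (ler_norm M))// ltrDl.
rewrite -[leLHS]invrK lef_pV2 ?posrE ?invr_gt0//.
by rewrite ge_min lexx orbT.
Qed.

(** The heat multiplier at time 4^-m. All filters are functions of this variable w, so that
    expanding them in powers of w expands them in heat kernels. *)
Definition gauss (m : nat) l : R := expR (- (l ^+ 2 / 4 ^+ m)).

Lemma gauss_gt0 m l : 0 < gauss m l. Proof. exact: expR_gt0. Qed.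

Lemma gauss_le1 m l : gauss m l <= 1.
Proof. by rewrite /gauss expR_le1 oppr_le0 divr_ge0 ?sqr_ge0 ?exprn_ge0. Qed.

Lemma gaussS m l : gauss m.+1 l ^+ 4 = gauss m l.
Proof.
rewrite /gauss -expRM_natl; congr expR; rewrite (exprS 4).
by rewrite mulrN; congr (- _); field; rewrite expf_neq0.
Qed.

Variable S : nat.

(** The cut-off acts on w and not on the frequency; since exp(-1) < 1/2 and exp(-1/4) > 3/4, it is 1
    for 0 <= l <= 2^m/2 and 0 for l >= 2^m. *)
Definition lowpass (m : nat) l : R := cutoff S (gauss m l).

Definition band (m : nat) l : R := lowpass m.+1 l - lowpass m l.

Lemma lowpass01 m l : 0 <= lowpass m l <= 1. Proof. exact: cutoff01. Qed.

Lemma lowpass_eq0 m l : 2 ^+ m <= l -> lowpass m l = 0.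
Proof.
move=> ml; have l0 : 0 <= l by apply: le_trans ml; rewrite exprn_ge0.
apply: cutoff_eq0; rewrite /gauss expRN lef_pV2 ?posrE ?expR_gt0//.
apply: le_trans (_ : 1 + (l ^+ 2 / 4 ^+ m) <= _); last exact: expR_ge1Dx.
rewrite -[leLHS]/(1 + 1) lerD2l ler_pdivlMr ?exprn_gt0// mul1r.
rewrite (_ : 4 = 2 ^+ 2); last by rewrite -natrX.
by rewrite exprAC lerXn2r ?nnegrE// exprn_ge0.
Qed.

Lemma lowpass_eq1 m l : 0 <= l -> 2 * l <= 2 ^+ m -> lowpass m l = 1.
Proof.
move=> l0 ml; apply: cutoff_eq1; rewrite /gauss.
apply: le_trans (expR_ge1Dx _); have : l ^+ 2 / 4 ^+ m <= 4^-1; last by lra.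
rewrite ler_pdivrMr ?exprn_gt0//.
suff : (2 * l) ^+ 2 <= 4 ^+ m by rewrite exprMn; lra.
rewrite (_ : 4 = 2 ^+ 2); last by rewrite -natrX.
by rewrite exprAC lerXn2r ?nnegrE ?exprn_ge0 ?mulr_ge0.
Qed.

Lemma lowpassM m n l : (m < n)%N -> lowpass n l * lowpass m l = lowpass m l.
Proof.
move=> mn; have [g1|g1] := leP (gauss m l) 2^-1.
  by rewrite /lowpass (cutoff_eq0 _ g1) mulr0.
rewrite [lowpass n l]cutoff_eq1 ?mul1r//.
rewrite -(subnKC mn); elim: (n - m.+1)%N => [|k IH].
  rewrite addn0; rewrite -gaussS in g1; have := gauss_gt0 m.+1 l.
  move: (gauss _ _) g1 => x; rewrite leNgt => x1 x0; apply/negP => x2.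
  suff : x ^+ 4 < 2^-1 by rewrite ltNge ltW.
  apply: le_lt_trans (_ : (3 / 4) ^+ 4 < _); last by lra.
  by rewrite lerXn2r// ?nnegrE ltW//; lra.
rewrite addnS (le_trans IH)// -gaussS; have := gauss_gt0 (m.+1 + k).+1 l.
have := gauss_le1 (m.+1 + k).+1 l; move: (gauss _ _) => x x1 x0.
have x3 : x ^+ 3 <= 1 by rewrite exprn_ile1// ltW.
by rewrite exprS ler_piMr// ltW.
Qed.

Lemma band_eq0 m l : 2 ^+ m.+1 <= l -> band m l = 0.
Proof.
move=> ml; rewrite /band !lowpass_eq0 ?subrr// (le_trans _ ml)//.
by rewrite ler_weXn2l// ler1n.
Qed.

Lemma sum_band m n l : (m <= n)%N ->
  lowpass n l = lowpass m l + \sum_(m <= i < n) band i l.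
Proof.
move=> mn; rewrite telescope_sumr//; by rewrite addrC subrK.
Qed.

(** An open neighbourhood of [0, 1], so that derivatives are available at both end points. *)
Let D : set R := oo (- 4^-1) (9 / 8).

(** One factor w is split off so that every power in the expansion of w psi(w) has a positive heat
    time. Dividing by w costs nothing, because the cut-off vanishes below 1/2. *)
Lemma lowpass_mask : exists2 psi : R -> R, usmooth S D (fun _ : unit => psi) &
  forall m l, lowpass m l = gauss m l * psi (gauss m l).
Proof.
exists (fun w => w^-1 * cutoff S w); last first.
  by move=> m l; rewrite mulVKf// gt_eqF// gauss_gt0.
apply: (usmooth_sub (D := oo (- 4^-1) 2^-1 `|` oo 4^-1 (9 / 8))).
  move=> t /andP[t1 t2] /=; have [t3|t3] := ltP t 2^-1; [left|right];
  by apply/andP; split; lra.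
have o1 : open (oo (- 4^-1) 2^-1 : set R) by exact: open_oo.
have o2 : open (oo 4^-1 (9 / 8) : set R) by exact: open_oo.
apply: usmoothU.
  apply: usmooth_eq (@usmooth_cst R unit S _ (fun=> 0) 0 _) => //.
    by move=> _ t /andP[_ t1]; rewrite cutoff_eq0 ?mulr0// ltW.
  by rewrite normr0.
apply: (usmoothM o2).
  apply: (usmooth_sub (D := oo 4^-1 (4^-1)^-1)).
    by move=> t /andP[t1 t2]; rewrite invrK; apply/andP; split; lra.
  by apply: usmooth_inv; rewrite invr_gt0.
apply: (usmooth_sub (D := oo (-1) 2)); last exact: usmooth_cutoff.
by move=> t /andP[t1 t2]; apply/andP; split; lra.
Qed.

(** Bounds on the whole line are invariant under translation, so the shifts may depend on the index
    without any control. *)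
Lemma usmooth_shift k (I : Type) (f : I -> R -> R) (c : I -> R) :
  usmooth k setT f -> usmooth k setT (fun i t => f i (c i + t)).
Proof.
have d1 (a t : R) : is_derive t 1 (fun t => a + t) 1.
  by apply: is_derive_eq (is_deriveD (is_derive_cst a t 1) (is_derive_id t 1)) _;
     rewrite add0r.
elim: k f => [|k IH] f [[M fM] h].
  by split => //; exists M => i t _; exact: fM.
case: h => df sf; split; first by exists M => i t _; exact: fM.
split.
  move=> i t _; apply/derivable1_diffP/(@differentiable_comp _ _ _ _ (fun t => c i + t) (f i)).
    by apply/derivable1_diffP; have [] := d1 (c i) t.
  by apply/derivable1_diffP; exact: df.
apply: usmooth_eq (IH _ sf); first exact: openT.
move=> i t _; have [dt ed] := d1 (c i) t.
rewrite (derive1_comp (f := fun t => c i + t) (g := f i) dt (df i (c i + t) Logic.I)).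
by rewrite [X in _ * X]derive1E ed mulr1.
Qed.

Let E0 : set R := oo 4^-1 (31 / 32).

(* With [w = gauss m l], the expression [ln (- ln w) / 2] is [ln (l / 2 ^ m)]. *)
Let L w := 2^-1 * ln (- ln w).

Let usmooth_L (I : Type) : usmooth S E0 (fun _ : I => L).
Proof.
have oE : open E0 by exact: open_oo.
have sc (I' : Type) (c : R) : usmooth S E0 (fun _ : I' => cst c).
  exact: (@usmooth_cst R I' S _ (fun=> c) `|c| (fun=> lexx _)).
have sln : usmooth S E0 (fun _ : I => @ln R).
  apply: (usmooth_sub (D := oo 4^-1 (4^-1)^-1)).
    by move=> t /andP[t1 t2]; rewrite invrK; apply/andP; split; lra.
  by apply: usmooth_ln; rewrite invr_gt0.
have snl : usmooth S E0 (fun (_ : I) w => - ln w) by exact: usmooth_opp.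
pose a : R := - ln (31 / 32).
have a0 : 0 < a by rewrite oppr_gt0 -ln1 ltr_ln ?posrE//; lra.
pose b : R := ln 4.
have b0 : 0 < b by rewrite -ln1 ltr_ln ?posrE//; lra.
pose d := Num.min a b^-1.
have d0 : 0 < d by rewrite lt_min a0 invr_gt0.
apply: (usmoothM oE (sc _ _)).
apply: (usmooth_comp (E := oo d d^-1) (f := fun=> @ln R) oE _ _ snl).
  move=> _ t /andP[t1 t2]; have t0 : 0 < t by apply: lt_trans t1; rewrite invr_gt0.
  apply/andP; split.
    by rewrite gt_min ltrN2 ltr_ln ?posrE// t2.
  apply: lt_le_trans (_ : b <= _).
    rewrite -lnV ?posrE// ltr_ln ?posrE ?invr_gt0//.
    by rewrite -[ltRHS]invrK ltf_pV2 ?posrE ?invr_gt0.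
  by rewrite -[leLHS]invrK lef_pV2 ?posrE ?invr_gt0// ge_min lexx orbT.
exact: usmooth_ln.
Qed.

(** As [gauss m] is the fourth power of w = [gauss m.+1], the band is cutoff(w) - cutoff(w^4), which
    vanishes near w = 0 and near w = 1. In between, s = l/2^(m+1) is a smooth function of w bounded
    away from 0 and infinity. Then (1+l)^alpha is 2^((m+1) alpha) (2^-(m+1) + s)^alpha, and F(ln l)
    is a translate of F at ln s, so all bounds are uniform in m. *)
Lemma multiplier_mask (alpha : R) (F : R -> R) :
  usmooth S setT (fun _ : unit => F) ->
  exists2 psi : nat -> R -> R, usmooth S D psi &
    forall m l, 0 <= l -> band m l * ((1 + l) `^ alpha * F (ln l)) =
      (2 ^+ m.+1) `^ alpha * (gauss m.+1 l * psi m (gauss m.+1 l)).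
Proof.
move=> sF.
pose step w := cutoff S w - cutoff S (w ^+ 4).
pose eta (m : nat) w := expR (alpha * ln ((2 ^+ m.+1)^-1 + expR (L w))) *
  F (ln (2 ^+ m.+1) + L w).
have step0 (w : R) : w < 2^-1 -> - 4^-1 < w -> step w = 0.
  move=> w1 w2; rewrite /step !cutoff_eq0 ?subrr ?ltW//.
  have : w ^+ 2 < 4^-1 by nra.
  have : 0 <= w ^+ 2 by exact: sqr_ge0.
  rewrite (exprM w 2 2); nra.
have step1 (w : R) : 15 / 16 < w -> step w = 0.
  move=> w1; rewrite /step !cutoff_eq1 ?subrr//; last by lra.
  have : (15 / 16) ^+ 4 <= w ^+ 4 by apply: lerXn2r; rewrite ?nnegrE//; lra.
  lra.
exists (fun m w => w^-1 * step w * eta m w); last first.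
  move=> m l; rewrite le_eqVlt => /predU1P[<-|l0].
    have e n : gauss n 0 = 1 by rewrite /gauss expr0n mul0r oppr0 expR0.
    by rewrite /band /lowpass !e subrr mul0r step1 ?mulr0 ?mul0r ?mulr0//; lra.
  have N0 : 0 < 2 ^+ m.+1 :> R by rewrite exprn_gt0.
  have LE : L (gauss m.+1 l) = ln (l / 2 ^+ m.+1).
    rewrite /L /gauss expRK opprK (_ : 4 = 2 ^+ 2); last by rewrite -natrX.
    rewrite exprAC -expr_div_n lnXn ?divr_gt0// -[ln _ *+ 2]mulr_natl.
    by rewrite mulrA mulVf ?mul1r.
  have -> : band m l = step (gauss m.+1 l) by rewrite /band /lowpass /step gaussS.
  have etaE : (2 ^+ m.+1) `^ alpha * eta m (gauss m.+1 l) = (1 + l) `^ alpha * F (ln l).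
    rewrite /eta LE -lnM ?posrE ?divr_gt0// lnK ?posrE ?divr_gt0//.
    rewrite [2 ^+ m.+1 * _]mulrC divfK ?gt_eqF// mulrA; congr (_ * _).
    have -> : (2 ^+ m.+1)^-1 + l / 2 ^+ m.+1 = (1 + l) / 2 ^+ m.+1.
      by rewrite mulrDl mul1r.
    have l1 : 0 < 1 + l by rewrite addr_gt0.
    rewrite ln_div ?posrE// mulrBr /powR !gt_eqF// -expRD; congr expR; ring.
  rewrite -etaE -(mulrA (_^-1)) mulVKf ?gt_eqF ?gauss_gt0//.
  by rewrite mulrCA.
have oE : open E0 by exact: open_oo.
have sc (I' : Type) (c : I' -> R) (M : R) : (forall i, `|c i| <= M) ->
    usmooth S E0 (fun i => cst (c i)) by exact: usmooth_cst.
apply: (usmooth_sub (D := oo (- 4^-1) 2^-1 `|` oo (15 / 16) (9 / 8) `|` E0)).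
  move=> t /andP[t1 t2] /=; have [t3|t3] := ltP t 2^-1.
    by left; left; apply/andP; split.
  have [t4|t4] := ltP (15 / 16) t; first by left; right; apply/andP; split.
  by right; apply/andP; split; lra.
apply: usmoothU; first apply: usmoothU.
- apply: usmooth_eq (@usmooth_cst R nat S _ (fun=> 0) 0 _); first exact: open_oo.
    by move=> m t /andP[t1 t2]; rewrite step0// mulr0 mul0r.
  by move=> _; rewrite normr0.
- apply: usmooth_eq (@usmooth_cst R nat S _ (fun=> 0) 0 _); first exact: open_oo.
    by move=> m t /andP[t1 t2]; rewrite step1// mulr0 mul0r.
  by move=> _; rewrite normr0.
have sid : usmooth S E0 (fun _ : nat => @id R).
  by apply: (usmooth_id _ (M := 1)) => t /andP[t1 t2]; rewrite ler_norml; lra.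
apply: (usmoothM oE); first apply: (usmoothM oE).
- apply: (usmooth_sub (D := oo 4^-1 (4^-1)^-1)).
    by move=> t /andP[t1 t2]; rewrite invrK; apply/andP; split; lra.
  by apply: usmooth_inv; rewrite invr_gt0.
- apply: (usmoothD oE).
    apply: (usmooth_sub (D := oo (-1) 2)); last exact: usmooth_cutoff.
    by move=> t /andP[t1 t2]; apply/andP; split; lra.
  apply: (usmooth_opp oE).
  apply: (usmooth_comp (E := oo (-1) 2) (f := fun=> cutoff S) (g := fun _ w => w ^+ 4) oE).
  + move=> _ t /andP[t1 t2]; have : t ^+ 4 <= 1 by rewrite exprn_ile1//; lra.
    have : 0 <= t ^+ 4 by rewrite exprn_ge0//; lra.
    by move=> ? ?; apply/andP; split; lra.
  + exact: usmooth_cutoff.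
  have s2 := usmoothM oE sid sid.
  apply: usmooth_eq (usmoothM oE s2 s2) => // m t _.
  by rewrite !fctE /=; ring.
have sL : usmooth S E0 (fun _ : nat => L) by exact: usmooth_L.
have [ML hML] := usmooth_bound sL.
have hML' w : E0 w -> - ML <= L w <= ML by move=> wE; rewrite -ler_norml; exact: hML 0%N _ wE.
apply: (usmoothM oE); last first.
  apply: (usmooth_comp (E := setT) (f := fun m t => F (ln (2 ^+ m.+1) + t)) oE) => //.
  apply: (@usmooth_shift _ nat (fun=> F)).
  exact: (usmooth_reindex (fun _ : nat => tt) sF).
have [Me hMe] := usmooth_bound (usmooth_expR (I := nat) S (ML + 1)).
have ep w : E0 w -> expR (- ML) <= expR (L w) <= expR ML.
  by move=> /hML'; rewrite !ler_expR.
pose N (m : nat) : R := (2 ^+ m.+1)^-1.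
have N01 m : 0 <= N m <= 1.
  by rewrite /N invr_ge0 exprn_ge0//= invf_le1 ?exprn_gt0// exprn_ege1// ler1n.
have seL : usmooth S E0 (fun (m : nat) w => N m + expR (L w)).
  apply: (usmoothD oE (sc _ N 1 _)).
    by move=> m; rewrite ger0_norm; have /andP[] := N01 m.
  apply: (usmooth_comp (E := [set x | x < ML + 1]) (f := fun=> @expR R) oE) sL.
    by move=> _ w /hML' /andP[_ h] /=; lra.
  exact: usmooth_expR.
pose d : R := Num.min (expR (- ML) / 2) (expR ML + 2)^-1.
have e0 := expR_gt0 (- ML); have e1 := expR_gt0 ML.
have d0 : 0 < d by rewrite lt_min divr_gt0//= invr_gt0 addr_gt0.
have sl : usmooth S E0 (fun (m : nat) w => ln (N m + expR (L w))).
  apply: (usmooth_comp (E := oo d d^-1) (f := fun=> @ln R) oE) seL.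
    move=> m w /ep /andP[l1 l2]; have /andP[n0 n1] := N01 m; apply/andP; split.
      by rewrite gt_min; apply/orP; left; lra.
    apply: lt_le_trans (_ : expR ML + 2 <= _); first by lra.
    by rewrite -[leLHS]invrK lef_pV2 ?posrE ?invr_gt0 ?addr_gt0// ge_min lexx orbT.
  exact: usmooth_ln.
have sal := usmoothM oE (sc nat (fun=> alpha) `|alpha| (fun=> lexx _)) sl.
have [Ma hMa] := usmooth_bound sal.
apply: (usmooth_comp (E := [set x | x < Ma + 1]) (f := fun=> @expR R) oE) sal.
  by move=> m w wE /=; have := hMa m w wE; rewrite ler_norml fctE => /andP[_]; lra.
exact: usmooth_expR.
Qed.

End cutoff.

(** * Localised kernels from the heat kernel bound *)

Section kernels.
Context {R : realType} (Xi : system R) (q : R) (Xi_dd : data_defined Xi q).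
Implicit Types (x y : Xi).

Definition ker (J : nat) (g : nat -> R) x y : R :=
  \sum_(k < J) g k * phi k x * phi k y.

Lemma rho_xx x : rho x x = 0.
Proof. by have [_ h _ _] := dd_quasi_metric Xi_dd; apply/h. Qed.

Lemma rho_ge0 x y : 0 <= rho x y.
Proof. by have [h _ _ _] := dd_quasi_metric Xi_dd. Qed.

Lemma rhoC x y : rho x y = rho y x.
Proof. by have [_ _ h _] := dd_quasi_metric Xi_dd. Qed.

Lemma q_gt0 : 0 < q. Proof. exact: dd_exponent_gt0 Xi_dd. Qed.

Lemma lam_ge0 k : 0 <= lam Xi k.
Proof. by rewrite -(dd_lam0 Xi_dd); exact: (dd_lam_nondecreasing Xi_dd). Qed.

(** On the diagonal the heat series has nonnegative terms, so its partial sums stay below the limit;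
    off the diagonal, |ab| <= (a^2 + b^2)/2. *)
Lemma heat_abs_bound : exists2 k3 : R, 0 < k3 & forall (t : R) x y J, 0 < t <= 1 ->
  \sum_(k < J) expR (- (lam Xi k ^+ 2 * t)) * `|phi k x * phi k y| <=
    k3 * t `^ (- (q / 2)).
Proof.
have [k3 [k4 [k30 k40 hb]]] := dd_heat_bound Xi_dd.
exists k3 => // t x y J t01.
have diag (z : Xi) : \sum_(k < J) expR (- (lam Xi k ^+ 2 * t)) * phi k z ^+ 2 <= k3 * t `^ (- (q / 2)).
  have := hb t z z t01; rewrite rho_xx expr0n mulr0 mul0r oppr0 expR0 mulr1.
  apply: le_trans; apply: le_trans (ler_norm _).
  have -> : \sum_(k < J) expR (- (lam Xi k ^+ 2 * t)) * phi k z ^+ 2 = heat_series t z z J.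
    rewrite /heat_series seriesEord; apply: eq_bigr => k _; ring.
  apply: nondecreasing_cvgn_le; last exact: dd_heat_cvg Xi_dd _ _ _ t01.
  apply/nondecreasing_series => k _ _.
  by rewrite -mulrA mulr_ge0 ?expR_ge0 ?sqr_ge0.
have -> : k3 * t `^ (- (q / 2)) = (k3 * t `^ (- (q / 2)) + k3 * t `^ (- (q / 2))) / 2.
  by lra.
apply: le_trans (_ : (\sum_(k < J) expR (- (lam Xi k ^+ 2 * t)) * phi k x ^+ 2 +
   \sum_(k < J) expR (- (lam Xi k ^+ 2 * t)) * phi k y ^+ 2) / 2 <= _); last first.
  by rewrite ler_pM2r ?invr_gt0// lerD.
rewrite -big_split mulr_suml ler_sum// => k _ /=.
rewrite -mulrDr -mulrA ler_wpM2l ?expR_ge0// normrM.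
rewrite -(real_normK (num_real (phi k x))) -(real_normK (num_real (phi k y))).
have := sqr_ge0 (`|phi k x| - `|phi k y|); nra.
Qed.

Lemma powR_4inv m : (4 ^- m) `^ (- (q / 2)) = (2 ^+ m) `^ q.
Proof.
have p : 0 < 2 ^+ m :> R by rewrite exprn_gt0.
have -> : 4 ^- m = (2 ^+ m) ^- 2 :> R.
  by rewrite (_ : 4 = 2 ^+ 2); [rewrite exprAC|rewrite -natrX].
by rewrite -powR_invn ?(ltW p)// -powRrM; congr (_ `^ _); field.
Qed.

Section localization.
Variable S : nat.
Hypothesis qS : q < S%:R.

(* bounds for a mask [psi] of class C^S on [0, 1] *)
Definition cmask (M : R) (psi : R -> R) : Prop :=
  (forall j (x : R), (j < S)%N -> 0 <= x <= 1 -> derivable (psi^`(j))%classic x 1) /\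
  (forall j (x : R), (j <= S)%N -> 0 <= x <= 1 -> `|(psi^`(j))%classic x| <= M).

Lemma gaussX m i (l : R) : gauss m l ^+ i = expR (- (l ^+ 2 * (i%:R / 4 ^+ m))).
Proof. by rewrite /gauss -expRM_natl; congr expR; ring. Qed.

Lemma ker_crude_bound : exists2 C : R, 0 < C & forall (psi : R -> R) (M : R) m J g x y,
  (forall w, 0 <= w <= 1 -> `|psi w| <= M) ->
  (forall k, g k = gauss m (lam Xi k) * psi (gauss m (lam Xi k))) ->
  `|ker J g x y| <= C * M * (2 ^+ m) `^ q.
Proof.
have [k3 k30 hb] := heat_abs_bound; exists k3 => // psi M m J g x y pM gE.
have M0 : 0 <= M by apply: le_trans (pM 0 _); rewrite ?lexx ?ler01.
have t01 : 0 < (4 ^- m : R) <= 1.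
  by rewrite invr_gt0 exprn_gt0//= invf_le1 ?exprn_gt0// exprn_ege1// ler1n.
apply: le_trans (_ : M * \sum_(k < J) expR (- (lam Xi k ^+ 2 * 4 ^- m)) * `|phi k x * phi k y| <= _).
  rewrite /ker (le_trans (ler_norm_sum _ _ _))// mulr_sumr ler_sum// => k _.
  rewrite gE -/(gauss m (lam Xi k)); set w := gauss m _.
  have w0 : 0 < w by exact: gauss_gt0.
  have -> : w * psi w * phi k x * phi k y = psi w * (w * (phi k x * phi k y)) by ring.
  rewrite normrM (normrM w) (ger0_norm (ltW w0)) ler_wpM2r ?mulr_ge0 ?(ltW w0)//.
  by apply: pM; rewrite gauss_le1 ltW.
by rewrite (mulrC k3) -mulrA ler_wpM2l// -powR_4inv; exact: hb _ x y J t01.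
Qed.

(** Replace psi by the polynomial P of [jackson]. The error psi - P is paid by [heat_abs_bound] at
    time 4^-m. What remains is the sum of P_i times the heat kernel at time (i+1)/4^m, bounded by
    the coefficient norm of P times the Gaussian at the largest time. The condition on n keeps all
    times at most 1. *)
Lemma ker_poly_bound : exists C k4 : R, [/\ 1 <= C, 0 < k4 &
  forall (psi : R -> R) (M : R) (m n J : nat) g x y,
  cmask M psi -> (8 * n + 6 + S <= 4 ^ m)%N ->
  (forall k, g k = gauss m (lam Xi k) * psi (gauss m (lam Xi k))) ->
  (forall k, (J <= k)%N -> g k = 0) ->
  `|ker J g x y| <= C * M * (2 ^+ m) `^ q *
    (n.+1%:R ^- S + C ^+ n.+1 * expR (- (k4 * rho x y ^+ 2 * 4 ^+ m / (8 * n + 6 + S)%:R)))].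
Proof.
have [k3 k30 hb] := heat_abs_bound.
have [k3' [k4 [k30' k40 gb]]] := dd_heat_bound Xi_dd.
have [C1 C11 jac] := @jackson R S.
pose C := k3 * C1 + k3' + C1.
have [C_1 C_2 C_3] : [/\ C1 <= C, k3' <= C & k3 * C1 <= C] by rewrite /C; split; nra.
exists C, k4; split => //; first by rewrite (le_trans C11).
move=> psi M m n J g x y [psid psiM] n4 gE g0.
have M0 : 0 <= M by apply: le_trans (psiM 0%N 0 _ _); rewrite ?lexx ?ler01.
have [P [sP eP lP]] := jac psi M n psid psiM.
pose t (i : nat) : R := i.+1%:R / 4 ^+ m.
have p4 : 0 < 4 ^+ m :> R by rewrite exprn_gt0.
have t01 i : (i < size P)%N -> 0 < t i <= 1.
  move=> iP; rewrite /t divr_gt0//= ler_pdivrMr// mul1r -natrX ler_nat.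
  by rewrite (leq_trans _ n4)// (leq_trans iP).
have cvgK i : (i < size P)%N -> heat_series (t i) x y j @[j --> \oo] --> limn (heat_series (t i) x y).
  by move=> iP; apply: dd_heat_cvg Xi_dd _ _ _ (t01 _ iP).
pose err := C1 * M / n.+1%:R ^+ S.
have err0 : 0 <= err by rewrite divr_ge0 ?exprn_ge0// mulr_ge0//; lra.
pose Q := (2 ^+ m) `^ q.
have Q0 : 0 <= Q by exact: powR_ge0.
(* The comparison is made on partial sums, since heat kernels are given as limits; as g vanishes
   from J on, the truncation of [ker] can follow j. *)
have step1 j : (J <= j)%N ->
    `|ker J g x y - \sum_(i < size P) P`_i * heat_series (t i) x y j| <= err * (k3 * Q).
  move=> Jj; have -> : ker J g x y = ker j g x y.
    rewrite /ker (big_ord_widen _ (fun k => g k * phi k x * phi k y) Jj) big_mkcond.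
    by apply: eq_bigr => k _; case: ltnP => // /g0 ->; rewrite !mul0r.
  have -> : \sum_(i < size P) P`_i * heat_series (t i) x y j =
      \sum_(k < j) gauss m (lam Xi k) * P.[gauss m (lam Xi k)] * phi k x * phi k y.
    under eq_bigr do rewrite /heat_series seriesEord mulr_sumr.
    rewrite exchange_big; apply: eq_bigr => k _ /=.
    rewrite horner_coef mulr_sumr !mulr_suml; apply: eq_bigr => i _.
    rewrite /t -gaussX exprS; ring.
  rewrite -sumrB (le_trans (ler_norm_sum _ _ _))//.
  have t0 : 0 < (4 ^- m : R) <= 1.
    by rewrite invr_gt0 p4 invf_le1// exprn_ege1// ler1n.
  have := hb _ x y j t0; rewrite powR_4inv -/Q => /(ler_wpM2l err0); apply: le_trans.
  rewrite mulr_sumr ler_sum// => k _; rewrite gE -/(gauss m (lam Xi k)).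
  set w := gauss m _; have w0 : 0 < w by exact: gauss_gt0.
  have -> : w * psi w * phi k x * phi k y - w * P.[w] * phi k x * phi k y =
     (psi w - P.[w]) * (w * (phi k x * phi k y)) by ring.
  rewrite normrM (normrM w) (ger0_norm (ltW w0)) ler_wpM2r ?mulr_ge0 ?(ltW w0)//.
  by apply: eP; rewrite gauss_le1 ltW.
have step2 : `|ker J g x y - \sum_(i < size P) P`_i * limn (heat_series (t i) x y)| <= err * (k3 * Q).
  have cv : `|ker J g x y - \sum_(i < size P) P`_i * heat_series (t i) x y j| @[j --> \oo] -->
     `|ker J g x y - \sum_(i < size P) P`_i * limn (heat_series (t i) x y)|.
    apply: cvg_norm; apply: cvgB; first exact: cvg_cst.
    apply: cvg_big => [|i _]; first exact: add_continuous.
    by apply: cvgMr; exact: cvgK.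
  have <- := cvg_lim (@Rhausdorff R) cv.
  apply: limr_le; first by apply/cvg_ex; eexists; exact: cv.
  by near=> j; apply: step1; near: j; exact: nbhs_infty_ge.
pose ex := expR (- (k4 * rho x y ^+ 2 * 4 ^+ m / (8 * n + 6 + S)%:R)).
(* Among the times (i+1)/4^m, the factor t^(-q/2) is largest at i = 0 and the Gaussian at the
   largest time. *)
have step3 : `|\sum_(i < size P) P`_i * limn (heat_series (t i) x y)| <= l1 P * (k3' * Q * ex).
  rewrite (le_trans (ler_norm_sum _ _ _))// (@l1E _ (size P))// mulr_suml ler_sum// => i _.
  rewrite normrM ler_wpM2l// (le_trans (gb _ _ _ (t01 i (ltn_ord i))))//.
  rewrite ler_pM ?mulr_ge0 ?powR_ge0 ?expR_ge0 ?(ltW k30')//.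
    rewrite ler_wpM2l ?(ltW k30')// /Q -powR_4inv /t powRM ?invr_ge0 ?(ltW p4)//.
    rewrite ler_piMl ?powR_ge0// powRN invf_le1 ?powR_gt0//.
    rewrite -[X in X <= _](powRr0 i.+1%:R) ler_powR ?ler1n// divr_ge0// ltW//.
    exact: q_gt0.
  rewrite ler_expR lerN2 /t invf_div -(mulrA (k4 * _)).
  have kr : 0 <= k4 * rho x y ^+ 2 by rewrite mulr_ge0 ?sqr_ge0// ltW.
  rewrite ler_wpM2l// ler_wpM2l ?(ltW p4)//.
  by rewrite lef_pV2 ?posrE ?ltr0n ?addn_gt0 ?orbT// ler_nat (leq_trans _ sP).
have ex0 : 0 <= ex by exact: expR_ge0.
have -> : ker J g x y = (ker J g x y - \sum_(i < size P) P`_i * limn (heat_series (t i) x y)) +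
   \sum_(i < size P) P`_i * limn (heat_series (t i) x y) by rewrite subrK.
rewrite (le_trans (ler_normD _ _))// (le_trans (lerD step2 step3))//.
rewrite mulrDr lerD//.
  apply: (@le_trans _ _ (C * (M / n.+1%:R ^+ S * Q))).
    have -> : err * (k3 * Q) = (k3 * C1) * (M / n.+1%:R ^+ S * Q) by rewrite /err; ring.
    by rewrite ler_wpM2r// mulr_ge0// divr_ge0// exprn_ge0.
  rewrite le_eqVlt; apply/orP; left; apply/eqP; rewrite /Q; ring.
rewrite -/ex -/Q.
apply: le_trans (_ : M * C1 ^+ n.+1 * (C * Q * ex) <= _).
  by rewrite ler_pM ?l1_ge0 ?mulr_ge0 ?(ltW k30')// !ler_wpM2r.
have -> : C * M * Q * (C ^+ n.+1 * ex) = M * C ^+ n.+1 * (C * Q * ex) by ring.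
rewrite ler_wpM2r ?mulr_ge0//; first by lra.
rewrite ler_wpM2l// lerXn2r ?nnegrE//; lra.
Unshelve. all: by end_near. Qed.

End localization.
End kernels.

Lemma jackson_degree_le n S : (8 * n + 6 + S <= (8 + S) * n.+1)%N.
Proof. by rewrite mulnS mulnDl; lia. Qed.

Section localization2.
Context {R : realType} (Xi : system R) (q : R) (Xi_dd : data_defined Xi q).
Variable S : nat.
Hypothesis qS : q < S%:R.
Implicit Types (x y : Xi).

Lemma S_gt0 : (0 < S)%N.
Proof. by rewrite -(ltr0n R); apply: lt_trans qS; exact: q_gt0 Xi_dd. Qed.

Lemma expRN_le_inv (t : R) : 0 < t -> expR (- t) <= S`!%:R / t ^+ S.
Proof.
move=> t0; rewrite expRN -[leRHS]invf_div lef_pV2 ?posrE ?expR_gt0 ?divr_gt0 ?exprn_gt0 ?ltr0n ?fact_gt0//.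
have := @expR_ge1Dxn R t S.-1 (ltW t0); rewrite prednK ?S_gt0//; lra.
Qed.

(** [J] only records a place where the multiplier has ended, which makes the kernel a finite sum; no
    bound depends on it. *)
Definition unit_kmask (M : R) (m J : nat) (g : nat -> R) : Prop :=
  exists2 psi, cmask S M psi &
    (forall k, g k = gauss m (lam Xi k) * psi (gauss m (lam Xi k))) /\
    (forall k, (J <= k)%N -> g k = 0).

(** In [ker_poly_bound] take n + 1 proportional to 2^j when 2^m rho > 2^j. The approximation error
    is then of order 2^(-jS), and the Gaussian exponent, of order 4^j/n, exceeds the logarithm of
    C^(n+1) by at least 2^j. *)
Lemma ker_localized_unit : exists2 C : R, 0 < C & forall M m J g x y, unit_kmask M m J g ->
  `|ker J g x y| <= C * M * (2 ^+ m) `^ q /\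
  forall j, (j <= m)%N -> 2 ^+ j < 2 ^+ m * rho x y ->
    `|ker J g x y| <= C * M * (2 ^+ m) `^ q / 2 ^+ (j * S).
Proof.
have rg (a b c d : R) : a * b * c * d = b * c * (a * d) by ring.
have rg2 (a b c d : R) : a * b * (c * d) = c * a * (b * d) by ring.
have rg3 (k A B Z : R) : A * B = Z -> k * Z ^+ 2 = k * B * (Z * A) by move=> <-; ring.
have [C1 C10 crude] := ker_crude_bound Xi_dd.
have [C2 [k4 [C21 k40 polyb]]] := ker_poly_bound Xi_dd S.
pose c0 : R := (8 + S)%:R.
have c00 : 0 < c0 by rewrite ltr0n.
have lnC : 0 <= ln C2 by rewrite ln_ge0.
(* The summand [c0] will keep the heat times at most 1; the other makes the Gaussian exponent
   dominate (ln C2 + 1) 2^j. *)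
pose X := c0 + c0 * (ln C2 + 1) / k4.
have X0 : 0 < X by rewrite addr_gt0// divr_gt0// mulr_gt0// ltr_wpDl.
pose j0 := (Num.truncn X).+1.
have Xj0 : X <= 2 ^+ j0.
  apply: ltW; apply: lt_le_trans (_ : j0%:R <= _); first exact: truncnS_gt.
  by rewrite -natrX ler_nat ltnW// ltn_expl.
pose P : R := 2 ^+ (j0 * S).
have P1 : 1 <= P by rewrite exprn_ege1// ler1n.
have f0 : 0 <= S`!%:R :> R by [].
have C20 : 0 < C2 by apply: lt_le_trans C21.
have P0 : 0 < P by apply: lt_le_trans P1.
have CS0 : 0 <= C2 * (P + S`!%:R) by rewrite mulr_ge0 ?addr_ge0// ltW.
have C1P : C1 * P <= C1 * P + C2 * (P + S`!%:R) by rewrite lerDl.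
exists (C1 * P + C2 * (P + S`!%:R)).
  by apply: lt_le_trans C1P; rewrite mulr_gt0.
move=> M m J g x y [psi cm [gE g0]].
have pM w : 0 <= w <= 1 -> `|psi w| <= M by exact: cm.2 0%N w _.
have M0 : 0 <= M by apply: le_trans (pM 0 _); rewrite ?lexx ?ler01.
have cr := crude psi M m J g x y pM gE.
set Q := (2 ^+ m) `^ q in cr *.
have Q0 : 0 <= Q by exact: powR_ge0.
have MQ : 0 <= M * Q by rewrite mulr_ge0.
split.
  apply: le_trans cr _; rewrite -!mulrA ler_wpM2r//.
  by apply: le_trans C1P; rewrite ler_peMr// ltW.
move=> j jm jrho.
have p2 k : 0 < 2 ^+ k :> R by rewrite exprn_gt0.
rewrite rg.
(* For j < j0 the claimed decay factor is at least 1/P, and the crude bound suffices. *)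
have [jj0|j0j] := ltnP j j0.
  apply: le_trans cr _; rewrite -mulrA mulrC ler_wpM2l//.
  rewrite ler_pdivlMr//; apply: le_trans C1P.
  by rewrite ler_wpM2l ?(ltW C10)// ler_weXn2l ?ler1n// leq_mul2r ltnW ?orbT.
(* With this degree the approximation error is 2^(-(j - j0)S), that is P 2^(-jS). *)
pose n := (2 ^ (j - j0)).-1.
have nE : n.+1 = (2 ^ (j - j0))%N by rewrite prednK// expn_gt0.
have e2 : (2 ^+ (j - j0) * 2 ^+ j0 = 2 ^+ j :> R) by rewrite -exprD subnK.
have sz : ((8 * n + 6 + S)%:R <= c0 * 2 ^+ (j - j0) :> R).
  by rewrite -natrX -nE -natrM ler_nat jackson_degree_le.
have n4 : (8 * n + 6 + S <= 4 ^ m)%N.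
  rewrite -(ler_nat R) (le_trans sz)//.
  apply: le_trans (_ : 2 ^+ j <= _).
    rewrite -e2 mulrC ler_wpM2l ?(ltW (p2 _))// (le_trans _ Xj0)// lerDl.
    by rewrite divr_ge0 ?mulr_ge0 ?(ltW k40) ?(ltW c00)// addr_ge0.
  by rewrite -natrX ler_nat -[4%N]/(2 ^ 2)%N -expnM leq_exp2l// (leq_trans jm)// leq_pmull.
have := polyb psi M m n J g x y cm n4 gE g0; rewrite -/Q => /le_trans; apply.
rewrite rg ler_wpM2l//.
apply: (@le_trans _ _ (C2 * (P + S`!%:R) / 2 ^+ (j * S))); last first.
  by rewrite ler_wpM2r ?invr_ge0 ?(ltW (p2 _))// lerDr mulr_ge0// ltW.
rewrite -[leRHS]mulrA ler_wpM2l ?(ltW C20)//.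
rewrite mulrDl lerD//.
  rewrite nE natrX -exprM /P ler_pdivlMr// mulrC ler_pdivrMr//.
  by rewrite -exprD -mulnDl subnKC.
set ex := (X in expR (- X)).
have exl : ln C2 * 2 ^+ (j - j0) + 2 ^+ j <= ex.
  rewrite /ex ler_pdivlMr ?ltr0n ?addn_gt0 ?orbT//.
  have a0 : 0 <= ln C2 * 2 ^+ (j - j0) + 2 ^+ j.
    by rewrite addr_ge0 ?mulr_ge0// ltW.
  apply: le_trans (ler_wpM2l a0 sz) _.
  have rr : (2 ^+ j) ^+ 2 <= rho x y ^+ 2 * 4 ^+ m.
    rewrite (_ : 4 = 2 ^+ 2); last by rewrite -natrX.
    rewrite (exprAC _ 2) -(exprMn _ (rho x y)) mulrC.
    by rewrite lerXn2r ?nnegrE ?(ltW (p2 _)) ?mulr_ge0 ?(ltW jrho) ?(rho_ge0 Xi_dd)// ltW.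
  rewrite -(mulrA k4); apply: le_trans (ler_wpM2l (ltW k40) rr).
  have j1 : 2 ^+ (j - j0) <= 2 ^+ j :> R by rewrite ler_weXn2l ?ler1n// leq_subr.
  apply: le_trans (_ : (ln C2 + 1) * 2 ^+ j * (c0 * 2 ^+ (j - j0)) <= _).
    rewrite ler_wpM2r ?mulr_ge0 ?(ltW c00) ?(ltW (p2 _))// mulrDl mul1r lerD2r.
    by rewrite ler_wpM2l.
  rewrite (rg3 _ _ _ _ e2) rg2.
  rewrite ler_wpM2r ?mulr_ge0 ?(ltW (p2 _))//.
  rewrite (mulrC k4) -ler_pdivrMr//; apply: le_trans Xj0.
  by rewrite lerDr ltW.
have -> : C2 ^+ n.+1 = expR (ln C2 * 2 ^+ (j - j0)).
  by rewrite nE -natrX expRM_natr lnK// posrE.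
rewrite -expRD; apply: le_trans (_ : expR (- 2 ^+ j) <= _).
  by rewrite ler_expR -lerBrDl -opprD lerN2 addrC.
by apply: le_trans (expRN_le_inv (p2 j)) _; rewrite -exprM.
Qed.

(* The scalar [c] is kept apart since the masks used below are only bounded
   after division by a power of [2 ^ m]. *)
Definition kmask (M : R) (m J : nat) (g : nat -> R) : Prop :=
  exists c M' g', [/\ unit_kmask M' m J g', `|c| * M' <= M & forall k, g k = c * g' k].

Lemma unit_kmask_ge0 M m J g : unit_kmask M m J g -> 0 <= M.
Proof.
move=> [psi cm _].
by apply: le_trans (cm.2 0%N 0 _ _); rewrite ?lexx ?ler01.
Qed.

Lemma kmask_ge0 M m J g : kmask M m J g -> 0 <= M.
Proof.
move=> [c [M' [g' [/unit_kmask_ge0 M'0 cM _]]]].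
by apply: le_trans cM; rewrite mulr_ge0.
Qed.

Lemma unit_kmaskW M m J g : unit_kmask M m J g -> kmask M m J g.
Proof.
move=> h; exists 1, M, g; split => //; first by rewrite normr1 mul1r.
by move=> k; rewrite mul1r.
Qed.

Lemma kmask_eq0 M m J g k : kmask M m J g -> (J <= k)%N -> g k = 0.
Proof.
by move=> [c [M' [g' [[psi _ [_ g0]] _ gE]]]] Jk; rewrite gE g0// mulr0.
Qed.

Lemma ker_localized : exists2 C : R, 0 < C & forall M m J g x y, kmask M m J g ->
  `|ker J g x y| <= C * M * (2 ^+ m) `^ q /\
  forall j, (j <= m)%N -> 2 ^+ j < 2 ^+ m * rho x y ->
    `|ker J g x y| <= C * M * (2 ^+ m) `^ q / 2 ^+ (j * S).
Proof.
have [C C0 loc] := ker_localized_unit; exists C => //.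
move=> M m J g x y [c [M' [g' [km cM gE]]]].
have kE : ker J g x y = c * ker J g' x y.
  by rewrite /ker mulr_sumr; apply: eq_bigr => k _; rewrite gE !mulrA.
have [l1 l2] := loc M' m J g' x y km.
have sc (A : R) : 0 <= A -> C * (`|c| * M') * A <= C * M * A.
  by move=> A0; rewrite ler_wpM2r// ler_wpM2l// ltW.
have rg (a b d e : R) : a * (b * d * e) = b * (a * d) * e by ring.
rewrite kE normrM; split.
  apply: le_trans (sc _ (powR_ge0 _ _)); rewrite -rg.
  by rewrite ler_wpM2l.
move=> j jm jr; rewrite -mulrA; apply: le_trans (sc _ _).
  by rewrite -rg ler_wpM2l//; apply: le_trans (l2 j jm jr) _; rewrite mulrA.
by rewrite divr_ge0 ?powR_ge0 ?exprn_ge0.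
Qed.

Lemma measurable_continuous (f : borel Xi -> R) : continuous (f : Xi -> R) ->
  measurable_fun setT f.
Proof.
move=> /continuousP cf; apply: (measurability _ (RGenOpens.measurableE R)).
move=> _ [_ [a [b ->] <-]]; rewrite setTI; apply: sub_sigma_algebra.
exact/cf/interval_open.
Qed.

Lemma measurable_phi k : measurable_fun setT (phi k : borel Xi -> R).
Proof. by apply: measurable_continuous; apply: (dd_phi_continuous Xi_dd). Qed.

Lemma measurable_ker J g x : measurable_fun setT (ker J g x : borel Xi -> R).
Proof.
apply: measurable_sum => k; apply: measurable_funM; last exact: measurable_phi.
exact: measurable_cst.
Qed.

Lemma measurable_cball x r : measurable (cball x r : set (borel Xi)).
Proof.
have [r0|r0] := ltP r 0.
  rewrite (_ : cball x r = set0); first exact: measurable0.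
  apply/seteqP; split => // y; rewrite /cball /=.
  by move=> yr; have := le_lt_trans (le_trans (rho_ge0 Xi_dd x y) yr) r0; rewrite ltxx.
rewrite (_ : cball x r = \bigcap_n [set y | rho x y < r + n.+1%:R^-1]).
  apply: bigcapT_measurable => n; apply: sub_sigma_algebra.
  apply: (dd_basis Xi_dd).1; exists x, (r + n.+1%:R^-1); split => //.
  by rewrite ltr_wpDl// invr_gt0.
apply/seteqP; split => y /=.
  by move=> yr n _ /=; rewrite (le_lt_trans yr)// ltrDl invr_gt0.
move=> H; apply/ler_addgt0Pr => e e0.
have [n ne] : exists n : nat, n.+1%:R^-1 < e.
  exists (Num.truncn e^-1); rewrite -[ltRHS]invrK ltf_pV2 ?posrE ?invr_gt0//.
  exact: truncnS_gt.
by apply: le_trans (ltW (H n Logic.I)) _; rewrite lerD2l ltW.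
Qed.

End localization2.

(** * Integrals of localised kernels *)

Section step_integral.
Context {R : realType} {d : measure_display} {T : measurableType d}.
Variable nu : {measure set T -> \bar R}.

Lemma integral_step_fun (I : Type) (s : seq I) (c : I -> R) (A : I -> set T) :
  (forall i, 0 <= c i) -> (forall i, measurable (A i)) ->
  (\int[nu]_y (\sum_(i <- s) c i * \1_(A i) y)%:E = \sum_(i <- s) (c i)%:E * nu (A i))%E.
Proof.
move=> c0 mA; under eq_integral do rewrite -sumEFin.
rewrite ge0_integral_sum//.
- apply: eq_bigr => i _; under eq_integral do rewrite EFinM.
  rewrite ge0_integralZl_EFin//; last by apply/measurable_EFinP; exact: measurable_indic.
  by rewrite integral_indic// setIT.
- by move=> i; apply/measurable_EFinP; apply: measurable_funM => //; exact: measurable_indic.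
- by move=> i x _; rewrite lee_fin mulr_ge0.
Qed.

End step_integral.

Section ker_integral.
Context {R : realType} (Xi : system R) (q : R) (Xi_dd : data_defined Xi q).
Variable S : nat.
Hypothesis qS : q < S%:R.
Implicit Types (x y : Xi) (nu : {measure set (borel Xi) -> \bar R}).

(** Ratio of the geometric series over dyadic shells: volume growth (2^j)^q against kernel decay
    2^(-jS), convergent because q < S. *)
Let theta : R := 2 `^ q / 2 ^+ S.

Let theta_ge0 : 0 <= theta.
Proof. by rewrite divr_ge0 ?powR_ge0 ?exprn_ge0. Qed.

Let theta_lt1 : theta < 1.
Proof.
rewrite ltr_pdivrMr ?exprn_gt0// mul1r -powR_mulrn//.
by rewrite /powR pnatr_eq0 /= ltr_expR ltr_pM2r ?ln_gt0 ?ltr1n.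
Qed.

Lemma powR_exp2 (j : nat) (s : R) : (2 ^+ j) `^ s = (2 `^ s) ^+ j.
Proof.
have -> : (2 ^+ j : R) = 2 `^ j%:R by rewrite powR_mulrn.
by rewrite -powRrM mulrC powRrM powR_mulrn// powR_ge0.
Qed.

Lemma geometric_le (t : R) n : 0 <= t < 1 -> \sum_(i < n) t ^+ i <= (1 - t)^-1.
Proof.
move=> /andP[t0 t1]; rewrite -[leRHS]mul1r ler_pdivlMr ?subr_gt0//.
by rewrite -[X in _ * X]opprB mulrN mulrC -subrX1 opprB gerBl exprn_ge0.
Qed.

(** The kernel is dominated by a step function: a constant on the central ball, smaller constants on
    the dyadic balls up to radius 1, and the smallest one on the whole space. *)
Lemma int_ker_dyadic : exists2 C : R, 0 < C & forall M m a J g x nu, kmask Xi S M m J g ->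
  (a <= m)%N ->
  (\int[nu]_y (`|ker J g x y|)%:E <= (C * M * (2 ^+ m) `^ q)%:E *
    (nu (cball x (2 ^+ a / 2 ^+ m)) +
     \sum_(a.+1 <= j < m.+1) (2 ^+ (j * S))^-1%:E * nu (cball x (2 ^+ j / 2 ^+ m)) +
     (2 ^+ (m * S))^-1%:E * nu setT))%E.
Proof.
have [C C0 loc] := ker_localized Xi_dd qS.
have p2 k : 0 < 2 ^+ k :> R by rewrite exprn_gt0.
exists (C * 2 ^+ S); first by rewrite mulr_gt0.
move=> M m a J g x nu km am.
have M0 := kmask_ge0 km.
pose K := C * 2 ^+ S * M * (2 ^+ m) `^ q.
pose K0 := C * M * (2 ^+ m) `^ q.
have K00 : 0 <= K0 by rewrite /K0 !mulr_ge0 ?powR_ge0 ?(ltW C0).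
have KE : K = K0 * 2 ^+ S by rewrite /K /K0; ring.
have K0K : K0 <= K by rewrite KE ler_peMr// exprn_ege1// ler1n.
have K_ge0 : 0 <= K by apply: le_trans K0K.
(* Index a stands for the central ball and index m + 1 for the whole space. *)
pose c (j : nat) := if j == a then K else if (j <= m)%N then K / 2 ^+ (j * S) else K / 2 ^+ (m * S).
pose A (j : nat) : set (borel Xi) := if (j <= m)%N then cball x (2 ^+ j / 2 ^+ m) else setT.
have c0 j : 0 <= c j.
  by rewrite /c; case: ifP => // _; case: ifP => _; rewrite divr_ge0// ltW.
have mA j : measurable (A j).
  by rewrite /A; case: ifP => // _; exact: measurable_cball Xi_dd _ _.
have dom y : `|ker J g x y| <= \sum_(j <- index_iota a m.+2) c j * \1_(A j) y.
  have pick (j : nat) : (a <= j < m.+2)%N -> A j y -> `|ker J g x y| <= c j ->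
      `|ker J g x y| <= \sum_(j <- index_iota a m.+2) c j * \1_(A j) y.
    move=> ja Ajy /le_trans; apply; rewrite (bigD1_seq j) ?mem_index_iota ?iota_uniq//=.
    rewrite indicE mem_set// mulr1 lerDl sumr_ge0// => i _.
    by rewrite mulr_ge0.
  have [l1 l2] := loc M m J g x y km.
  have [far|near] := ltP (2 ^+ m) (2 ^+ m * rho x y).
    apply: (pick m.+1); first by rewrite ltnSn ltnW.
      by rewrite /A ltnn.
    rewrite /c gtn_eqF ?ltnS// ltnn; apply: le_trans (l2 m (leqnn m) far) _.
    by rewrite ler_wpM2r// invr_ge0 ltW.
  have exj : exists j, 2 ^+ m * rho x y <= 2 ^+ j by exists m.
  have [j jP jmin] := ex_minnP exj.
  have jm : (j <= m)%N by exact: jmin.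
  have [ja|aj] := leqP j a.
    apply: (pick a); first by rewrite leqnn ltnS ltnW.
      rewrite /A am /cball /= ler_pdivlMr// mulrC (le_trans jP)//.
      by rewrite ler_weXn2l ?ler1n.
    by rewrite /c eqxx (le_trans l1).
  have j0 : (0 < j)%N by apply: leq_ltn_trans aj.
  apply: (pick j); first by rewrite ltnW//= ltnS ltnW.
    by rewrite /A jm /cball /= ler_pdivlMr// mulrC.
  (* By minimality of j the point lies beyond the radius 2^(j-1)/2^m; using the decay at j - 1 costs
     the factor 2^S of [K]. *)
  rewrite /c gtn_eqF// jm; apply: le_trans (l2 j.-1 _ _) _.
  - by rewrite (leq_trans (leq_pred _)).
  - by rewrite ltNge; apply/negP => /jmin; rewrite leqNgt prednK// leqnn.
  rewrite -/K0 KE ler_pdivlMr// -mulrA ler_wpM2l// mulrC ler_pdivrMr//.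
  by rewrite -exprD -mulSn prednK.
apply: (@le_trans _ _ (\int[nu]_y (\sum_(j <- index_iota a m.+2) c j * \1_(A j) y)%:E)%E).
  apply: ge0_le_integral => //.
  - by apply/measurable_EFinP; apply: measurableT_comp => //; exact: measurable_ker Xi_dd _ _ _.
  - apply/measurable_EFinP; apply: measurable_sum => j.
    by apply: measurable_funM => //; exact: measurable_indic.
  - by move=> y _; rewrite lee_fin.
rewrite integral_step_fun//.
rewrite -[index_iota a m.+2]/(index_iota a m.+2) big_ltn; last by rewrite ltnS ltnW.
rewrite big_nat_recr/=; last by rewrite ltnS.
rewrite /c eqxx gtn_eqF ?ltnS// ltnn /A am ltnn -/K.
have n0 B : (0 <= nu B)%E by [].
have s0 : (0 <= \sum_(a.+1 <= j < m.+1) (2 ^+ (j * S))^-1%:E * nu (cball x (2 ^+ j / 2 ^+ m)))%E.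
  by rewrite sume_ge0// => i _; rewrite mule_ge0// lee_fin invr_ge0 ltW.
have t0 : (0 <= (2 ^+ (m * S))^-1%:E * nu setT)%E.
  by rewrite mule_ge0// lee_fin invr_ge0 ltW.
rewrite [in leRHS]ge0_muleDr ?adde_ge0// [in leRHS]ge0_muleDr//.
rewrite addeA leeD//; last by rewrite EFinM muleA.
rewrite leeD// ge0_sume_distrr; last first.
  by move=> i _; rewrite mule_ge0// lee_fin invr_ge0 ltW.
rewrite le_eqVlt; apply/orP; left; apply/eqP; apply: eq_big_nat => j /andP[aj jm].
by rewrite gtn_eqF// -ltnS jm EFinM muleA.
Qed.

(** The case a = 0 of [int_ker_dyadic], with the shells summed as a geometric series of ratio
    [theta]. *)
Lemma int_ker_bound : exists2 C : R, 0 < C & forall M m J g x nu (E T : R),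
  kmask Xi S M m J g -> 0 <= E -> 0 <= T ->
  (forall j, (j <= m)%N -> (nu (cball x (2 ^+ j / 2 ^+ m)) <= (E * (2 ^+ j) `^ q)%:E)%E) ->
  (nu setT <= T%:E)%E ->
  (\int[nu]_y (`|ker J g x y|)%:E <= (C * M * ((2 ^+ m) `^ q * E + T))%:E)%E.
Proof.
have [C C0 dy] := int_ker_dyadic.
have p2 k : 0 < 2 ^+ k :> R by rewrite exprn_gt0.
have t1 : 0 < 1 - theta by rewrite subr_gt0 theta_lt1.
have D1 : 1 <= (1 - theta)^-1 by rewrite invf_ge1// gerBl theta_ge0.
exists (C * (1 - theta)^-1); first by rewrite mulr_gt0// invr_gt0.
move=> M m J g x nu E T km E0 T0 ball tot.
have M0 := kmask_ge0 km.
apply: le_trans (dy M m 0%N J g x nu km (leq0n m)) _.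
have CM : 0 <= C * M by rewrite mulr_ge0// ltW.
have Q0 : 0 <= (2 ^+ m) `^ q by exact: powR_ge0.
have th k : (2 ^+ k) `^ q / 2 ^+ (k * S) = theta ^+ k.
  by rewrite powR_exp2 mulnC exprM -expr_div_n.
have s : (nu (cball x (2 ^+ 0 / 2 ^+ m)) +
    \sum_(1 <= j < m.+1) (2 ^+ (j * S))^-1%:E * nu (cball x (2 ^+ j / 2 ^+ m)) <=
    (E * (1 - theta)^-1)%:E)%E.
  apply: (@le_trans _ _ (\sum_(0 <= j < m.+1) (E * theta ^+ j)%:E)%E); last first.
    rewrite sumEFin lee_fin -mulr_sumr ler_wpM2l// big_mkord geometric_le//.
    by rewrite theta_ge0 theta_lt1.
  rewrite [leRHS]big_ltn// leeD//; first by have := ball 0%N (leq0n m); rewrite powR1.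
  rewrite big_seq [leRHS]big_seq; apply: lee_sum => j.
  rewrite mem_index_iota => /andP[_ jm].
  apply: le_trans (lee_wpmul2l _ (ball j jm)) _; first by rewrite lee_fin invr_ge0 ltW.
  by rewrite -EFinM lee_fin mulrC -mulrA th.
apply: (@le_trans _ _ ((C * M * (2 ^+ m) `^ q)%:E * ((E * (1 - theta)^-1)%:E + ((2 ^+ (m * S))^-1 * T)%:E))%E).
  apply: lee_wpmul2l; first by rewrite lee_fin mulr_ge0.
  apply: leeD; first exact: s.
  by rewrite EFinM; apply: lee_wpmul2l; rewrite // lee_fin invr_ge0 ltW.
rewrite -EFinD -EFinM lee_fin.
have -> : C * (1 - theta)^-1 * M * ((2 ^+ m) `^ q * E + T) =
   C * M * ((2 ^+ m) `^ q * (E * (1 - theta)^-1) + (1 - theta)^-1 * T) by ring.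
rewrite -(mulrA (C * M)) ler_wpM2l// mulrDr lerD2l [X in X <= _]mulrA th ler_wpM2r//.
by rewrite (le_trans _ D1)// exprn_ile1 ?theta_ge0// ltW// theta_lt1.
Qed.

End ker_integral.

(** * Filters of the system, volume of balls from below, and packing *)

Section ball_measure.
Context {R : realType} (Xi : system R) (q : R) (Xi_dd : data_defined Xi q).
Variable S : nat.
Hypothesis qS : q < S%:R.
Implicit Types (x y : Xi) (nu : {measure set (borel Xi) -> \bar R}).

Lemma usmooth_cmask (I : Type) (psi : I -> R -> R) :
  usmooth S (oo (- 4^-1) (9 / 8)) psi ->
  exists2 M : R, 0 < M & forall i, cmask S M (psi i).
Proof.
move=> /usmooth_uniform [df [M hM]].
have sub (t : R) : 0 <= t <= 1 -> oo (- 4^-1) (9 / 8) t.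
  by move=> /andP[t0 t1]; apply/andP; split; lra.
exists (`|M| + 1); first by rewrite ltr_wpDl.
move=> i; split => j t jS /sub tD; first exact: df.
by rewrite (le_trans (hM i j t jS tD))// (le_trans (ler_norm _))// lerDl.
Qed.

(* An index beyond which all frequencies are at least [2 ^ m]. *)
Lemma lam_large m : exists J, forall k, (J <= k)%N -> 2 ^+ m <= lam Xi k.
Proof.
have /cvgryPge/(_ (2 ^+ m)) [J _ H] := dd_lam_infty Xi_dd.
by exists J => k Jk; exact: H.
Qed.

(** Not literally a dimension: some chosen index past all frequencies below 2^m, used as a length
    for sums of filtered terms. *)
Definition dimPi m : nat := projT1 (cid (lam_large m)).

Lemma dimPiP m k : (dimPi m <= k)%N -> 2 ^+ m <= lam Xi k.
Proof. exact: (projT2 (cid (lam_large m))). Qed.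

Lemma lowpass_kmask : exists2 M : R, 0 < M &
  forall m, kmask Xi S M m (dimPi m) (fun k => lowpass S m (lam Xi k)).
Proof.
have [psi spsi psiE] := @lowpass_mask R S.
have [M M0 hM] := usmooth_cmask spsi.
exists M => // m; apply: unit_kmaskW; exists psi; first exact: hM tt.
split=> [k|k /dimPiP]; first exact: psiE.
exact: lowpass_eq0.
Qed.

Lemma kmask_multiplier (alpha : R) (F : R -> R) :
  usmooth S setT (fun _ : unit => F) ->
  exists2 M : R, 0 < M & forall m,
    kmask Xi S (M * (2 ^+ m.+1) `^ alpha) m.+1 (dimPi m.+1)
      (fun k => band S m (lam Xi k) * ((1 + lam Xi k) `^ alpha * F (ln (lam Xi k)))).
Proof.
move=> sF; have [psi spsi psiE] := multiplier_mask alpha sF.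
have [M M0 hM] := usmooth_cmask spsi.
exists M => // m; set c := (2 ^+ m.+1) `^ alpha.
have c0 : 0 < c by rewrite powR_gt0// exprn_gt0.
exists c, M, (fun k => gauss m.+1 (lam Xi k) * psi m (gauss m.+1 (lam Xi k))); split.
- exists (psi m) => //; split=> // k /dimPiP h.
  have := psiE m _ (lam_ge0 Xi_dd k); rewrite band_eq0// mul0r => /esym/eqP.
  by rewrite mulf_eq0 gt_eqF//= => /eqP.
- by rewrite ger0_norm 1?mulrC// ltW.
- by move=> k; rewrite psiE// (lam_ge0 Xi_dd).
Qed.

Lemma int_phi k : (\int[mustar Xi]_x phi k x)%R = (k == 0%N)%:R.
Proof.
rewrite -(dd_phi_orthonormal Xi_dd); congr fine; apply: eq_integral => x _.
by rewrite (dd_phi0 Xi_dd) mulr1.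
Qed.

Lemma integrable_phi (nu : {measure set (borel Xi) -> \bar R}) k :
  (nu setT < +oo)%E -> nu.-integrable setT (EFin \o (phi k : borel Xi -> R)).
Proof.
move=> nuT; have [B hB] := dd_phi_bounded Xi_dd k.
apply: measurable_bounded_integrable => //; first exact: measurable_phi Xi_dd k.
exists B; split; first exact: num_real.
by move=> M BM x _; apply: le_trans (hB x) (ltW BM).
Qed.

Lemma Rintegral_ker (nu : {measure set (borel Xi) -> \bar R}) J g x :
  (nu setT < +oo)%E ->
  (\int[nu]_y ker J g x y)%R = \sum_(k < J) g k * phi k x * (\int[nu]_y phi k y)%R.
Proof.
move=> nuT; rewrite /Rintegral /ker.
under eq_integral do rewrite -sumEFin.
have ik (k : 'I_J) : nu.-integrable setT (fun y => (g k * phi k x * phi k y)%:E).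
  exact: (integrableZl measurableT (g k * phi k x) (integrable_phi k nuT)).
rewrite integral_sum// -sum_fine; last first.
  by move=> k _; apply: integrable_fin_num => //; exact: ik.
apply: eq_bigr => k _; have ip := integrable_phi k nuT.
under eq_integral do rewrite EFinM.
by rewrite integralZl// fineM// integrable_fin_num.
Qed.

Lemma integrable_ker (nu : {measure set (borel Xi) -> \bar R}) J g x :
  (nu setT < +oo)%E -> nu.-integrable setT (EFin \o (ker J g x : borel Xi -> R)).
Proof.
move=> nuT; rewrite (_ : _ \o _ = (fun y => \sum_(k < J) (g k * phi k x * phi k y)%:E)%E).
  apply: integrable_sum => // k _.
  exact: (integrableZl measurableT (g k * phi k x) (integrable_phi k nuT)).
by apply/funext => y /=; rewrite /ker -sumEFin.
Qed.

Lemma mustar_lty : (mustar Xi setT < +oo)%E.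
Proof. by rewrite probability_setT ltry. Qed.

(** Since phi_0 = 1, orthonormality kills every term except k = 0, where the filter equals 1. *)
Lemma int_lowpass m x :
  (\int[mustar Xi]_y ker (dimPi m) (fun k => lowpass S m (lam Xi k)) x y)%R = 1.
Proof.
rewrite (Rintegral_ker _ _ _ mustar_lty).
have d0 : (0 < dimPi m)%N.
  rewrite lt0n; apply/eqP => h; have := @dimPiP m 0%N; rewrite h (dd_lam0 Xi_dd).
  by move=> /(_ (leqnn 0)); rewrite leNgt exprn_gt0.
rewrite (bigD1 (Ordinal d0))//= int_phi eqxx mulr1 (dd_phi0 Xi_dd) mulr1.
rewrite (dd_lam0 Xi_dd) lowpass_eq1 ?mulr0 ?exprn_ge0//.
rewrite big1 ?addr0// => k k0; rewrite int_phi.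
by rewrite (_ : (k : nat) == 0%N = false) ?mulr0//; apply/negbTE.
Qed.

End ball_measure.

Section ball_measure2.
Context {R : realType} (Xi : system R) (q : R) (Xi_dd : data_defined Xi q).
Variable S : nat.
Hypothesis qS : q < S%:R.
Implicit Types (x y : Xi) (nu : {measure set (borel Xi) -> \bar R}).

Let q_ge0 : 0 <= q. Proof. exact: ltW (q_gt0 Xi_dd). Qed.

Lemma cball_sub x (r s : R) : r <= s -> cball x r `<=` cball x s.
Proof. by move=> rs y; rewrite /cball /= => /le_trans; exact. Qed.

Lemma le_cball nu x (r s : R) : r <= s -> (nu (cball x r) <= nu (cball x s))%E.
Proof.
move=> rs; apply: le_measure; rewrite ?inE; last exact: cball_sub.
  exact: measurable_cball Xi_dd _ _.
exact: measurable_cball Xi_dd _ _.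
Qed.

(** The low-pass kernel has integral 1, while its part outside a ball of radius 2^a/2^m is small for
    large a by localisation and the upper bound on volumes. So the ball carries at least half of the
    integral of a kernel of size 2^(mq). *)
Lemma dyadic_ball_lower : exists a c, 0 < c :> R /\
  forall m x, (a <= m)%N ->
    ((c * ((2 ^+ m) `^ q)^-1)%:E <= mustar Xi (cball x (2 ^+ a / 2 ^+ m)))%E.
Proof.
have [C C0 dy] := int_ker_dyadic Xi_dd qS.
have [M M0 lpm] := lowpass_kmask Xi_dd S.
have [k2 k20 ball] := dd_ball_measure Xi_dd.
pose theta : R := 2 `^ q / 2 ^+ S.
have th0 : 0 <= theta by rewrite divr_ge0 ?powR_ge0 ?exprn_ge0.
have th1 : theta < 1.
  rewrite ltr_pdivrMr ?exprn_gt0// mul1r -powR_mulrn//.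
  by rewrite /powR pnatr_eq0 /= ltr_expR ltr_pM2r ?ln_gt0 ?ltr1n.
have th k : (2 ^+ k) `^ q / 2 ^+ (k * S) = theta ^+ k.
  by rewrite powR_exp2 mulnC exprM -expr_div_n.
have t1 : 0 < 1 - theta by rewrite subr_gt0.
pose D := C * M * (k2 / (1 - theta) + 1).
have D0 : 0 < D by rewrite !mulr_gt0// addr_gt0// divr_gt0.
(* This [a] makes the contribution outside the central ball at most 1/2. *)
have [a ha] : exists a, theta ^+ a <= (2 * D)^-1.
  have /cvgrPdist_le/(_ (2 * D)^-1) : theta ^+ n @[n --> \oo] --> 0.
    by apply: cvg_expr; rewrite ger0_norm.
  rewrite invr_gt0 mulr_gt0// => /(_ isT)[a _ ha]; exists a.
  by have := ha a (leqnn a); rewrite sub0r normrN ger0_norm// exprn_ge0.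
exists a, (2 * (C * M))^-1; split; first by rewrite invr_gt0 !mulr_gt0.
move=> m x am.
set g := fun k => lowpass S m (lam Xi k).
have Q0 : 0 < (2 ^+ m) `^ q by rewrite powR_gt0// exprn_gt0.
have p2 k : 0 < 2 ^+ k :> R by rewrite exprn_gt0.
have one : (1%:E <= \int[mustar Xi]_y (`|ker (dimPi Xi_dd m) g x y|)%:E)%E.
  rewrite -[X in X%:E](int_lowpass Xi_dd S m x) -/g.
  have ik : (mustar Xi).-integrable setT (fun y => (ker (dimPi Xi_dd m) g x y)%:E).
    by apply: (@integrable_ker _ _ _ Xi_dd (mustar Xi)); exact: mustar_lty.
  rewrite /Rintegral fineK ?integrable_fin_num//.
  apply: le_integral => //; first exact: integrable_norm.
  by move=> y _; rewrite lee_fin ler_norm.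
have := le_trans one (dy M m a _ g x (mustar Xi) (lpm m) am).
have fin_mu : mustar Xi (cball x (2 ^+ a / 2 ^+ m)) \is a fin_num.
  by apply: fin_num_measure; exact: measurable_cball Xi_dd _ _.
have tot : ((mustar Xi : {measure set (borel Xi) -> \bar R}) setT = 1)%E by exact: probability_setT.
rewrite tot mule1; set u := fine (mustar Xi (cball x (2 ^+ a / 2 ^+ m))).
have bs : (\sum_(a.+1 <= j < m.+1) (2 ^+ (j * S))^-1%:E * mustar Xi (cball x (2 ^+ j / 2 ^+ m)) <=
    (((2 ^+ m) `^ q)^-1 * (k2 * theta ^+ a / (1 - theta)))%:E)%E.
  apply: (@le_trans _ _ (\sum_(a.+1 <= j < m.+1) (((2 ^+ m) `^ q)^-1 * (k2 * theta ^+ j))%:E)%E).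
    apply: lee_sum => j _.
    apply: (le_trans (lee_wpmul2l _ (ball x (2 ^+ j / 2 ^+ m) _))).
    - by rewrite lee_fin invr_ge0 ltW.
    - by rewrite divr_gt0.
    rewrite -EFinM lee_fin powRM ?invr_ge0 ?(ltW (p2 _))// -[in leLHS]powR_inv1 ?(ltW (p2 _))//.
    rewrite -th powRAC powR_inv1 ?powR_ge0// le_eqVlt; apply/orP; left; apply/eqP; ring.
  rewrite sumEFin lee_fin -mulr_sumr ler_wpM2l ?invr_ge0 ?(ltW Q0)//.
  rewrite -mulr_sumr -mulrA ler_wpM2l ?(ltW k20)//.
  rewrite -{1}(add0n a.+1) big_addn big_mkord.
  under eq_bigr do rewrite addnC exprD.
  rewrite -mulr_sumr ler_pM ?exprn_ge0//; first by rewrite sumr_ge0// => i _; rewrite exprn_ge0.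
    by rewrite exprSr ler_piMr ?exprn_ge0// ltW.
  by apply: geometric_le; rewrite th0.
have CMQ : 0 <= C * M * (2 ^+ m) `^ q by rewrite !mulr_ge0 ?powR_ge0// ltW.
move=> h; have {h} : (1%:E <= (C * M * (2 ^+ m) `^ q)%:E * (u%:E +
   (((2 ^+ m) `^ q)^-1 * (k2 * theta ^+ a / (1 - theta)))%:E + ((2 ^+ (m * S))^-1)%:E))%E.
  apply: (le_trans h); apply: lee_wpmul2l; first by rewrite lee_fin.
  by apply: leeD => //; apply: leeD => //; rewrite /u fineK.
rewrite -!EFinD -EFinM !lee_fin.
have e3 : (2 ^+ (m * S))^-1 = ((2 ^+ m) `^ q)^-1 * theta ^+ m.
  by rewrite -th mulrA mulVf ?mul1r// gt_eqF.
have tm : theta ^+ m <= theta ^+ a by rewrite -(subnKC am) exprD ler_piMr ?exprn_ge0// exprn_ile1// ltW.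
rewrite e3; move: CMQ tm ha {one bs e3 dy lpm ball}.
move: (theta ^+ m) (theta ^+ a) ((2 ^+ m) `^ q) Q0 => A B Q Q0 CMQ AB BD H.
have H1 : 1 <= C * M * Q * u + D * B.
  apply: le_trans H _.
  have -> : C * M * Q * (u + Q^-1 * (k2 * B / (1 - theta)) + Q^-1 * A) =
    C * M * Q * u + C * M * (k2 * B / (1 - theta) + A).
    by field; rewrite !gt_eqF.
  rewrite lerD2l /D -!mulrA ler_wpM2l ?(ltW C0)// ler_wpM2l ?(ltW M0)//.
  by rewrite mulrDl mul1r mulrA mulrAC lerD2l.
have H2 : D * B <= 2^-1.
  apply: le_trans (ler_wpM2l (ltW D0) BD) _.
  by rewrite invfM mulrCA divff ?mulr1// gt_eqF.
rewrite -(fineK fin_mu) lee_fin -/u -invfM -[leLHS]mulr1 ler_pdivrMl ?mulr_gt0//.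
rewrite (_ : 2 * (C * M) * Q * u = 2 * (C * M * Q * u)); last by ring.
move: H1 H2; move: (C * M * Q * u) (D * B) => s t; lra.
Qed.

(** Dyadic radii suffice: the least m with 2^a/2^m <= d loses a bounded factor. *)
Lemma ball_lower : exists2 c : R, 0 < c & forall x d, 0 < d <= 1 ->
  ((c * d `^ q)%:E <= mustar Xi (cball x d))%E.
Proof.
have [a [c [c0 H]]] := dyadic_ball_lower.
have p2 k : 0 < 2 ^+ k :> R by rewrite exprn_gt0.
exists (c / (2 ^+ a.+1) `^ q); first by rewrite divr_gt0// powR_gt0.
move=> x d /andP[d0 d1].
have ex : exists m, 2 ^+ a / 2 ^+ m <= d.
  exists (a + Num.truncn d^-1)%N; rewrite exprD invfM mulrA divff ?gt_eqF// mul1r.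
  rewrite -[leRHS]invrK lef_pV2 ?posrE ?invr_gt0//.
  apply: ltW; apply: lt_le_trans (truncnS_gt _) _.
  by rewrite -natrX ler_nat ltn_expl.
have [m mP mmin] := ex_minnP ex.
have am : (a <= m)%N.
  rewrite leqNgt; apply/negP => ma; have := le_trans mP d1.
  by rewrite ler_pdivrMr// mul1r ler_eXn2l ?ltr1n// leqNgt ma.
have dm : d <= 2 ^+ a.+1 / 2 ^+ m.
  case: m am mP mmin => [|m] am mP mmin.
    by rewrite expr0 divr1 (le_trans d1)// exprn_ege1// ler1n.
  rewrite leNgt; apply/negP => h.
  suff /mmin : 2 ^+ a / 2 ^+ m <= d by rewrite ltnn.
  by apply: le_trans (ltW h); rewrite (exprS 2 a) (exprS 2 m) -mulf_div divff ?mul1r.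
apply: le_trans (le_cball (mustar Xi) x mP).
apply: le_trans (H m x am); rewrite lee_fin -mulrA ler_wpM2l ?(ltW c0)//.
rewrite mulrC ler_pdivrMr ?powR_gt0// mulrC.
have -> : (2 ^+ a.+1) `^ q * ((2 ^+ m) `^ q)^-1 = (2 ^+ a.+1 / 2 ^+ m) `^ q.
  rewrite powRM ?invr_ge0 ?(ltW (p2 _))//; congr (_ * _).
  by rewrite -powR_inv1 ?powR_ge0// powRAC powR_inv1 ?(ltW (p2 _)).
by apply: ge0_ler_powR => //; rewrite nnegrE ?divr_ge0 ?(ltW (p2 _))// ltW.
Qed.

(** Balls of radius d around a maximal d-separated subset of the large ball cover it. The smaller
    balls of radius d/(2 k1) around the same points are disjoint, so comparing the lower and upper
    volume bounds shows that there are at most C (2^j)^q of them. *)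
Lemma covering_bound : exists2 C : R, 0 < C & forall nu (D d : R), 0 < d <= 1 -> 0 <= D ->
  (forall x, (nu (cball x d) <= (D * d `^ q)%:E)%E) ->
  forall j x, (nu (cball x (2 ^+ j * d)) <= (C * D * (2 ^+ j) `^ q * d `^ q)%:E)%E.
Proof.
have [c c0 lower] := ball_lower.
have [k2 k20 upper] := dd_ball_measure Xi_dd.
have [_ _ _ [k1 k11 tri]] := dd_quasi_metric Xi_dd.
have k10 : 0 < k1 by apply: lt_le_trans k11.
pose C := k2 / c * (4 * k1 ^+ 2) `^ q.
have C0 : 0 < C by rewrite mulr_gt0 ?divr_gt0// powR_gt0// mulr_gt0// exprn_gt0.
exists C => // nu D d /andP[d0 d1] D0 nud j x.
have p2 : 0 < 2 ^+ j :> R by rewrite exprn_gt0.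
have p21 : 1 <= 2 ^+ j :> R by rewrite exprn_ege1// ler1n.
pose separated k := exists z : nat -> Xi,
  (forall i, (i < k)%N -> rho x (z i) <= 2 ^+ j * d) /\
  (forall i l, (i < l < k)%N -> d < rho (z i) (z l)).
pose e := d / (2 * k1).
have e0 : 0 < e by rewrite divr_gt0// mulr_gt0.
(* Since e <= d <= 1, [ball_lower] applies at radius e; the quasi-triangle inequality makes the
   balls of radius e around separated points disjoint. *)
have ed : e <= d by rewrite ler_pdivrMr ?mulr_gt0// ler_peMr ?(ltW d0)//; lra.
have sep_le k : separated k -> k%:R <= C * (2 ^+ j) `^ q.
  move=> [z [zx zz]].
  have tz : trivIset [set: 'I_k] (fun i => cball (z i) e).
    apply/trivIsetP => a b _ _ ab; apply/eqP/negPn/negP => /set0P[u [ua ub]].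
    have H (i l : 'I_k) : (i < l)%N -> cball (z i) e u -> cball (z l) e u -> False.
      move=> il ui ul; have := zz i l; rewrite il ltn_ord => /(_ isT).
      rewrite ltNge => /negP; apply.
      apply: le_trans (tri (z i) (z l) u) _; rewrite (rhoC Xi_dd u).
      have -> : d = k1 * (e + e) by rewrite /e; field; rewrite gt_eqF.
      by rewrite ler_wpM2l ?(ltW k10)// lerD.
    have : (a != b :> nat)%N by [].
    by rewrite neq_ltn => /orP[ab'|ba]; [exact: (H a b)|exact: (H b a)].
  have mc (i : 'I_k) : measurable (cball (z i) e : set (borel Xi)).
    exact: measurable_cball Xi_dd _ _.
  have h1 : (\sum_(i < k) mustar Xi (cball (z i) e) <=
      mustar Xi (cball x (k1 * (2 ^+ j * d + e))))%E.
    rewrite -(measure_bigsetU_ord _ xpredT mc tz); apply: le_measure; rewrite ?inE.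
    - by apply: bigsetU_measurable.
    - exact: measurable_cball Xi_dd _ _.
    move=> u; rewrite -bigcup_seq => -[i _ ui].
    rewrite /cball /=; apply: le_trans (tri x u (z i)) _.
    by rewrite ler_wpM2l ?(ltW k10)// lerD// zx.
  have h2 : ((k%:R * (c * e `^ q))%:E <= \sum_(i < k) mustar Xi (cball (z i) e))%E.
    apply: (@le_trans _ _ (\sum_(i < k) (c * e `^ q)%:E)%E).
      by rewrite sumEFin sumr_const card_ord mulr_natl.
    by apply: lee_sum => i _; apply: lower; rewrite e0 (le_trans ed).
  have r0 : 0 < k1 * (2 ^+ j * d + e) by rewrite mulr_gt0// addr_gt0// mulr_gt0.
  have := le_trans (le_trans h2 h1) (upper x _ r0); rewrite lee_fin.
  have h3 : (k1 * (2 ^+ j * d + e)) `^ q <= (4 * k1 ^+ 2 * 2 ^+ j) `^ q * e `^ q.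
    rewrite -powRM ?(ltW e0) ?mulr_ge0 ?exprn_ge0 ?(ltW k10)//.
    apply: ge0_ler_powR => //; rewrite ?nnegrE ?(ltW r0)//.
      by apply: mulr_ge0 (ltW e0); rewrite mulr_ge0 ?(ltW p2)// mulr_ge0// exprn_ge0// ltW.
    have -> : 4 * k1 ^+ 2 * 2 ^+ j * e = k1 * (2 ^+ j * d + 2 ^+ j * d).
      by rewrite /e; field; rewrite gt_eqF.
    by rewrite ler_wpM2l ?(ltW k10)// lerD2l (le_trans ed)// ler_peMl ?(ltW d0).
  move=> H; have := le_trans H (ler_wpM2l (ltW k20) h3).
  rewrite !mulrA ler_pM2r ?powR_gt0// -ler_pdivlMr// => {}H; apply: le_trans H _.
  rewrite powRM ?exprn_ge0 ?mulr_ge0 ?exprn_ge0 ?(ltW k10)//.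
  by rewrite /C !mulrA [X in _ <= X * _]mulrAC [X in _ <= X]mulrAC.
have exsep : exists k, `[< separated k >].
  by exists 0%N; apply/asboolP; exists (fun=> x); split => // i l; rewrite ltn0 andbF.
have bsep k : `[< separated k >] -> (k <= Num.truncn (C * (2 ^+ j) `^ q))%N.
  move=> /asboolP/sep_le h; rewrite truncn_ge_nat//.
  by rewrite mulr_ge0 ?powR_ge0// ltW.
have [k /asboolP ks kmax] := ex_maxnP exsep bsep.
have [z [zx zz]] := ks.
(* An uncovered point could be appended to the separated sequence, against the maximality of k. *)
have cov : cball x (2 ^+ j * d) `<=` \big[setU/set0]_(i < k) cball (z i) d.
  move=> y yx; apply: contrapT => ny.
  suff : separated k.+1 by move=> /asboolP/kmax; rewrite ltnn.
  exists (fun i => if (i < k)%N then z i else y); split.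
    by move=> i _; case: ifP => [/zx|_].
  move=> i l /andP[il]; rewrite ltnS leq_eqVlt => /predU1P[lk|lk]; last first.
    by rewrite lk (ltn_trans il lk) zz// il.
  rewrite lk in il *; rewrite ltnn il ltNge; apply/negP => zy; apply: ny.
  by rewrite -(bigcup_mkord k (fun i => cball (z i) d)); exists i.
apply: (@le_trans _ _ (\sum_(i < k) nu (cball (z i) d))%E).
  by apply: (content_subadditive nu (F := fun i => cball (z i) d)) => // [i _|]; exact: measurable_cball Xi_dd _ _.
apply: (@le_trans _ _ (\sum_(i < k) (D * d `^ q)%:E)%E).
  by apply: lee_sum.
rewrite sumEFin sumr_const card_ord lee_fin -[X in X <= _]mulr_natl.
apply: (@le_trans _ _ (C * (2 ^+ j) `^ q * (D * d `^ q))).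
  by rewrite ler_wpM2r ?mulr_ge0 ?powR_ge0// sep_le.
by rewrite mulrA (mulrAC C).
Qed.

End ball_measure2.

(** * Norms over a probability space: interpolation, completeness, Schur's test *)

Section Lp.
Context {R : realType} {d : measure_display} {T : measurableType d}.
Variable mu : probability T R.
Implicit Types (p : \bar R) (f g : T -> R).

Let muT : ((mu : {measure set T -> \bar R}) setT = 1)%E.
Proof. exact: probability_setT. Qed.

Local Notation "'N_ p [ f ]" := (Lnorm mu p (EFin \o f)).

Lemma hconjE (r : R) : 1 < r -> hoelder_conjugate r%:E = (r / (r - 1))%:E.
Proof.
move=> r1; rewrite /hoelder_conjugate /= gt_eqF ?lte_fin ?(lt_trans ltr01)//.
by rewrite -EFinB inver subr_eq0 gt_eqF.
Qed.

(* The three cases of exponent with their conjugates. *)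
Lemma conj_exponents p : (1 <= p)%E ->
  [\/ p = 1%E /\ hoelder_conjugate p = +oo%E,
      p = +oo%E /\ hoelder_conjugate p = 1%E |
      exists r s : R, [/\ 1 < r, 1 < s, p = r%:E, hoelder_conjugate p = s%:E &
        r^-1 + s^-1 = 1]].
Proof.
case: p => [r||//]; last by move=> _; apply: Or32.
rewrite lee_fin le_eqVlt => /predU1P[<-|r1].
  by apply: Or31; rewrite hoelder_conjugate1.
have r10 : 0 < r - 1 by rewrite subr_gt0.
apply: Or33; exists r, (r / (r - 1)); split => //; last 2 first.
- exact: hconjE.
- by field; rewrite !gt_eqF// (lt_trans _ r1).
by rewrite ltr_pdivlMr// mul1r gtrBl.
Qed.

Lemma LnormyP f (B : R) : measurable_fun setT f ->
  ('N_+oo[f] <= B%:E)%E <-> {ae mu, forall x, `|f x| <= B}.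
Proof.
move=> mf; rewrite unlock /Lnorm muT lte01.
have -> : (ess_sup mu (abse \o (EFin \o f)) <= B%:E)%E <->
    {ae mu, forall x, (`|(f x)%:E| <= B%:E)%E}.
  by split => [/ess_supP//|h]; apply/ess_supP.
by split; apply: filterS => x; rewrite /= lee_fin.
Qed.

Lemma Lnorm_fin (r : R) f : 'N_r%:E[f] = ((\int[mu]_x (`|f x| `^ r)%:E) `^ r^-1)%E.
Proof. by rewrite unlock. Qed.

Lemma Lnorm1E f : 'N_1[f] = (\int[mu]_x (`|f x|)%:E)%E.
Proof. exact: Lnorm1. Qed.

Lemma measurable_normpow f (r : R) : measurable_fun setT f ->
  measurable_fun setT (fun x => (`|f x| `^ r)%:E).
Proof.
move=> mf; apply/measurable_EFinP.
apply: (@measurableT_comp _ _ _ _ _ _ (@powR R ^~ r)); first exact: measurable_powR.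
exact: measurableT_comp.
Qed.

Lemma mem_LfunP p f : f \in Lfun mu p <-> measurable_fun setT f /\ ('N_p[f] < +oo)%E.
Proof.
split.
  by rewrite inE => /andP[]; rewrite !inE.
by move=> [mf fp]; rewrite inE; apply/andP; rewrite !inE.
Qed.

Lemma le_Lnorm p f g : (1 <= p)%E -> measurable_fun setT f -> measurable_fun setT g ->
  {ae mu, forall x, `|f x| <= `|g x|} -> ('N_p[f] <= 'N_p[g])%E.
Proof.
move=> p1 mf mg fg; case: p p1 => [r r1||//].
  have r0 : 0 < r by rewrite (lt_le_trans ltr01)// -lee_fin.
  rewrite !Lnorm_fin; apply: gt0_ler_poweR.
  - by rewrite invr_ge0 ltW.
  - by rewrite in_itv /= leey andbT integral_ge0// => x _; rewrite lee_fin powR_ge0.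
  - by rewrite in_itv /= leey andbT integral_ge0// => x _; rewrite lee_fin powR_ge0.
  apply: ae_ge0_le_integral => //; [exact: measurable_normpow|exact: measurable_normpow|].
  apply: filterS fg => x fgx _; rewrite lee_fin.
  by apply: ge0_ler_powR => //; rewrite ?nnegrE// ltW.
move=> _; rewrite unlock /Lnorm muT lte01.
by apply: le_ess_sup; apply: filterS fg => x; rewrite /= lee_fin.
Qed.

Lemma eq_Lnorm_ae p f g : (1 <= p)%E -> measurable_fun setT f -> measurable_fun setT g ->
  {ae mu, forall x, f x = g x} -> 'N_p[f] = 'N_p[g].
Proof.
move=> p1 mf mg fg; apply/eqP; rewrite eq_le; apply/andP; split; apply: le_Lnorm => //.
  by apply: filterS fg => x ->.
by apply: filterS fg => x ->.
Qed.

Lemma Lnorm_bounded p f (B : R) : (1 <= p)%E -> measurable_fun setT f -> 0 <= B ->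
  (forall x, `|f x| <= B) -> ('N_p[f] <= B%:E)%E.
Proof.
move=> p1 mf B0 fB; apply: (@le_trans _ _ 'N_p[cst B]).
  apply: le_Lnorm => //.
  by apply: aeW => x; rewrite (ger0_norm B0).
case: p p1 => [r r1||//].
  have r0 : r != 0 by rewrite gt_eqF// (lt_le_trans ltr01)// -lee_fin.
  rewrite Lnorm_fin (_ : (\int[mu]_x _ = (B `^ r)%:E)%E); last first.
    rewrite (_ : (fun _ => _) = cst (B `^ r)%:E).
      by rewrite (integral_cst _ measurableT (B `^ r)%:E) muT mule1.
    by apply/funext => x; rewrite /= (ger0_norm B0).
  by rewrite poweR_EFin -powRrM mulfV// powRr1.
move=> _; apply/LnormyP => //.
by apply: aeW => x; rewrite (ger0_norm B0).
Qed.

Lemma Lfun_bounded p f (B : R) : (1 <= p)%E -> measurable_fun setT f ->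
  (forall x, `|f x| <= B) -> f \in Lfun mu p.
Proof.
move=> p1 mf fB; apply/mem_LfunP; split => //.
apply: le_lt_trans (Lnorm_bounded (B := `|B|) p1 mf _ _) _; rewrite ?ltry//.
by move=> x; rewrite (le_trans (fB x))// ler_norm.
Qed.

Lemma hoelder_fin p f g : (1 <= p)%E -> f \in Lfun mu p ->
  g \in Lfun mu (hoelder_conjugate p) ->
  (\int[mu]_x (`|f x * g x|)%:E <= 'N_p[f] * 'N_(hoelder_conjugate p)[g])%E.
Proof.
move=> p1 /mem_LfunP[mf fp] /mem_LfunP[mg gp].
have inf1 (u v : T -> R) : measurable_fun setT u -> measurable_fun setT v ->
    ('N_+oo[v] < +oo)%E ->
    (\int[mu]_x (`|u x * v x|)%:E <= 'N_1[u] * 'N_+oo[v])%E.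
  move=> mu' mv vy.
  have vfin : 'N_+oo[v] \is a fin_num by rewrite ge0_fin_numE// Lnorm_ge0.
  have vB : {ae mu, forall x, `|v x| <= fine 'N_+oo[v]}.
    by apply/LnormyP => //; rewrite fineK.
  rewrite -[X in (_ <= _ * X)%E](fineK vfin) Lnorm1E muleC -ge0_integralZl_EFin//; last 2 first.
  - by apply/measurable_EFinP; exact: measurableT_comp.
  - by rewrite fine_ge0// Lnorm_ge0.
  apply: ae_ge0_le_integral => //.
  - by apply/measurable_EFinP; apply: measurableT_comp => //; exact: measurable_funM.
  - by move=> x _; rewrite -EFinM lee_fin mulr_ge0// fine_ge0// Lnorm_ge0.
  - by apply/measurable_EFinP; apply: measurable_funM => //; exact: measurableT_comp.
  by apply: filterS vB => x vx _; rewrite -EFinM lee_fin normrM mulrC ler_wpM2r.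
case: (conj_exponents p1) => [[pE qE]|[pE qE]|[r [s [r1 s1 pE qE rs]]]].
- by rewrite qE in gp *; rewrite pE; exact: inf1.
- rewrite pE in fp *; rewrite hoelder_conjugatey muleC.
  under eq_integral do rewrite mulrC.
  exact: inf1.
rewrite qE pE; have := @hoelder _ _ _ mu f g r s mf mg.
rewrite Lnorm1E; apply => //; exact: lt_trans ltr01 _.
Qed.

Lemma Lfun_Lfun1 p f : (1 <= p)%E -> f \in Lfun mu p -> f \in Lfun mu 1.
Proof.
move=> p1; apply: Lfun_subset => //.
by rewrite muT.
Qed.

Lemma le_Lnorm1 p f : (1 <= p)%E -> f \in Lfun mu p -> ('N_1[f] <= 'N_p[f])%E.
Proof.
move=> p1 fp; have q1 := hoelder_conj_ge1 p1.
have c1 : (cst 1 : T -> R) \in Lfun mu (hoelder_conjugate p).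
  by apply: (Lfun_bounded (B := 1)) => // x; rewrite normr1.
have := hoelder_fin p1 fp c1; under eq_integral do rewrite mulr1.
rewrite -Lnorm1E => /le_trans; apply.
rewrite -[leRHS]mule1; apply: lee_wpmul2l; first exact: Lnorm_ge0.
by apply: Lnorm_bounded => // x; rewrite normr1.
Qed.

(* interpolation between [L^1] and [L^oo] *)
Lemma Lnorm_interpolation p f (Z W : R) : (1 <= p)%E -> measurable_fun setT f ->
  0 <= Z -> 0 < W -> (forall x, `|f x| <= Z * W) -> ('N_1[f] <= Z%:E)%E ->
  ('N_(hoelder_conjugate p)[f] <= (Z * W `^ (fine p^-1%E))%:E)%E.
Proof.
move=> p1 mf Z0 W0 fZW f1; have ZW : 0 <= Z * W by rewrite mulr_ge0// ltW.
case: (conj_exponents p1) => [[pE qE]|[pE qE]|[r [s [r1 s1 pE qE rs]]]].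
- rewrite qE pE inve1 /= powRr1 ?(ltW W0)//.
  by apply/LnormyP => //; exact: aeW.
- by rewrite qE pE invey /= powRr0 mulr1.
have r0 : 0 < r by exact: lt_trans ltr01 _.
have s0 : 0 < s by exact: lt_trans ltr01 _.
rewrite qE pE inver gt_eqF//= Lnorm_fin.
have h : (\int[mu]_x (`|f x| `^ s)%:E <= ((Z * W) `^ (s - 1) * Z)%:E)%E.
  apply: (@le_trans _ _ (\int[mu]_x (((Z * W) `^ (s - 1))%:E * (`|f x|)%:E))%E).
    apply: ge0_le_integral => //.
    - exact: measurable_normpow.
    - by apply/measurable_EFinP; apply: measurable_funM => //; exact: measurableT_comp.
    move=> x _; rewrite -EFinM lee_fin -mulr_powRB1// mulrC ler_wpM2r//.
    by apply: ge0_ler_powR; rewrite ?nnegrE ?subr_ge0// ltW.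
  rewrite ge0_integralZl_EFin//; last 2 first.
  - by apply/measurable_EFinP; exact: measurableT_comp.
  - by rewrite powR_ge0.
  by rewrite EFinM lee_wpmul2l// ?lee_fin ?powR_ge0// -Lnorm1E.
apply: (@le_trans _ _ (((Z * W) `^ (s - 1) * Z)%:E `^ s^-1)%E).
  apply: gt0_ler_poweR h; first by rewrite invr_ge0 ltW.
    by rewrite in_itv /= leey andbT integral_ge0// => x _; rewrite lee_fin powR_ge0.
  by rewrite in_itv /= leey andbT lee_fin mulr_ge0 ?powR_ge0.
rewrite poweR_EFin lee_fin.
have [->|Zn0] := eqVneq Z 0; first by rewrite mulr0 mul0r powR0// invr_neq0// gt_eqF.
have Zp : 0 < Z by rewrite lt0r Zn0.
have -> : (Z * W) `^ (s - 1) * Z = Z `^ s * W `^ (s - 1).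
  by rewrite (powRM _ Z0 (ltW W0)) mulrAC (mulrC _ Z) mulr_powRB1.
rewrite powRM ?powR_ge0// -!powRrM mulfV ?gt_eqF// powRr1//.
have -> : (s - 1) / s = r^-1.
  by rewrite mulrBl mulfV ?gt_eqF// mul1r -rs; ring.
exact: lexx.
Qed.

End Lp.

Section Lp2.
Context {R : realType} {d : measure_display} {T : measurableType d}.
Variable mu : probability T R.
Implicit Types (p : \bar R) (f g : T -> R).

Local Notation "'N_ p [ f ]" := (Lnorm mu p (EFin \o f)).

Lemma powR_cvg (r : R) (a : nat -> R) (l : R) : 0 < r -> (forall n, 0 <= a n) ->
  a n @[n --> \oo] --> l -> a n `^ r @[n --> \oo] --> l `^ r.
Proof.
move=> r0 a0 al.
have [l0|l0|l0] := ltgtP l 0.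
- have : 0 <= l by rewrite -(cvg_lim (@Rhausdorff R) al); apply: limr_ge; [apply/cvg_ex; exists l|near=> n].
  by rewrite leNgt l0.
- have c : {for l, continuous (fun x : R => x `^ r)}.
    apply: differentiable_continuous; apply/derivable1_diffP.
    by apply: derivable_powR; rewrite in_itv /= l0.
  exact: (continuous_cvg _ c al).
rewrite l0 powR0 ?gt_eqF// in al *.
apply/cvgrPdist_lt => e e0.
have er : 0 < e `^ r^-1 by rewrite powR_gt0.
move/cvgrPdist_lt : al => /(_ _ er); apply: filterS => n.
rewrite !sub0r !normrN !ger0_norm ?powR_ge0// => h.
rewrite -[ltRHS](powRr1 (ltW e0)) -(mulVf (lt0r_neq0 r0)) powRrM.
by rewrite gt0_ltr_powR// nnegrE ?powR_ge0.
Unshelve. all: end_near. Qed.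

Lemma measurable_limn_einf (v : nat -> T -> \bar R) :
  (forall n, measurable_fun setT (v n)) ->
  measurable_fun setT (fun x => limn_einf (v ^~ x)).
Proof.
move=> mv; have -> : (fun x => limn_einf (v ^~ x)) =
    (fun x => - limn_esup (fun n => - v n x))%E.
  by apply/funext => x; have := limn_esupN (v ^~ x); rewrite /comp => ->; rewrite oppeK.
apply: (@measurableT_comp _ _ _ _ _ _ (@oppe R)) => //.
apply: (@measurable_fun_limn_esup _ _ _ _ (fun n x => - v n x)%E) => n.
exact: measurableT_comp.
Qed.

(** Lower semicontinuity of the norm: Fatou's lemma for |u_n|^r at finite exponents, a pointwise
    limit outside a null set for the essential supremum. *)
Lemma Lnorm_cvg_le p (u : nat -> T -> R) (h : T -> R) (B : R) n0 : (1 <= p)%E ->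
  (forall n, measurable_fun setT (u n)) -> measurable_fun setT h ->
  {ae mu, forall x, u n x @[n --> \oo] --> h x} ->
  (forall n, (n0 <= n)%N -> ('N_p[u n] <= B%:E)%E) -> ('N_p[h] <= B%:E)%E.
Proof.
move=> p1 mu_ mh uh uB.
have B0 : 0 <= B by rewrite -lee_fin; apply: le_trans (uB n0 (leqnn _)); exact: Lnorm_ge0.
case: p p1 uB => [r r1 uB|_ uB|//]; last first.
  apply/LnormyP => //.
  have all : {ae mu, forall x, forall n, (n0 <= n)%N -> `|u n x| <= B}.
    apply: ae_foralln => n; have [n0n|] := boolP (n0 <= n)%N.
      by have /LnormyP := uB n n0n; move=> /(_ (mu_ n)); apply: filterS.
    by move=> _; apply: aeW.
  move: uh all; apply: filterS2 => x ux ub.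
  have cn : `|u n x| @[n --> \oo] --> `|h x| by exact: cvg_norm.
  rewrite -(cvg_lim (@Rhausdorff R) cn); apply: limr_le.
    by apply/cvg_ex; eexists; exact: cn.
  by near=> n; apply: ub; near: n; exact: nbhs_infty_ge.
have r0 : 0 < r by rewrite (lt_le_trans ltr01)// -lee_fin.
rewrite Lnorm_fin.
suff H : (\int[mu]_x (`|h x| `^ r)%:E <= (B `^ r)%:E)%E.
  apply: (@le_trans _ _ ((B `^ r)%:E `^ r^-1)%E).
    apply: gt0_ler_poweR H; first by rewrite invr_ge0 ltW.
      by rewrite in_itv /= leey andbT integral_ge0// => x _; rewrite lee_fin powR_ge0.
    by rewrite in_itv /= leey andbT lee_fin powR_ge0.
  by rewrite poweR_EFin -powRrM mulfV ?gt_eqF// powRr1.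
pose v n x := (`|u (n + n0)%N x| `^ r)%:E.
have mv n : measurable_fun setT (v n) by exact: measurable_normpow.
have v0 n x : (0 <= v n x)%E by rewrite lee_fin powR_ge0.
have -> : (\int[mu]_x (`|h x| `^ r)%:E = \int[mu]_x limn_einf (v ^~ x))%E.
  apply: ge0_ae_eq_integral => //.
  - exact: measurable_normpow.
  - exact: measurable_limn_einf.
  - move=> x _; rewrite limn_einf_lim; apply: lime_ge; first exact: is_cvg_einfs.
    by apply: nearW => n; apply: le_ereal_inf_tmp => _ [k _ <-].
  move: uh; apply: filterS => x ux _.
  suff /cvg_limn_einf_sup[-> _] : v n x @[n --> \oo] --> (`|h x| `^ r)%:E by [].
  apply: cvg_EFin; first by near=> n.
  apply: (@powR_cvg r (fun n => `|u (n + n0)%N x|)) => //.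
  by apply: cvg_norm; have := ux; rewrite -(cvg_shiftn n0).
apply: le_trans (fatou mu measurableT mv _) _ => //.
rewrite limn_einf_lim; apply: lime_le; first exact: is_cvg_einfs.
apply: nearW => n; apply: le_trans (_ : (\int[mu]_x v n x <= _)%E).
  by apply: ereal_inf_lbound; exists n => /=.
have := uB _ (leq_addl n n0); rewrite Lnorm_fin => H.
have I0 : (0 <= \int[mu]_x v n x)%E by exact: integral_ge0.
have -> : (\int[mu]_x v n x = (\int[mu]_x v n x) `^ (r^-1 * r))%E.
  by rewrite mulVf ?gt_eqF// poweRe1.
rewrite poweRrM -poweR_EFin; apply: gt0_ler_poweR H; first exact: ltW.
  by rewrite in_itv /= leey andbT poweR_ge0.
by rewrite in_itv /= leey andbT lee_fin.
Unshelve. all: end_near. Qed.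

End Lp2.

Section Lp3.
Context {R : realType} {d : measure_display} {T : measurableType d}.
Variable mu : probability T R.
Implicit Types (p : \bar R) (f g : T -> R).

Local Notation "'N_ p [ f ]" := (Lnorm mu p (EFin \o f)).

Lemma Lnorm_add p f g : (1 <= p)%E -> measurable_fun setT f -> measurable_fun setT g ->
  ('N_p[(fun x => f x + g x)%R] <= 'N_p[f] + 'N_p[g])%E.
Proof. by move=> p1 mf mg; exact: eminkowski. Qed.

Lemma Lnorm_scale p f (a : R) : (1 <= p)%E -> measurable_fun setT f ->
  ('N_p[(fun x => a * f x)%R] = `|a|%:E * 'N_p[f])%E.
Proof.
move=> p1 mf; have [->|a0] := eqVneq a 0.
  rewrite normr0 mul0e; apply/eqP; rewrite eq_le Lnorm_ge0 andbT.
  by apply: Lnorm_bounded; [done|exact: measurable_funM|done|move=> x; rewrite mul0r normr0].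
have a_gt0 : 0 < `|a| by rewrite normr_gt0.
case: p p1 => [r r1||//].
  have r0 : 0 < r by rewrite (lt_le_trans ltr01)// -lee_fin.
  rewrite !Lnorm_fin; under eq_integral do rewrite normrM powRM// EFinM.
  rewrite ge0_integralZl_EFin ?powR_ge0//; last first.
    exact: measurable_normpow.
  rewrite poweRM ?lee_fin ?powR_ge0//; last first.
    by apply: integral_ge0 => x _; rewrite lee_fin powR_ge0.
  by rewrite poweR_EFin -powRrM mulfV ?gt_eqF// powRr1.
move=> _; have le (c : R) g : measurable_fun setT g ->
    ('N_+oo[(fun x => c * g x)%R] <= `|c|%:E * 'N_+oo[g])%E.
  move=> mg; have [->|c0] := eqVneq c 0.
    by rewrite normr0 mul0e; apply: Lnorm_bounded; [exact: leey|exact: measurable_funM|done|move=> x; rewrite mul0r normr0].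
  have [->|gy] := eqVneq 'N_+oo[g] +oo%E.
    by rewrite gt0_muley ?leey// lte_fin normr_gt0.
  have gfin : 'N_+oo[g] \is a fin_num by rewrite ge0_fin_numE ?Lnorm_ge0// ltey.
  rewrite -(fineK gfin) -EFinM; apply/LnormyP; first exact: measurable_funM.
  have : ('N_+oo[g] <= (fine 'N_+oo[g])%:E)%E by rewrite fineK.
  move/LnormyP => /(_ mg); apply: filterS => x gx.
  by rewrite normrM ler_wpM2l.
apply/eqP; rewrite eq_le le//=.
have := le a^-1 (fun x => a * f x) (measurable_funM (measurable_cst a) mf).
rewrite (_ : (EFin \o (fun x => a^-1 * (a * f x))) = EFin \o f); last first.
  by apply/funext => x; rewrite /= mulKf.
move=> h; apply: le_trans (lee_wpmul2l _ h) _; first by rewrite lee_fin.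
by rewrite muleA -EFinM normfV mulfV ?gt_eqF// mul1e.
Qed.

Lemma Lfun_add p f g : (1 <= p)%E -> f \in Lfun mu p -> g \in Lfun mu p ->
  (fun x => f x + g x) \in Lfun mu p.
Proof.
move=> p1 /mem_LfunP[mf fp] /mem_LfunP[mg gp]; apply/mem_LfunP; split; first exact: measurable_funD.
by apply: le_lt_trans (Lnorm_add p1 mf mg) _; rewrite lte_add_pinfty.
Qed.

Lemma Lfun_scaler p f (a : R) : (1 <= p)%E -> f \in Lfun mu p ->
  (fun x => a * f x) \in Lfun mu p.
Proof.
move=> p1 /mem_LfunP[mf fp]; apply/mem_LfunP; split; first exact: measurable_funM.
by rewrite Lnorm_scale// lte_mul_pinfty ?lee_fin.
Qed.

Lemma Lfun_sub p f g : (1 <= p)%E -> f \in Lfun mu p -> g \in Lfun mu p ->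
  (fun x => f x - g x) \in Lfun mu p.
Proof.
move=> p1 fp gp; have := Lfun_add p1 fp (Lfun_scaler (-1) p1 gp).
by under eq_fun do rewrite mulN1r.
Qed.

Lemma Lfun_sum p (I : Type) (s : seq I) (P : pred I) (F : I -> T -> R) : (1 <= p)%E ->
  (forall i, F i \in Lfun mu p) -> (fun x => \sum_(i <- s | P i) F i x) \in Lfun mu p.
Proof.
move=> p1 Fp; elim: s => [|i s ih].
  under eq_fun do rewrite big_nil.
  by apply: (Lfun_bounded mu (B := 0)) => // x; rewrite normr0.
under eq_fun do rewrite big_cons; case: (P i) => //.
exact: Lfun_add.
Qed.

Lemma Lnorm_sum p (I : Type) (s : seq I) (P : pred I) (F : I -> T -> R) : (1 <= p)%E ->
  (forall i, measurable_fun setT (F i)) ->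
  ('N_p[(fun x => \sum_(i <- s | P i) F i x)%R] <= \sum_(i <- s | P i) 'N_p[F i])%E.
Proof.
move=> p1 mF; elim: s => [|i s ih].
  rewrite big_nil (_ : EFin \o _ = EFin \o cst 0).
    by apply: Lnorm_bounded => // x; rewrite normr0.
  by apply/funext => x; rewrite /= big_nil.
rewrite big_cons (_ : EFin \o _ = EFin \o
    (fun x => if P i then F i x + \sum_(i <- s | P i) F i x else \sum_(i <- s | P i) F i x)).
  case: (P i) => //; apply: le_trans (Lnorm_add p1 _ _) _ => //; last exact: leeD2l.
  elim: s {ih} => [|j s ih]; first by under eq_fun do rewrite big_nil; exact: measurable_cst.
  under eq_fun do rewrite big_cons; case: (P j) => //; exact: measurable_funD.
by apply/funext => x; rewrite /= big_cons.
Qed.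

Lemma Lnorm_opp p f : 'N_p[(fun x => - f x)%R] = 'N_p[f].
Proof. by rewrite -[in RHS](oppe_Lnorm). Qed.

Lemma Lnorm_distC p f g : 'N_p[(fun x => f x - g x)%R] = 'N_p[(fun x => g x - f x)%R].
Proof. by rewrite -Lnorm_opp; congr Lnorm; apply/funext => x /=; rewrite opprB. Qed.

(** Geometric increments are summable in L^1, hence give convergence almost everywhere. The error
    estimate is stated for any later index and any constant valid from there, so that a single limit
    can be reused with sharper information. *)
Lemma Lp_complete p (u : nat -> T -> R) (K t : R) : (1 <= p)%E -> 0 <= t < 1 ->
  (forall n, u n \in Lfun mu p) ->
  (forall n, ('N_p[(fun x => u n.+1 x - u n x)%R] <= (K * t ^+ n)%:E)%E) ->
  exists2 h, h \in Lfun mu p &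
    forall n (L : R),
      (forall m, ('N_p[(fun x => u (m + n).+1 x - u (m + n)%N x)%R] <= (L * t ^+ m)%:E)%E) ->
      ('N_p[(fun x => (h x - u n x)%R)%R] <= (L / (1 - t))%:E)%E.
Proof.
move=> p1 /andP[t0 t1] up uK.
have mu_ n : measurable_fun setT (u n) by have /mem_LfunP[] := up n.
have K0 : 0 <= K.
  by have := uK 0%N; rewrite mulr1 -lee_fin; apply: le_trans; exact: Lnorm_ge0.
pose D n x : \bar R := (`|u n.+1 x - u n x|)%:E.
have mD n : measurable_fun setT (D n).
  by apply/measurable_EFinP; apply: measurableT_comp => //; exact: measurable_funB.
have D0 n x : (0 <= D n x)%E by rewrite lee_fin.
have mS : measurable_fun setT (fun x => \sum_(n <oo) D n x)%E.
  exact: ge0_emeasurable_sum.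
have Sfin : (\int[mu]_x \sum_(n <oo) D n x < +oo)%E.
  rewrite integral_nneseries//; apply: (@le_lt_trans _ _ (K / (1 - t))%:E); last exact: ltry.
  apply: lime_le; first by apply: is_cvg_nneseries => n _ _; exact: integral_ge0.
  apply: nearW => n.
  apply: (@le_trans _ _ (\sum_(0 <= i < n) (K * t ^+ i)%:E)%E).
    apply: lee_sum => i _; rewrite /D -(Lnorm1E mu (fun x => u i.+1 x - u i x)).
    apply: le_trans (le_Lnorm1 p1 _) (uK i).
    exact: Lfun_sub.
  rewrite sumEFin lee_fin -mulr_sumr ler_wpM2l// big_mkord geometric_le//.
  by rewrite t0 t1.
have cvgu : {ae mu, forall x, cvgn (u ^~ x)}.
  have iS : mu.-integrable setT (fun x => \sum_(n <oo) D n x)%E.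
    apply/integrableP; split => //.
    by under eq_integral do rewrite gee0_abs ?nneseries_ge0//.
  have := integrable_ae measurableT iS; apply: filterS => x /(_ Logic.I) Sx.
  have -> : u ^~ x = fun n => u 0%N x + series (telescope (u ^~ x)) n.
    by apply/funext => n; rewrite -eq_sum_telescope.
  apply: is_cvgD; first exact: is_cvg_cst.
  apply: normed_cvg; apply: nondecreasing_is_cvgn.
    by apply: nondecreasing_series => n _ _; exact: normr_ge0.
  exists (fine (\sum_(n <oo) D n x)) => _ [n _ <-].
  rewrite -lee_fin fineK// /series/= -sumEFin.
  exact: (nneseries_lim_ge (P := xpredT) (m := 0%N) n (fun k _ _ => D0 k x)).
(* The upper limit is measurable everywhere and equals the limit wherever the limit exists. *)
pose h x := fine (limn_esup (fun n => (u n x)%:E)).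
have mh : measurable_fun setT h.
  apply: (@measurableT_comp _ _ _ _ _ _ (@fine R)) => //.
  apply: (@measurable_fun_limn_esup _ _ _ _ (fun n x => (u n x)%:E)) => n.
  exact/measurable_EFinP.
have uh : {ae mu, forall x, u n x @[n --> \oo] --> h x}.
  move: cvgu; apply: filterS => x /cvg_ex[l ul].
  suff -> : h x = l by [].
  have /cvg_limn_einf_sup[_] : (u n x)%:E @[n --> \oo] --> l%:E.
    by apply: cvg_EFin => //; exact: nearW.
  by rewrite /h => ->.
have hu n (L : R) :
    (forall m, ('N_p[(fun x => u (m + n).+1 x - u (m + n)%N x)%R] <= (L * t ^+ m)%:E)%E) ->
    ('N_p[(fun x => (h x - u n x)%R)%R] <= (L / (1 - t))%:E)%E.
  move=> uL; have L0 : 0 <= L.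
    by have := uL 0%N; rewrite mulr1 -lee_fin; apply: le_trans; exact: Lnorm_ge0.
  apply: (@Lnorm_cvg_le _ _ _ mu p (fun m x => u m x - u n x) _ _ n) => //.
  - by move=> m; exact: measurable_funB.
  - exact: measurable_funB.
  - by move: uh; apply: filterS => x ux; apply: cvgB => //; exact: cvg_cst.
  move=> m nm; rewrite (_ : EFin \o _ =
      EFin \o (fun x => \sum_(i < m - n) (u (i + n).+1 x - u (i + n)%N x))); last first.
    apply/funext => x /=; rewrite -(telescope_sumr (u ^~ x) nm) -{1}(add0n n) big_addn big_mkord.
    by [].
  apply: le_trans (Lnorm_sum _ _ p1 _) _; first by move=> i; exact: measurable_funB.
  apply: (@le_trans _ _ (\sum_(i < m - n) (L * t ^+ i)%:E)%E).
    by apply: lee_sum => i _; exact: uL.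
  by rewrite sumEFin lee_fin -mulr_sumr ler_wpM2l// geometric_le// t0 t1.
exists h => //; apply/mem_LfunP; split => //.
have -> : h = fun x => (h x - u 0%N x) + u 0%N x by apply/funext => x; rewrite subrK.
apply: le_lt_trans (Lnorm_add p1 _ _) _ => //; first exact: measurable_funB.
rewrite lte_add_pinfty//; last by have /mem_LfunP[] := up 0%N.
apply: le_lt_trans (hu 0%N K _) _; last exact: ltry.
by move=> m; rewrite addn0.
Qed.

End Lp3.

Section Schur.
Context {R : realType} {d : measure_display} {T : measurableType d}.
Variable mu : probability T R.
Implicit Types (p : \bar R) (f g : T -> R).

Local Notation "'N_ p [ f ]" := (Lnorm mu p (EFin \o f)).

(** Hoelder's inequality for the factorisation |k f| = |k|^(1/s) (|k|^(1/r) |f|), with s conjugate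
    to r. *)
Lemma jensen_kernel (k f : T -> R) (A r : R) : 1 <= r -> 0 <= A ->
  measurable_fun setT k -> measurable_fun setT f ->
  (\int[mu]_y (`|k y|)%:E <= A%:E)%E ->
  ((\int[mu]_y (`|k y * f y|)%:E) `^ r <=
     (A `^ (r - 1))%:E * \int[mu]_y (`|k y| * `|f y| `^ r)%:E)%E.
Proof.
move=> r1 A0 mk mf kA.
have mfr : measurable_fun setT (fun y => `|f y| `^ r).
  exact/measurable_EFinP/measurable_normpow.
have mnk : measurable_fun setT (fun y => `|k y|) by exact: measurableT_comp.
have mkf : measurable_fun setT (fun y => (`|k y * f y|)%:E).
  by apply/measurable_EFinP; apply: measurableT_comp => //; exact: measurable_funM.
move: r1; rewrite le_eqVlt => /predU1P[rE|r1].
  rewrite -rE in mfr *; rewrite subrr powRr0 mul1e poweRe1; last exact: integral_ge0.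
  apply: ge0_le_integral => //.
    by apply/measurable_EFinP; exact: measurable_funM mnk mfr.
  by move=> y _; rewrite lee_fin powRr1// normrM.
have r0 : 0 < r by exact: lt_trans r1.
pose s := r / (r - 1).
have r10 : 0 < r - 1 by rewrite subr_gt0.
have s0 : 0 < s by rewrite divr_gt0.
have rs : s^-1 + r^-1 = 1 by rewrite /s; field; rewrite !gt_eqF.
have mks : measurable_fun setT (fun y => `|k y| `^ s^-1).
  exact/measurable_EFinP/measurable_normpow.
have mkr : measurable_fun setT (fun y => `|k y| `^ r^-1).
  exact/measurable_EFinP/measurable_normpow.
have mnf : measurable_fun setT (fun y => `|f y|) by exact: measurableT_comp.
have := hoelder mu mks (measurable_funM mkr mnf) s0 r0 rs.
rewrite (_ : (_ \* _)%R = (fun y => `|k y * f y|)); last first.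
  apply/funext => y; rewrite /= mulrA -powRD ?rs ?powRr1 ?normrM//.
  by rewrite oner_eq0.
rewrite Lnorm1E; under eq_integral do rewrite normr_id.
rewrite !Lnorm_fin => h.
have E1 : (\int[mu]_x ((`|(`|k x| `^ s^-1)| `^ s)%:E) = \int[mu]_x (`|k x|)%:E)%E.
  apply: eq_integral => x _; rewrite (ger0_norm (powR_ge0 _ _)) -powRrM.
  by rewrite mulVf ?gt_eqF// powRr1.
have E2 : (\int[mu]_x ((`|(`|k x| `^ r^-1 * `|f x|)%R| `^ r)%:E) =
    \int[mu]_x (`|k x| * `|f x| `^ r)%:E)%E.
  apply: eq_integral => x _; rewrite ger0_norm ?mulr_ge0 ?powR_ge0//.
  rewrite powRM ?powR_ge0//.
  by rewrite -powRrM mulVf ?gt_eqF// powRr1.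
rewrite /= E1 E2 in h.
set J := (\int[mu]_x (`|k x| * `|f x| `^ r)%:E)%E in h *.
have J0 : (0 <= J)%E.
  by apply: integral_ge0 => y _; rewrite lee_fin mulr_ge0 ?powR_ge0.
have I0 : (0 <= \int[mu]_x (`|k x|)%:E)%E by exact: integral_ge0.
have K0 : (0 <= \int[mu]_y (`|k y * f y|)%:E)%E by exact: integral_ge0.
apply: le_trans (gt0_ler_poweR (ltW r0) _ _ h) _.
- by rewrite in_itv /= leey andbT.
- by rewrite in_itv /= leey andbT mule_ge0// poweR_ge0.
rewrite poweRM ?poweR_ge0// -!poweRrM mulVf ?gt_eqF// poweRe1//.
rewrite lee_wpmul2r//.
have -> : s^-1 * r = r - 1 by rewrite /s; field; rewrite !gt_eqF.
rewrite -poweR_EFin; apply: gt0_ler_poweR kA => //; first exact: ltW.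
  by rewrite in_itv /= leey andbT.
by rewrite in_itv /= leey andbT lee_fin.
Qed.

(* Schur's test *)
Lemma schur p (k : T -> T -> R) (f F : T -> R) (A : R) : (1 <= p)%E -> 0 <= A ->
  measurable_fun setT (fun z : T * T => k z.1 z.2) ->
  (forall x, (\int[mu]_y (`|k x y|)%:E <= A%:E)%E) ->
  (forall y, (\int[mu]_x (`|k x y|)%:E <= A%:E)%E) ->
  f \in Lfun mu p -> measurable_fun setT F ->
  (forall x, ((`|F x|)%:E <= \int[mu]_y (`|k x y * f y|)%:E)%E) ->
  ('N_p[F] <= A%:E * 'N_p[f])%E.
Proof.
move=> p1 A0 mk kx ky /mem_LfunP[mf fp] mF Fk.
have mkx x : measurable_fun setT (k x).
  exact: (measurable_fun_pair2 (f := fun z : T * T => k z.1 z.2) x).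
have mky y : measurable_fun setT (k ^~ y).
  exact: (measurable_fun_pair1 (f := fun z : T * T => k z.1 z.2) y).
have ffin : 'N_p[f] \is a fin_num by rewrite ge0_fin_numE// Lnorm_ge0.
case: p p1 fp ffin => [r r1 fp ffin|_ fp ffin|//]; last first.
  rewrite -(fineK ffin) -EFinM; apply/LnormyP => //; apply: aeW => x.
  have f0 : 0 <= fine 'N_+oo[f] by rewrite fine_ge0// Lnorm_ge0.
  have : ('N_+oo[f] <= (fine 'N_+oo[f])%:E)%E by rewrite fineK.
  move/LnormyP => /(_ mf) fae; rewrite -lee_fin.
  apply: le_trans (Fk x) _.
  apply: (@le_trans _ _ (\int[mu]_y ((fine 'N_+oo[f])%:E * (`|k x y|)%:E))%E).
    apply: ae_ge0_le_integral => //.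
    - by apply/measurable_EFinP; apply: measurableT_comp => //; exact: measurable_funM.
    - by move=> y _; rewrite -EFinM lee_fin mulr_ge0.
    - by apply/measurable_EFinP; apply: measurable_funM => //; exact: measurableT_comp.
    by apply: filterS fae => y fy _; rewrite -EFinM lee_fin normrM mulrC ler_wpM2r.
  rewrite ge0_integralZl_EFin//; last first.
    by apply/measurable_EFinP; exact: measurableT_comp.
  by rewrite mulrC EFinM lee_wpmul2l.
rewrite lee_fin in r1; have r0 : 0 < r by exact: lt_le_trans r1.
have mfr : measurable_fun setT (fun y => `|f y| `^ r).
  exact/measurable_EFinP/measurable_normpow.
pose H z : \bar R := (`|k z.1 z.2| * `|f z.2| `^ r)%:E.
have mH : measurable_fun setT H.
  apply/measurable_EFinP; apply: measurable_funM; first exact: measurableT_comp.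
  exact: (measurableT_comp mfr (@measurable_snd _ _ T T)).
have H0 z : (0 <= H z)%E by rewrite lee_fin mulr_ge0 ?powR_ge0.
rewrite !Lnorm_fin.
have I0 (u : T -> R) : (0 <= \int[mu]_x (`|u x| `^ r)%:E)%E.
  by apply: integral_ge0 => x _; rewrite lee_fin powR_ge0.
have A1 : A = (A `^ r) `^ r^-1 by rewrite -powRrM mulfV ?gt_eqF// powRr1.
rewrite [X in (X%:E * _)%E]A1 -poweR_EFin -poweRM ?lee_fin ?powR_ge0//.
apply: gt0_ler_poweR; first by rewrite invr_ge0 ltW.
- by rewrite in_itv /= leey andbT.
- by rewrite in_itv /= leey andbT mule_ge0// lee_fin powR_ge0.
apply: (@le_trans _ _ (\int[mu]_x ((A `^ (r - 1))%:E * \int[mu]_y H (x, y)))%E).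
  apply: ge0_le_integral => //.
  - exact: measurable_normpow.
  - apply: emeasurable_funM => //.
    exact: (measurable_fun_fubini_tonelli_F (m2 := mu) _ mH H0).
  move=> x _; apply: le_trans (jensen_kernel r1 A0 (mkx x) mf (kx x)).
  rewrite -poweR_EFin; apply: gt0_ler_poweR (Fk x); first exact: ltW.
    by rewrite in_itv /= leey andbT lee_fin.
  by rewrite in_itv /= leey andbT integral_ge0.
rewrite ge0_integralZl_EFin ?powR_ge0//; last 2 first.
- by move=> x _; exact: integral_ge0.
- exact: (measurable_fun_fubini_tonelli_F (m2 := mu) _ mH H0).
rewrite (fubini_tonelli (m1 := mu) (m2 := mu) _ mH H0).
have -> : A `^ r = A `^ (r - 1) * A.
  have [->|A_neq0] := eqVneq A 0; first by rewrite mulr0 powR0// gt_eqF.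
  by rewrite mulrC mulr_powRB1// lt0r A_neq0.
rewrite EFinM -muleA lee_wpmul2l ?lee_fin ?powR_ge0//.
rewrite -ge0_integralZl_EFin//; last exact: measurable_normpow.
apply: ge0_le_integral => //.
- by move=> y _; exact: integral_ge0.
- exact: (measurable_fun_fubini_tonelli_G (m1 := mu) _ mH H0).
- by apply: emeasurable_funM => //; exact: measurable_normpow.
move=> y _; rewrite /H /=; under eq_integral do rewrite mulrC EFinM.
rewrite ge0_integralZl_EFin ?powR_ge0//; last first.
  by apply/measurable_EFinP; exact: measurableT_comp.
by rewrite muleC lee_wpmul2r// lee_fin powR_ge0.
Qed.

End Schur.

(** * Integration against signed measures *)

Section charge_integral_theory.
Context {R : realType} {d : measure_display} {T : measurableType d}.
Variable nu : {charge set T -> \bar R}.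
Implicit Types f g : T -> R.

Definition bounded_meas f : Prop :=
  measurable_fun setT f /\ exists B : R, forall x, `|f x| <= B.

Local Notation np := (jordan_pos (hahnP nu)).
Local Notation nn := (jordan_neg (hahnP nu)).

Lemma bounded_meas_integrable (m : {finite_measure set T -> \bar R}) f :
  bounded_meas f -> m.-integrable setT (EFin \o f).
Proof.
move=> [mf [B fB]]; apply: measurable_bounded_integrable => //.
  by rewrite -ge0_fin_numE//; exact: fin_num_measure.
exists B; split; first exact: num_real.
by move=> M BM x _; apply: le_trans (fB x) (ltW BM).
Qed.

Lemma bounded_measD f g : bounded_meas f -> bounded_meas g ->
  bounded_meas (fun x => f x + g x).
Proof.
move=> [mf [A fA]] [mg [B gB]]; split; first exact: measurable_funD.
by exists (A + B) => x; apply: le_trans (ler_normD _ _) _; exact: lerD.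
Qed.

Lemma bounded_measZ (a : R) f : bounded_meas f -> bounded_meas (fun x => a * f x).
Proof.
move=> [mf [A fA]]; split; first exact: measurable_funM.
by exists (`|a| * A) => x; rewrite normrM ler_wpM2l.
Qed.

Lemma bounded_meas_sum (I : Type) (s : seq I) (P : pred I) (F : I -> T -> R) :
  (forall i, bounded_meas (F i)) -> bounded_meas (fun x => \sum_(i <- s | P i) F i x).
Proof.
move=> bF; elim: s => [|i s ih].
  under eq_fun do rewrite big_nil; split; first exact: measurable_cst.
  by exists 0 => x; rewrite normr0.
by under eq_fun do rewrite big_cons; case: (P i) => //; exact: bounded_measD.
Qed.

(** The value 1 at the zeros of f keeps the modulus equal to 1 everywhere. *)
Definition sign f : T -> R := fun z => if 0 <= f z then 1 else -1.

Lemma bounded_meas_sign f : measurable_fun setT f -> bounded_meas (sign f).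
Proof.
move=> mf; split; last by exists 1 => z; rewrite /sign; case: ifP; rewrite ?normrN normr1.
apply: measurable_fun_ifT; [|exact: measurable_cst|exact: measurable_cst].
by apply: measurable_fun_ler => //; exact: measurable_cst.
Qed.

Lemma mul_sign f z : f z * sign f z = `|f z|.
Proof. by rewrite /sign; case: ger0P; rewrite ?mulr1 ?mulrN1. Qed.

Lemma norm_sign f z : `|sign f z| = 1.
Proof. by rewrite /sign; case: ifP; rewrite ?normrN normr1. Qed.

Lemma variationE A : variation_measure nu A = (np A + nn A)%E.
Proof. by []. Qed.

Lemma ge0_integral_variation (f : T -> \bar R) : measurable_fun setT f ->
  (forall x, 0 <= f x)%E ->
  (\int[variation_measure nu]_x f x = \int[np]_x f x + \int[nn]_x f x)%E.
Proof.
move=> mf f0; rewrite -(ge0_integral_measure_add np nn measurableT)//.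
by apply: eq_measure_integral => A mA _; exact: (esym (measure_addE np nn A)).
Qed.

Lemma charge_integralD f g : bounded_meas f -> bounded_meas g ->
  charge_integral nu (fun x => f x + g x) = charge_integral nu f + charge_integral nu g.
Proof.
move=> bf bg; rewrite /charge_integral.
rewrite (RintegralD measurableT (bounded_meas_integrable np bf) (bounded_meas_integrable np bg)).
rewrite (RintegralD measurableT (bounded_meas_integrable nn bf) (bounded_meas_integrable nn bg)).
by rewrite opprD addrACA.
Qed.

Lemma charge_integralZ (a : R) f : bounded_meas f ->
  charge_integral nu (fun x => a * f x) = a * charge_integral nu f.
Proof.
move=> bf; rewrite /charge_integral.
rewrite (RintegralZl a measurableT (bounded_meas_integrable np bf)).
rewrite (RintegralZl a measurableT (bounded_meas_integrable nn bf)).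
by rewrite -mulrBr.
Qed.

Lemma charge_integral_sum (I : Type) (s : seq I) (P : pred I) (F : I -> T -> R) :
  (forall i, bounded_meas (F i)) ->
  charge_integral nu (fun x => \sum_(i <- s | P i) F i x) =
  \sum_(i <- s | P i) charge_integral nu (F i).
Proof.
move=> bF; elim: s => [|i s ih].
  rewrite big_nil; under eq_fun do rewrite big_nil.
  by rewrite /charge_integral /Rintegral !integral0 subrr.
rewrite big_cons; under eq_fun do rewrite big_cons.
case: (P i) => //; rewrite charge_integralD// ?ih//; exact: bounded_meas_sum.
Qed.

Lemma charge_integralB f g : bounded_meas f -> bounded_meas g ->
  charge_integral nu (fun x => f x - g x) = charge_integral nu f - charge_integral nu g.
Proof.
move=> bf bg; rewrite -[X in _ = _ + X]mulN1r -charge_integralZ// -charge_integralD//.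
  by congr charge_integral; apply/funext => x; rewrite mulN1r.
exact: bounded_measZ.
Qed.

Lemma charge_integral_indic (A : set T) : measurable A ->
  charge_integral nu (\1_A : T -> R) = fine (nu A).
Proof.
move=> mA; rewrite /charge_integral /Rintegral !integral_indic// !setIT.
rewrite (jordan_decomp (hahnP nu) mA) /cadd /= cscaleN1 -fineB//.
- exact: fin_num_measure.
- exact: fin_num_measure.
Qed.

Lemma le_charge_integral f : bounded_meas f ->
  ((`|charge_integral nu f|)%:E <= \int[variation_measure nu]_x (`|f x|)%:E)%E.
Proof.
move=> bf; have [mf _] := bf.
have mnf : measurable_fun setT (fun x => (`|f x|)%:E).
  by apply/measurable_EFinP; exact: measurableT_comp.
rewrite ge0_integral_variation//; rewrite /charge_integral.
have h (m : {finite_measure set T -> \bar R}) :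
    ((`|\int[m]_x f x|%R)%:E <= \int[m]_x (`|f x|)%:E)%E.
  have im := bounded_meas_integrable m bf.
  rewrite /Rintegral -abse_EFin fineK; last exact: integrable_fin_num.
  have mEf : measurable_fun setT (EFin \o f) by exact/measurable_EFinP.
  exact: (le_abse_integral m measurableT mEf).
apply: le_trans (leeD (h np) (h nn)).
by rewrite -EFinD lee_fin; exact: ler_normB.
Qed.

Lemma charge_integral_bound f (B S : R) : measurable_fun setT f ->
  (forall x, `|f x| <= B) -> (variation_measure nu setT <= S%:E)%E -> 0 <= B ->
  `|charge_integral nu f| <= B * S.
Proof.
move=> mf fB nuS B0; rewrite -lee_fin; apply: le_trans (le_charge_integral _) _.
  by split=> //; exists B.
apply: (@le_trans _ _ (\int[variation_measure nu]_x B%:E)%E).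
  apply: ge0_le_integral => //.
    by apply/measurable_EFinP; exact: measurableT_comp.
  by move=> x _; rewrite lee_fin.
by rewrite integral_cst// EFinM lee_wpmul2l.
Qed.

Lemma variation_lty : (variation_measure nu setT < +oo)%E.
Proof.
rewrite variationE; apply: lte_add_pinfty;
  by rewrite -ge0_fin_numE//; exact: fin_num_measure.
Qed.

End charge_integral_theory.

Section charge_of_measure.
Context {R : realType} {d : measure_display} {T : measurableType d}.
Variable m : {finite_measure set T -> \bar R}.

Local Notation nu := (charge_of_finite_measure m).
Local Notation np := (jordan_pos (hahnP nu)).
Local Notation nn := (jordan_neg (hahnP nu)).

(** The negative Jordan part takes minus the value of a nonnegative measure and is itself
    nonnegative. *)
Lemma jordan_neg_measure (A : set T) : measurable A -> nn A = 0%E.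
Proof.
move=> mA; apply/eqP; rewrite eq_le measure_ge0 andbT.
rewrite jordan_negE cjordan_negE /crestr0 mem_set// /crestr oppe_le0.
exact: (measure_ge0 m).
Qed.

Lemma jordan_pos_measure (A : set T) : measurable A -> np A = m A.
Proof.
move=> mA; have : nu A = (np A - nn A)%E.
  by rewrite [LHS](jordan_decomp (hahnP nu) mA) /cadd/= cscaleN1.
by rewrite jordan_neg_measure// oppe0 adde0 => <-.
Qed.

Lemma charge_integral_measure (f : T -> R) :
  charge_integral nu f = (\int[m]_x f x)%R.
Proof.
rewrite /charge_integral /Rintegral.
have -> : (\int[nn]_x (f x)%:E = 0)%E.
  rewrite (eq_measure_integral mzero); first by rewrite integral_measure_zero.
  by move=> A mA _; exact: jordan_neg_measure.
have -> : (\int[np]_x (f x)%:E = \int[m]_x (f x)%:E)%E.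
  by apply: eq_measure_integral => A mA _; exact: jordan_pos_measure.
by rewrite subr0.
Qed.

Lemma variation_of_measure (A : set T) : measurable A ->
  variation_measure nu A = m A.
Proof.
by move=> mA; rewrite variationE jordan_neg_measure// jordan_pos_measure// adde0.
Qed.

End charge_of_measure.

(** The arithmetic of constants in [charge_ker_bound], where W >= 1 is the loss between two
    scales. *)
Lemma helper (R : realFieldType) (C C' C1 M D T W : R) : 0 <= C -> 0 <= C' -> 0 <= C1 ->
  0 <= M -> 0 <= D -> 0 <= T -> 1 <= W ->
  C * M * (C' * D * W + T) <= (C * (C' + 1) + C1) * M * (D + T) * W.
Proof.
move=> C0 C'0 C10 M0 D0 T0 W1; have W0 : 0 <= W by exact: le_trans ler01 W1.
have TW : T <= T * W by rewrite ler_peMr.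
have CM : 0 <= C * M by rewrite mulr_ge0.
apply: (@le_trans _ _ (C * M * ((C' + 1) * (D + T) * W))).
  rewrite ler_wpM2l//.
  have -> : (C' + 1) * (D + T) * W = C' * D * W + T * W + (D * W + C' * T * W) by ring.
  by rewrite -[leLHS]addr0 lerD ?lerD2l// addr_ge0 ?mulr_ge0.
have -> : (C * (C' + 1) + C1) * M * (D + T) * W =
    C * M * ((C' + 1) * (D + T) * W) + C1 * M * (D + T) * W by ring.
by rewrite lerDl !mulr_ge0// addr_ge0.
Qed.

(** * Multipliers acting on functions and on signed measures *)

Section kernel_operators.
Context {R : realType} (Xi : system R) (q : R) (Xi_dd : data_defined Xi q).
Variable S : nat.
Hypothesis qS : q < S%:R.
Implicit Types (x y : Xi) (f : borel Xi -> R) (p : \bar R).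

Local Notation mu := (mustar Xi).
Local Notation "'N_ p [ f ]" := (Lnorm mu p (EFin \o f)).

Lemma ker_sym J g x y : ker J g x y = ker J g y x.
Proof. by apply: eq_bigr => k _; rewrite mulrAC. Qed.

Lemma bounded_meas_phi k : bounded_meas (phi k : borel Xi -> R).
Proof. by split; [exact: measurable_phi Xi_dd k|exact: dd_phi_bounded Xi_dd k]. Qed.

Lemma phi_Lfun p k : (1 <= p)%E -> (phi k : borel Xi -> R) \in Lfun mu p.
Proof.
by move=> p1; have [mf [B fB]] := bounded_meas_phi k; exact: (Lfun_bounded mu p1 mf fB).
Qed.

Lemma bounded_meas_ker J g x : bounded_meas (ker J g x : borel Xi -> R).
Proof.
by apply: bounded_meas_sum => k; apply: bounded_measZ; exact: bounded_meas_phi.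
Qed.

Lemma int_ker_mustar : exists2 C : R, 0 < C & forall M m J g x, kmask Xi S M m J g ->
  (\int[mu]_y (`|ker J g x y|)%:E <= (C * M)%:E)%E.
Proof.
have [C C0 ib] := int_ker_bound Xi_dd qS.
have [k2 k20 hk] := dd_ball_measure Xi_dd.
have q0 := q_gt0 Xi_dd.
exists (C * (k2 + 1)); first by rewrite mulr_gt0// addr_gt0.
move=> M m J g x km.
have p0 : 0 < (2 ^+ m : R) by rewrite exprn_gt0.
have pq0 : 0 < (2 ^+ m : R) `^ q by rewrite powR_gt0.
have := ib M m J g x mu (k2 / (2 ^+ m) `^ q) 1 km.
have -> : C * M * ((2 ^+ m) `^ q * (k2 / (2 ^+ m) `^ q) + 1) = C * (k2 + 1) * M.
  by field; rewrite gt_eqF.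
apply => //; first by rewrite divr_ge0// ltW.
- move=> j _; apply: le_trans (hk _ _ _) _; first by rewrite divr_gt0// exprn_gt0.
  rewrite lee_fin powRM ?invr_ge0 ?exprn_ge0// -(powR_inv1 (ltW p0)) -powRrM mulN1r powRN.
  by rewrite mulrA mulrAC.
- by rewrite -(@probability_setT _ _ _ mu).
Qed.

Definition multop J (g : nat -> R) f : borel Xi -> R :=
  fun y => \sum_(k < J) g k * coef f k * phi k y.

Lemma bounded_meas_multop J g f : bounded_meas (multop J g f).
Proof. by apply: bounded_meas_sum => k; apply: bounded_measZ; exact: bounded_meas_phi. Qed.

Lemma Lfun1_mul f h : f \in Lfun mu 1 -> bounded_meas h ->
  mu.-integrable setT (EFin \o (fun z => f z * h z)).
Proof.
move=> /Lfun1_integrable fi [mh [B hB]].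
have mf : measurable_fun setT f by apply/measurable_EFinP; exact: measurable_int fi.
apply: (@le_integrable _ _ _ mu _ measurableT _ (fun z => (B%:E * (f z)%:E)%E)).
- by apply/measurable_EFinP; exact: measurable_funM.
- move=> x _; rewrite /= lee_fin normrM mulrC -normrM !normrM ler_wpM2r//.
  by apply: le_trans (hB x) _; rewrite ler_norm.
- exact: integrableZl.
Qed.

Lemma multop_int J g f x : f \in Lfun mu 1 ->
  multop J g f x = (\int[mu]_z (ker J g x z * f z))%R.
Proof.
move=> f1.
have ik k : mu.-integrable setT (fun z : borel Xi => (g k * phi k x * (f z * phi k z))%:E).
  exact: (integrableZl measurableT (g k * phi k x) (Lfun1_mul f1 (bounded_meas_phi k))).
rewrite /Rintegral (_ : (\int[mu]_z (ker J g x z * f z)%:E)%E =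
    (\int[mu]_z \sum_(k < J) (g k * phi k x * (f z * phi k z))%:E)%E); last first.
  apply: eq_integral => y _; rewrite sumEFin /ker mulr_suml; congr EFin.
  by apply: eq_bigr => k _; rewrite (mulrC (f y)) mulrA.
rewrite integral_sum// /multop -sum_fine; last first.
  by move=> k _; exact: integrable_fin_num.
apply: eq_bigr => k _; rewrite /coef -mulrA (mulrC (coef f k)) mulrA.
rewrite -(RintegralZl _ measurableT (Lfun1_mul f1 (bounded_meas_phi k))).
by [].
Qed.

Lemma measurable_ker2 J g :
  measurable_fun setT (fun z : borel Xi * borel Xi => ker J g z.1 z.2).
Proof.
apply: measurable_sum => k; apply: measurable_funM.
  apply: measurable_funM; first exact: measurable_cst.
  exact: (measurableT_comp (measurable_phi Xi_dd k) measurable_fst).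
exact: (measurableT_comp (measurable_phi Xi_dd k) measurable_snd).
Qed.

(** Schur's test: the kernel is symmetric and its L^1 norm in either variable is at most C M by
    [int_ker_mustar]. The constant does not depend on p. *)
Lemma multop_bound : exists2 C : R, 0 < C & forall p M m J g f, (1 <= p)%E ->
  kmask Xi S M m J g -> f \in Lfun mu p ->
  ('N_p[multop J g f] <= (C * M)%:E * 'N_p[f])%E.
Proof.
have [C C0 ik] := int_ker_mustar; exists C => // p M m J g f p1 km fp.
apply: (@schur _ _ _ mu p (ker J g)) => //.
- by rewrite mulr_ge0 ?(ltW C0) ?(kmask_ge0 km).
- exact: measurable_ker2.
- by move=> x; exact: ik km.
- by move=> y; under eq_integral do rewrite ker_sym; exact: ik km.
- by case: (bounded_meas_multop J g f).
move=> x; rewrite (multop_int J g x (Lfun_Lfun1 p1 fp)).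
have i : mu.-integrable setT (EFin \o (fun z : borel Xi => ker J g x z * f z)).
  rewrite (_ : (fun z : borel Xi => _) = (fun z : borel Xi => f z * ker J g x z)).
    exact: Lfun1_mul (Lfun_Lfun1 p1 fp) (bounded_meas_ker J g x).
  by apply/funext => y; rewrite mulrC.
rewrite /Rintegral -abse_EFin fineK; last exact: integrable_fin_num.
apply: (le_abse_integral mu measurableT (measurable_int mu i)).
Qed.

(* The measure is only controlled at the scale [2^-m0]; the factor is what is
   lost by interpolating between [L^1] and [L^oo]. *)
Lemma charge_ker_bound : exists2 C : R, 0 < C &
  forall p M m m0 J g (nu : signed_measure Xi R) (D T : R), (1 <= p)%E ->
  kmask Xi S M m J g -> (m0 <= m)%N -> 0 <= D -> 0 <= T ->
  (forall x, (variation_measure nu (cball x (2 ^+ m0)^-1) <=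
     (D * ((2 ^+ m0)^-1) `^ q)%:E)%E) ->
  (variation_measure nu setT <= T%:E)%E ->
  ('N_(hoelder_conjugate p)[(fun y : borel Xi => \sum_(k < J) g k * charge_integral nu (phi k) * phi k y)%R]
    <= (C * M * (D + T) * (2 ^+ (m - m0)) `^ (q * fine p^-1%E))%:E)%E.
Proof.
have [C C0 ib] := int_ker_bound Xi_dd qS.
have [C' C'0 cb] := covering_bound Xi_dd qS.
have [C1 C10 ik] := int_ker_mustar.
have q0 := q_gt0 Xi_dd.
exists (C * (C' + 1) + C1); first by rewrite addr_gt0// mulr_gt0// addr_gt0.
move=> p M m m0 J g nu D T p1 km m0m D0 T0 reg tot.
have M0 := kmask_ge0 km.
set Q := (fun y : borel Xi => _).
have bQ : bounded_meas Q by apply: bounded_meas_sum => k; apply: bounded_measZ; exact: bounded_meas_phi.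
have QE y : Q y = charge_integral nu (ker J g y).
  rewrite /Q /ker charge_integral_sum; last first.
    by move=> k; apply: bounded_measZ; exact: bounded_meas_phi.
  apply: eq_bigr => k _; rewrite charge_integralZ; last exact: bounded_meas_phi.
  by rewrite mulrAC.
have W1 : 1 <= (2 ^+ (m - m0) : R) `^ q.
  have := ge0_ler_powR (ltW q0) (x := 1) (y := 2 ^+ (m - m0)).
  by rewrite powR1; apply; rewrite ?nnegrE ?exprn_ge0// exprn_ege1// ler1n.
set W := _ `^ q in W1.
have Wd : (2 ^+ m : R) `^ q * ((2 ^+ m0)^-1) `^ q = W.
  rewrite -powRM ?invr_ge0 ?exprn_ge0//; congr (_ `^ _).
  by rewrite -[in LHS](subnK m0m) exprD mulfK// expf_neq0.
pose Z := (C * (C' + 1) + C1) * M * (D + T).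
have DT : 0 <= D + T by rewrite addr_ge0.
have Z0 : 0 <= Z by rewrite !mulr_ge0 ?addr_ge0 ?mulr_ge0 ?addr_ge0// ltW.
(* Supremum bound: [covering_bound] gives the growth on balls of radius 2^j/2^m0, which contain
   those of radius 2^j/2^m. *)
have QW y : `|Q y| <= Z * W.
  rewrite QE -lee_fin; apply: le_trans (le_charge_integral _ (bounded_meas_ker J g y)) _.
  have d0 : 0 < (2 ^+ m0 : R)^-1 <= 1.
    by rewrite invr_gt0 exprn_gt0//= invf_le1 ?exprn_gt0// exprn_ege1// ler1n.
  have := ib M m J g y (variation_measure nu) (C' * D * ((2 ^+ m0)^-1) `^ q) T km.
  move=> /(_ _ T0 _ tot) H; apply: le_trans (H _ _) _.
  - by rewrite !mulr_ge0 ?powR_ge0// ltW.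
  - move=> j jm; have := cb (variation_measure nu) D (2 ^+ m0)^-1 d0 D0 reg j y.
    rewrite (mulrAC (C' * D)); apply: le_trans; apply: le_cball Xi_dd _ _ _ _ _.
    by rewrite ler_wpM2l ?exprn_ge0// lef_pV2 ?posrE ?exprn_gt0// ler_eXn2l ?ltr1n.
  rewrite lee_fin.
  have -> : (2 ^+ m : R) `^ q * (C' * D * ((2 ^+ m0)^-1) `^ q) = C' * D * W.
    by rewrite -Wd mulrCA.
  by apply: helper => //; exact: ltW.
(* By duality: the integral of sign(Q) Q is that, against nu, of the multiplier applied to sign(Q),
   a function bounded by C1 M. All sums are finite, so the exchange of integrals is linearity. *)
have Q1 : ('N_1[Q] <= Z%:E)%E.
  have bs := bounded_meas_sign bQ.1.
  have s1 : sign Q \in Lfun mu 1.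
    by apply: (Lfun_bounded mu (B := 1)) bs.1 _ => // z; rewrite norm_sign.
  have iQ : mu.-integrable setT (EFin \o (fun z => sign Q z * Q z)) by exact: Lfun1_mul s1 bQ.
  rewrite Lnorm1E (_ : (\int[mu]_z _)%E = (\int[mu]_z (sign Q z * Q z)%:E)%E); last first.
    by apply: eq_integral => z _; rewrite mulrC mul_sign.
  rewrite -[leLHS]fineK; last exact: integrable_fin_num.
  have ZT : C1 * M * T <= Z.
    rewrite /Z -!(mulrA _ M); apply: ler_pM; rewrite ?mulr_ge0 ?(ltW C10)//.
      by rewrite lerDr mulr_ge0 ?addr_ge0 ?ltW.
    by rewrite ler_wpM2l// lerDr.
  rewrite lee_fin; apply: le_trans ZT.
  have bk k : bounded_meas (fun z => sign Q z * phi k z).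
    have [mphi [B hB]] := bounded_meas_phi k; split.
      exact: measurable_funM bs.1 mphi.
    by exists B => z; rewrite normrM norm_sign mul1r.
  have -> : fine (\int[mu]_z (sign Q z * Q z)%:E) = charge_integral nu (multop J g (sign Q)).
    rewrite /multop charge_integral_sum; last by move=> k; exact/bounded_measZ/bounded_meas_phi.
    rewrite -[LHS](charge_integral_measure mu (fun z => sign Q z * Q z)) /Q.
    under eq_fun do rewrite mulr_sumr.
    rewrite charge_integral_sum; last first.
      move=> k; under eq_fun do rewrite mulrCA; exact: bounded_measZ.
    apply: eq_bigr => k _; under eq_fun do rewrite mulrCA.
    rewrite [LHS]charge_integralZ// [RHS]charge_integralZ; last exact: bounded_meas_phi.
    have := charge_integral_measure mu (fun z => sign Q z * phi k z) => ->.
    by rewrite /coef mulrAC.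
  apply: le_trans (ler_norm _) _; apply: charge_integral_bound => //.
  - by case: (bounded_meas_multop J g (sign Q)).
  - move=> x; rewrite (multop_int J g x s1) -lee_fin.
    have i := Lfun1_mul s1 (bounded_meas_ker J g x).
    apply: le_trans (ik _ _ _ _ x km).
    under eq_Rintegral do rewrite mulrC.
    rewrite /Rintegral.
    rewrite -abse_EFin fineK; last exact: integrable_fin_num.
    apply: le_trans (le_abse_integral mu measurableT (measurable_int mu i)) _.
    rewrite le_eqVlt; apply/orP; left; apply/eqP; apply: eq_integral => z _.
    by rewrite /= normrM norm_sign mul1r.
  - by rewrite mulr_ge0// ltW.
have := Lnorm_interpolation p1 bQ.1 Z0 _ QW Q1.
by rewrite /W -powRrM; apply; rewrite (lt_le_trans ltr01).
Qed.

End kernel_operators.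

(** * Diffusion polynomials and their closure *)

Lemma sum_trunc (V : nmodType) (F : nat -> V) J K :
  (forall k, (J <= k)%N -> F k = 0) -> (forall k, (K <= k)%N -> F k = 0) ->
  \sum_(k < J) F k = \sum_(k < K) F k.
Proof.
have half a b : (a <= b)%N -> (forall k, (a <= k)%N -> F k = 0) ->
    \sum_(k < a) F k = \sum_(k < b) F k.
  move=> ab Fa; rewrite -!(big_mkord xpredT) [RHS](big_cat_nat _ ab)//=.
  by rewrite [X in _ = _ + X]big_nat [X in _ = _ + X]big1 ?addr0// => k /andP[ak _]; exact: Fa.
move=> FJ FK; have [JK|/ltnW KJ] := leqP J K; first exact: half.
by apply/esym/half.
Qed.

Section diffusion_spaces.
Context {R : realType} (Xi : system R) (q : R) (Xi_dd : data_defined Xi q).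
Variable S : nat.
Hypothesis qS : q < S%:R.
Implicit Types (f g P Q : borel Xi -> R) (p : \bar R).

Local Notation mu := (mustar Xi).
Local Notation "'N_ p [ f ]" := (Lnorm mu p (EFin \o f)).

Lemma coef_diff f g k : f \in Lfun mu 1 -> g \in Lfun mu 1 ->
  coef (fun z => f z - g z) k = coef f k - coef g k.
Proof.
move=> f1 g1; have bk := bounded_meas_phi Xi_dd k.
rewrite /coef; under eq_Rintegral do rewrite mulrBl.
exact: (RintegralB measurableT (Lfun1_mul f1 bk) (Lfun1_mul g1 bk)).
Qed.

Lemma coef_lincomb (m : nat) (c : nat -> R) k :
  coef (fun z : borel Xi => \sum_(j < m) c j * phi j z) k = if (k < m)%N then c k else 0.
Proof.
rewrite /coef -(charge_integral_measure mu).
under eq_fun do rewrite mulr_suml.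
rewrite charge_integral_sum; last first.
  move=> j; under eq_fun do rewrite -mulrA.
  apply: bounded_measZ; have [mj [A hA]] := bounded_meas_phi Xi_dd j.
  have [mk [B hB]] := bounded_meas_phi Xi_dd k; split; first exact: measurable_funM.
  by exists (A * B) => z; rewrite normrM ler_pM.
have E j : charge_integral (charge_of_finite_measure mu) (fun z => c j * phi j z * phi k z) =
    c j * (j == k)%:R.
  under eq_fun do rewrite -mulrA.
  rewrite charge_integralZ; last first.
    have [mj [A hA]] := bounded_meas_phi Xi_dd j.
    have [mk [B hB]] := bounded_meas_phi Xi_dd k; split; first exact: measurable_funM.
    by exists (A * B) => z; rewrite normrM ler_pM.
  have := charge_integral_measure mu (fun z => phi j z * phi k z) => ->.
  by rewrite (dd_phi_orthonormal Xi_dd).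
under eq_bigr do rewrite E.
case: ifPn => [km|]; last first.
  rewrite -leqNgt => mk; rewrite big1// => j _.
  by rewrite ltn_eqF ?mulr0// (leq_trans _ mk).
rewrite (bigD1 (Ordinal km))//= eqxx mulr1 big1 ?addr0// => j jk.
by rewrite (_ : (j == k :> nat) = false) ?mulr0//; apply: contraNF jk => /eqP jk; apply/eqP/val_inj.
Qed.

(** By orthonormality the unspecified coefficients of [Pi] are the Fourier coefficients, so
    multipliers can be applied to P through [coef P]. *)
Lemma PiP (N : R) P : Pi N P <-> exists m : nat,
  [/\ forall k, (m <= k)%N -> coef P k = 0, forall k, N <= lam Xi k -> coef P k = 0 &
      P = fun z : borel Xi => \sum_(k < m) coef P k * phi k z].
Proof.
split=> [[m [c PE]]|[m [hm hN PE]]]; last first.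
  exists m, (coef P); rewrite [LHS]PE; apply/funext => z.
  rewrite (bigID (fun k : 'I_m => lam Xi k < N))/= [X in _ + X]big1 ?addr0// => k.
  by rewrite -leNgt => /hN ->; rewrite mul0r.
have PE' : P = fun z : borel Xi => \sum_(k < m) (if lam Xi k < N then c k else 0) * phi k z.
  rewrite PE; apply/funext => z; rewrite big_mkcond; apply: eq_bigr => k _.
  by case: ifP; rewrite ?mul0r.
exists m.
have cE k : coef P k = if (k < m)%N then (if lam Xi k < N then c k else 0) else 0.
  by rewrite PE' (coef_lincomb m (fun k => if lam Xi k < N then c k else 0)).
split=> [k mk|k Nk|].
- by rewrite cE ltnNge mk.
- by rewrite cE ltNge Nk/=; case: ifP.
by rewrite {1}PE'; apply/funext => z; apply: eq_bigr => k _; rewrite cE ltn_ord.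
Qed.

Lemma bounded_meas_Pi (N : R) P : Pi N P -> bounded_meas P.
Proof.
move=> /PiP[m [_ _ ->]]; apply: bounded_meas_sum => k; apply: bounded_measZ.
exact: bounded_meas_phi Xi_dd k.
Qed.

Lemma Pi_Lfun (N : R) P p : (1 <= p)%E -> Pi N P -> P \in Lfun mu p.
Proof.
by move=> p1 /bounded_meas_Pi[mP [B PB]]; exact: (Lfun_bounded mu p1 mP PB).
Qed.

Lemma polyB P Q : diffusion_polynomial P -> diffusion_polynomial Q ->
  diffusion_polynomial (fun z => P z - Q z).
Proof.
move=> [N HP] [N' HQ].
have PQk k : coef (fun z => P z - Q z) k = coef P k - coef Q k.
  by apply: coef_diff; [exact: Pi_Lfun HP|exact: Pi_Lfun HQ].
move/PiP : HP => [m [Pm PN PE]]; move/PiP : HQ => [m' [Qm QN QE]].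
exists (Num.max N N'); apply/PiP; exists (maxn m m'); split.
- by move=> k; rewrite geq_max PQk => /andP[/Pm -> /Qm ->]; rewrite subrr.
- by move=> k; rewrite ge_max PQk => /andP[/PN -> /QN ->]; rewrite subrr.
apply/funext => z; under eq_bigr do rewrite PQk mulrBl.
rewrite sumrB; congr (_ - _).
- rewrite {1}PE; apply: (@sum_trunc _ (fun k => coef P k * phi k z)) => k.
    by move=> /Pm ->; rewrite mul0r.
  by rewrite geq_max => /andP[/Pm -> _]; rewrite mul0r.
- rewrite {1}QE; apply: (@sum_trunc _ (fun k => coef Q k * phi k z)) => k.
    by move=> /Qm ->; rewrite mul0r.
  by rewrite geq_max => /andP[_ /Qm ->]; rewrite mul0r.
Qed.

Lemma XspaceB p f g : (1 <= p)%E -> Xspace p f -> Xspace p g ->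
  Xspace p (fun z => f z - g z).
Proof.
move=> p1 [fp fP] [gp gP]; split; first exact: Lfun_sub.
move=> e e0; have e2 : 0 < e / 2 by rewrite divr_gt0.
have [P dP fPe] := fP _ e2; have [Q dQ gQe] := gP _ e2.
exists (fun z => P z - Q z); first exact: polyB.
have [N HP] := dP; have [N' HQ] := dQ.
have /mem_LfunP[mu1 _] := Lfun_sub p1 fp (Pi_Lfun p1 HP).
have /mem_LfunP[mu2 _] := Lfun_sub p1 gp (Pi_Lfun p1 HQ).
rewrite /normp (_ : EFin \o _ = EFin \o (fun z => (f z - P z) + (-1) * (g z - Q z))); last first.
  by apply/funext => z /=; congr EFin; ring.
have mu3 : measurable_fun setT (fun z => -1 * (g z - Q z)) by exact: measurable_funM.
apply: le_lt_trans (Lnorm_add mu p1 mu1 mu3) _.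
rewrite Lnorm_scale// normrN normr1 mul1e [e in ltRHS]splitr EFinD.
by apply: lteD.
Qed.

(* The low-pass operators reproduce polynomials and annihilate [f]. *)
Lemma Xspace_eq0 p f : (1 <= p)%E -> Xspace p f -> (forall k, coef f k = 0) ->
  'N_p[f] = 0%E.
Proof.
move=> p1 [fp fP] f0.
have [C C0 cb] := multop_bound Xi_dd qS.
have [M M0 km] := lowpass_kmask Xi_dd S.
suff H e : 0 < e -> ('N_p[f] <= ((1 + C * M) * e)%:E)%E.
  apply/eqP; rewrite eq_le Lnorm_ge0 andbT; apply/lee_addgt0Pr => e e0.
  have c0 : 0 < 1 + C * M by rewrite addr_gt0// mulr_gt0.
  have E : (1 + C * M) * (e / (1 + C * M)) = e by rewrite mulrC divfK ?gt_eqF.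
  have := H (e / (1 + C * M)); rewrite E add0e.
  by apply; rewrite divr_gt0.
move=> e0; have [P [N HP] fPe] := fP _ e0.
have Pp := Pi_Lfun p1 HP.
have [m Nm] : exists m, 2 * N <= 2 ^+ m.
  exists (Num.truncn (2 * N)).+1; apply: le_trans (ltW (truncnS_gt _)) _.
  by rewrite -natrX ler_nat ltnW// ltn_expl.
pose g k := lowpass S m (lam Xi k).
have PV : P = multop (dimPi Xi_dd m) g (fun z => P z - f z).
  have /PiP[K [PK PN PE]] := HP.
  rewrite [LHS]PE; apply/funext => z; rewrite /multop.
  have cE k : coef (fun z => P z - f z) k = coef P k.
    by rewrite coef_diff ?f0 ?subr0//; apply: Lfun_Lfun1 p1 _.
  transitivity (\sum_(k < K) g k * coef (fun z => P z - f z) k * phi k z); last first.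
    apply: (@sum_trunc _ (fun k => g k * coef (fun z => P z - f z) k * phi k z)) => k h.
      by rewrite cE PK// mulr0 mul0r.
    by rewrite (_ : g k = 0) ?mul0r //; exact: kmask_eq0 (km m) h.
  apply: eq_bigr => k _; rewrite cE.
  have [/PN ->|kN] := leP N (lam Xi k); first by rewrite mulr0.
  rewrite /g lowpass_eq1 ?mul1r//; first exact: lam_ge0 Xi_dd k.
  by apply: le_trans Nm; rewrite ler_wpM2l// ltW.
have d1 := Lfun_sub p1 fp Pp; have d2 := Lfun_sub p1 Pp fp.
have nd : ('N_p[(fun z => P z - f z)%R] <= e%:E)%E by rewrite Lnorm_distC; exact: ltW.
rewrite (_ : EFin \o f = EFin \o (fun z => (f z - P z) + P z)); last first.
  by apply/funext => z /=; rewrite subrK.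
have /mem_LfunP[mfP _] := d1; have /mem_LfunP[mP _] := Pp.
apply: le_trans (Lnorm_add mu p1 mfP mP) _.
rewrite mulrDl mul1r EFinD; apply: leeD; first exact: ltW.
rewrite [X in EFin \o X]PV; apply: le_trans (cb _ _ _ _ _ _ p1 (km m) d2) _.
by rewrite [leRHS]EFinM lee_wpmul2l// lee_fin mulr_ge0// ltW.
Qed.

End diffusion_spaces.

(** * Potentials of signed measures *)

Lemma expr_small (R : realType) (t K e : R) : 0 <= t < 1 -> 0 < e ->
  \forall n \near \oo, K * t ^+ n < e.
Proof.
move=> /andP[t0 t1] e0.
have tn : `|t| < 1 by rewrite ger0_norm.
have K1 : 0 < `|K| + 1 by rewrite ltr_wpDl.
have /cvgrPdist_lt/(_ (e / (`|K| + 1))) := cvg_expr tn.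
rewrite divr_gt0// => /(_ isT); apply: filterS => n.
rewrite sub0r normrN ger0_norm ?exprn_ge0// ltr_pdivlMr// => h.
apply: le_lt_trans h; rewrite mulrC ler_wpM2l ?exprn_ge0//.
by apply: le_trans (ler_norm _) _; rewrite lerDl.
Qed.

Lemma powR2_lt1 (R : realType) (x : R) : x < 0 -> 2 `^ x < 1.
Proof.
by move=> x0; rewrite /powR gt_eqF ?ltr0n// expR_lt1 nmulr_rlt0// ln_gt0 ?ltr1n.
Qed.

Section potential.
Context {R : realType} (Xi : system R) (q : R) (Xi_dd : data_defined Xi q).
Variable S : nat.
Hypothesis qS : q < S%:R.
Variables (p : \bar R) (beta : R) (b : R -> R).
Hypotheses (p1 : (1 <= p)%E) (beta_gt0 : 0 < beta) (q_beta : (q%:E / p < beta%:E)%E).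
Hypothesis kb : kernel_mask S beta b.
Implicit Types (f g : borel Xi -> R).

Local Notation mu := (mustar Xi).
Local Notation p' := (hoelder_conjugate p).
Local Notation "'N_ p [ f ]" := (Lnorm mu p (EFin \o f)).

Let p'1 : (1 <= p')%E. Proof. exact: hoelder_conj_ge1. Qed.

(** At l = 0, where the product formula is not given, positivity follows by continuity from
    b(1/(n+1)) >= 2^(-beta) c1. The frequency lam_0 = 0 requires this case. *)
Lemma mask_gt0 (l : R) : 0 <= l -> 0 < b l.
Proof.
have [_ [db _] [F [bF _ _ [c1 c10 cF]]]] := kb.
rewrite le_eqVlt => /predU1P[<-|l0]; last first.
  rewrite bF// mulr_gt0 ?powR_gt0 ?addr_gt0//.
  exact: lt_le_trans c10 (cF _).
have cb : {for 0, continuous b}.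
  apply: differentiable_continuous; apply/derivable1_diffP.
  by have := db 0%N (S_gt0 Xi_dd qS) 0.
have hc : @harmonic R @ \oo --> (0 : R) by exact: cvg_harmonic.
have bc : b (harmonic n) @[n --> \oo] --> b 0 by exact: (continuous_cvg _ cb hc).
apply: (@lt_le_trans _ _ (2 `^ (- beta) * c1)); first by rewrite mulr_gt0// powR_gt0.
rewrite -(cvg_lim (@Rhausdorff R) bc); apply: limr_ge; first by apply/cvg_ex; exists (b 0).
apply: nearW => n; rewrite bF ?harmonic_gt0//; apply: ler_pM; [exact: powR_ge0|exact: ltW| |exact: cF].
rewrite !powRN lef_pV2 ?posrE ?powR_gt0 ?addr_gt0 ?harmonic_gt0//.
apply: ge0_ler_powR; rewrite ?nnegrE ?addr_ge0 ?harmonic_ge0// ?(ltW beta_gt0)//.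
by rewrite -[leRHS]/(1 + 1) lerD2l /harmonic invf_le1 ?ler1n ?ltr0n.
Qed.

(** F takes its values in [c1, c] with c1 > 0, where inversion is smooth; so dividing by b is as
    good as multiplying by a mask of the opposite order. *)
Lemma mask_usmooth : exists2 F : R -> R,
  (forall l, 0 < l -> b l = (1 + l) `^ (- beta) * F (ln l)) &
  usmooth S setT (fun _ : unit => F) /\ usmooth S setT (fun _ : unit => fun l => (F l)^-1).
Proof.
have [_ _ [F [bF dF [c hc] [c1 c10 cF]]]] := kb.
have sF : usmooth S setT (fun _ : unit => F).
  apply: (@usmooth_of_bounds _ _ _ _ _ c) => _ j t jS _; [exact: dF|exact: hc].
exists F => //; split => //.
have c0 : 0 < c.
  apply: lt_le_trans c10 _; apply: le_trans (cF 0) _; apply: le_trans (ler_norm _) _.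
  exact: (hc 0%N (leq0n _) 0).
pose d := Num.min (c1 / 2) (c + 1)^-1.
have d0 : 0 < d by rewrite lt_min divr_gt0//= invr_gt0 addr_gt0.
have sI := @usmooth_inv R unit S d d0.
apply: (usmooth_comp _ _ sI sF) => [|_ t _]; first exact: openT.
apply/andP; split.
  apply: lt_le_trans (cF t); apply: (@le_lt_trans _ _ (c1 / 2)); first by rewrite ge_min lexx.
  by rewrite ltr_pdivrMr// ltr_pMr// ltr1n.
apply: (@lt_le_trans _ _ (c + 1)).
  by apply: le_lt_trans (ler_norm _) _; apply: le_lt_trans (hc 0%N (leq0n _) t) _; rewrite ltrDl.
by rewrite -[leLHS]invrK lef_pV2 ?posrE ?invr_gt0 ?addr_gt0// ge_min lexx orbT.
Qed.

Let band0 m : band S m (0 : R) = 0.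
Proof. by rewrite /band !lowpass_eq1 ?mulr0 ?exprn_ge0// subrr. Qed.

Lemma mask_kmask : exists2 M : R, 0 < M & forall m,
  kmask Xi S (M * (2 ^+ m.+1) `^ (- beta)) m.+1 (dimPi Xi_dd m.+1)
    (fun k => band S m (lam Xi k) * b (lam Xi k)).
Proof.
have [F bF [sF _]] := mask_usmooth.
have [M M0 km] := kmask_multiplier Xi_dd (- beta) sF; exists M => // m.
rewrite (_ : (fun k => _) = (fun k => band S m (lam Xi k) *
  ((1 + lam Xi k) `^ (- beta) * F (ln (lam Xi k))))); first exact: km.
apply/funext => k; have := lam_ge0 Xi_dd k.
rewrite le_eqVlt => /predU1P[<-|l0]; first by rewrite band0 !mul0r.
by rewrite bF.
Qed.

(** Used with s = 0 and s = r: on one band, it turns a function, respectively its r-th derivative,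
    into the function divided by b. *)
Lemma inv_mask_kmask (s : R) : exists2 M : R, 0 < M & forall m,
  kmask Xi S (M * (2 ^+ m.+1) `^ (beta - s)) m.+1 (dimPi Xi_dd m.+1)
    (fun k => band S m (lam Xi k) * ((b (lam Xi k))^-1 * (1 + lam Xi k) `^ (- s))).
Proof.
have [F bF [_ sF]] := mask_usmooth.
have [M M0 km] := kmask_multiplier Xi_dd (beta - s) sF; exists M => // m.
rewrite (_ : (fun k => _) = (fun k => band S m (lam Xi k) *
  ((1 + lam Xi k) `^ (beta - s) * (F (ln (lam Xi k)))^-1))); first exact: km.
apply/funext => k; have := lam_ge0 Xi_dd k.
rewrite le_eqVlt => /predU1P[<-|l0]; first by rewrite band0 !mul0r.
have l1 : 1 + lam Xi k != 0 by rewrite gt_eqF// addr_gt0.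
rewrite bF// invfM -powRN opprK mulrAC -powRD//.
by rewrite l1 implybT.
Qed.

(** Gain per dyadic band: the decay 2^(-beta) of the mask against the interpolation loss 2^(q/p).
    The term [fine p^-1] is 0 for infinite p. *)
Definition rate : R := 2 `^ (q * fine p^-1%E - beta).

Lemma rate01 : 0 <= rate < 1.
Proof.
rewrite powR_ge0/=; apply: powR2_lt1; rewrite subr_lt0.
have := q_beta; case: p p1 => [r r1||//].
  have r0 : r != 0 by rewrite gt_eqF// (lt_le_trans ltr01)// -lee_fin.
  by rewrite inver (negbTE r0) -EFinM lte_fin.
by rewrite invey /= mule0 mulr0 lte_fin.
Qed.

(* Low-pass version of [int G(x, .) dnu(x)]. *)
Definition lowpot (m : nat) (nu : signed_measure Xi R) : borel Xi -> R :=
  fun y => \sum_(k < dimPi Xi_dd m) (lowpass S m (lam Xi k) * b (lam Xi k)) *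
     charge_integral nu (phi k) * phi k y.

Lemma bounded_meas_approx m nu : bounded_meas (lowpot m nu).
Proof.
by apply: bounded_meas_sum => k; apply: bounded_measZ; exact: bounded_meas_phi Xi_dd k.
Qed.

Lemma approx_Lfun m nu r : (1 <= r)%E -> lowpot m nu \in Lfun mu r.
Proof.
by move=> r1; have [mA [B hB]] := bounded_meas_approx m nu; exact: (Lfun_bounded mu r1 mA hB).
Qed.

Lemma approxS m nu y : lowpot m.+1 nu y - lowpot m nu y =
  \sum_(k < dimPi Xi_dd m.+1) (band S m (lam Xi k) * b (lam Xi k)) *
     charge_integral nu (phi k) * phi k y.
Proof.
rewrite /lowpot.
have z j k : 2 ^+ j <= lam Xi k -> lowpass S j (lam Xi k) * b (lam Xi k) *
     charge_integral nu (phi k) * phi k y = 0.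
  by move=> /lowpass_eq0 ->; rewrite !mul0r.
rewrite (@sum_trunc _ (fun k => lowpass S m (lam Xi k) * b (lam Xi k) *
     charge_integral nu (phi k) * phi k y) (dimPi Xi_dd m) (dimPi Xi_dd m.+1)).
- rewrite -sumrB; apply: eq_bigr => k _; rewrite /band.
  by rewrite -!mulrBl.
- by move=> k /dimPiP /z.
- move=> k /dimPiP h; apply: z; apply: le_trans h.
  by rewrite ler_eXn2l ?ltr1n.
Qed.

Definition regular_at m0 (nu : signed_measure Xi R) (D T : R) : Prop :=
  [/\ 0 <= D, 0 <= T,
    forall x : Xi, (variation_measure nu (cball x (2 ^+ m0)^-1) <=
       (D * ((2 ^+ m0)^-1) `^ q)%:E)%E &
    (variation_measure nu setT <= T%:E)%E].

(** The increment is one band of the mask integrated against nu, so [charge_ker_bound] applies with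
    multiplier size 2^(-(m+1) beta); the powers of 2 are regrouped at scale m0. *)
Lemma approx_step : exists2 C : R, 0 < C & forall m0 m nu D T,
  regular_at m0 nu D T -> (m0 <= m.+1)%N ->
  ('N_p'[(fun y => lowpot m.+1 nu y - lowpot m nu y)%R] <=
    (C * (D + T) * (2 ^+ m0) `^ (- beta) * rate ^+ (m.+1 - m0))%:E)%E.
Proof.
have [C C0 ck] := charge_ker_bound Xi_dd qS.
have [M M0 km] := mask_kmask.
exists (C * M); first exact: mulr_gt0.
move=> m0 m nu D T [D0 T0 reg tot] m0m.
have -> : (fun y => lowpot m.+1 nu y - lowpot m nu y) = (fun y =>
  \sum_(k < dimPi Xi_dd m.+1) (band S m (lam Xi k) * b (lam Xi k)) *
     charge_integral nu (phi k) * phi k y).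
  by apply/funext => y; rewrite approxS.
have := ck p _ m.+1 m0 _ _ nu D T p1 (km m) m0m D0 T0 reg tot.
move=> /le_trans; apply; rewrite lee_fin le_eqVlt; apply/orP; left; apply/eqP.
rewrite -[X in (2 ^+ X) `^ (- beta)](subnK m0m) exprD powRM ?exprn_ge0//.
set l := (m.+1 - m0)%N.
have h2 : (2 ^+ l : R) `^ (- beta) * (2 ^+ l) `^ (q * fine p^-1%E) = rate ^+ l.
  rewrite -powRD; first by rewrite addrC powR_exp2.
  by rewrite (gt_eqF (exprn_gt0 _ _))// implybT.
rewrite -h2; set x := _ `^ (- beta); set y := _ `^ (q * _); set z := _ `^ (- beta).
by ring.
Qed.

(** At scale 1 any finite signed measure is regular with its total variation as constant; this gives
    every measure a potential. *)
Lemma regular_crude (nu : signed_measure Xi R) :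
  regular_at 0 nu (fine (variation_measure nu setT)) (fine (variation_measure nu setT)).
Proof.
have fin : variation_measure nu setT \is a fin_num.
  by rewrite ge0_fin_numE// variation_lty.
split => //; rewrite ?fine_ge0//; last by rewrite fineK.
move=> x; rewrite expr0 invr1 powR1 mulr1 fineK//.
by apply: le_measure; rewrite ?inE//; exact: measurable_cball Xi_dd x 1.
Qed.

Lemma coef_bound k : exists2 B : R, 0 <= B & forall f r, (1 <= r)%E -> f \in Lfun mu r ->
  ((`|coef f k|)%:E <= B%:E * 'N_r[f])%E.
Proof.
have [mk [B hB]] := bounded_meas_phi Xi_dd k; exists `|B| => // f r r1 fr.
have f1 := Lfun_Lfun1 r1 fr.
have i := Lfun1_mul f1 (bounded_meas_phi Xi_dd k).
rewrite /coef /Rintegral -abse_EFin fineK; last exact: integrable_fin_num.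
apply: le_trans (le_abse_integral mu measurableT (measurable_int mu i)) _.
have /mem_LfunP[mf _] := fr.
have mnf : measurable_fun setT (fun z => (`|f z|)%:E).
  by apply/measurable_EFinP; exact: measurableT_comp.
apply: (@le_trans _ _ (\int[mu]_z ((`|B|)%:E * (`|f z|)%:E))%E).
  apply: ge0_le_integral => //.
  - by apply: measurableT_comp => //; exact: measurable_int i.
  - by apply/measurable_EFinP; apply: measurable_funM => //; exact/measurable_EFinP.
  move=> z _; rewrite /= -EFinM lee_fin normrM mulrC ler_wpM2r//.
  exact: le_trans (hB z) (ler_norm _).
rewrite ge0_integralZl_EFin// lee_wpmul2l// -(Lnorm1E mu f).
exact: le_Lnorm1.
Qed.

(** The limit h of the low-pass potentials is built once, from the crude regularity of nu at scale
    1. Its distance to each of them is then estimated from whatever regularity nu has at scale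
    2^-m0. *)
Lemma potential : exists2 C : R, 0 < C & forall nu, exists h,
  [/\ Xspace p' h, forall k, coef h k = b (lam Xi k) * charge_integral nu (phi k) &
    forall m0 m D T, regular_at m0 nu D T -> (m0 <= m.+1)%N ->
      ('N_p'[(fun y => h y - lowpot m nu y)%R] <=
        (C * (D + T) * (2 ^+ m0) `^ (- beta) * rate ^+ (m.+1 - m0))%:E)%E].
Proof.
have [C C0 st] := approx_step.
have /andP[r0 r1] := rate01.
exists (C / (1 - rate)); first by rewrite divr_gt0// subr_gt0.
move=> nu; have rc := regular_crude nu.
set D := fine _ in rc.
have [|m|h hp hu] := @Lp_complete _ _ _ mu p' (fun m => lowpot m nu)
  (C * (D + D) * (2 ^+ 0) `^ (- beta) * rate) rate p'1 rate01.
- by move=> m; exact: approx_Lfun.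
- by apply: le_trans (st 0%N m nu D D rc _) _ => //; rewrite subn0 exprS mulrA.
have hb m0 m D' T : regular_at m0 nu D' T -> (m0 <= m.+1)%N ->
      ('N_p'[(fun y => h y - lowpot m nu y)%R] <=
        (C / (1 - rate) * (D' + T) * (2 ^+ m0) `^ (- beta) * rate ^+ (m.+1 - m0))%:E)%E.
  move=> reg m0m.
  have e (A B E X : R) : A / X * B * E = A * B * E / X by ring.
  have e2 (A B E F X : R) : A / X * B * E * F = A * B * E * F / X by ring.
  rewrite e2; apply: hu => i.
  apply: le_trans (st m0 (i + m)%N nu D' T reg _) _.
    by rewrite (leq_trans m0m)// ltnS leq_addl.
  by rewrite -addnS -addnBA// addnC exprD mulrA.
exists h; split => //.
- split=> // e e0.
  have [n _ hn] := @expr_small R rate (C / (1 - rate) * (D + D) * (2 ^+ 0) `^ (- beta)) e rate01 e0.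
  exists (lowpot n nu); last first.
    apply: le_lt_trans (hb 0%N n D D rc _) _ => //.
    by rewrite lte_fin subn0; apply: hn => /=.
  exists (2 ^+ n), (dimPi Xi_dd n), (fun k => (lowpass S n (lam Xi k) * b (lam Xi k)) *
     charge_integral nu (phi k)).
  apply/funext => z; rewrite [RHS]big_mkcond; apply: eq_bigr => k _.
  by case: ltP => // /lowpass_eq0 ->; rewrite !mul0r.
move=> k; apply/eqP; rewrite -subr_eq0 -normr_le0; apply/ler_addgt0Pr => e e0; rewrite add0r.
have [B B0 cB] := coef_bound k.
have [n1 _ hn1] := @expr_small R rate (B * (C / (1 - rate) * (D + D) * (2 ^+ 0) `^ (- beta))) e rate01 e0.
(* From this index on, lam_k lies where the low-pass filter equals 1, so the k-th coefficient of
   [lowpot] is exact. *)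
pose n2 := (Num.truncn (2 * lam Xi k)).+1.
pose n := maxn n1 n2.
have ln : 2 * lam Xi k < 2 ^+ n.
  apply: lt_le_trans (truncnS_gt _) _; rewrite -natrX ler_nat.
  by apply: leq_trans (ltnW (ltn_expl n (ltnSn 1))); rewrite leq_maxr.
have l0 := lam_ge0 Xi_dd k.
have kn : (k < dimPi Xi_dd n)%N.
  rewrite ltnNge; apply/negP => /dimPiP h'; move: ln; rewrite ltNge => /negP; apply.
  by apply: le_trans h' _; rewrite ler_peMl// ler1n.
have <- : coef (lowpot n nu) k = b (lam Xi k) * charge_integral nu (phi k).
  rewrite (coef_lincomb Xi_dd _ (fun k => (lowpass S n (lam Xi k) * b (lam Xi k)) *
     charge_integral nu (phi k))) kn lowpass_eq1 ?mul1r//.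
  exact: ltW.
rewrite -(coef_diff Xi_dd k (Lfun_Lfun1 p'1 hp) (approx_Lfun n nu _))//.
rewrite -lee_fin; apply: le_trans (cB _ _ p'1 _) _; first exact: Lfun_sub (approx_Lfun _ _ p'1).
apply: le_trans (lee_wpmul2l _ (hb 0%N n D D rc _)) _ => //.
rewrite -EFinM lee_fin mulrA; apply: ltW; rewrite subn0; apply: hn1 => /=.
by rewrite (leq_trans (leq_maxl n1 n2)).
Qed.

End potential.

(** * Bochner integrals by uniform approximation *)

(** The integral of a nonnegative function is a supremum over simple functions below it, hence
    monotone even without measurability. The distances in [is_bochner] need not be measurable. *)
Lemma le_integral_ge0 {R : realType} {d : measure_display} {T : measurableType d}
    (m : {measure set T -> \bar R}) (f g : T -> \bar R) :
  (forall x, 0 <= f x)%E -> (forall x, f x <= g x)%E ->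
  (\int[m]_x f x <= \int[m]_x g x)%E.
Proof.
move=> f0 fg; have g0 x : (0 <= g x)%E by exact: le_trans (f0 x) (fg x).
rewrite !ge0_integralTE//; apply: ereal_sup_le => _ [h hf <-].
by exists h => // x; exact: le_trans (hf x) (fg x).
Qed.

Section bochner_theory.
Context {R : realType} {d d' : measure_display}
  {T : measurableType d} {U : measurableType d'}.
Variables (mu : probability U R) (p : \bar R) (nu : {charge set T -> \bar R}).
Hypothesis p1 : (1 <= p)%E.
Implicit Types (F : T -> U -> R) (h : U -> R) (s : Lsimple (T := T) mu p).

Local Notation "'N_ p [ f ]" := (Lnorm mu p (EFin \o f)).

(** A form of Bochner integrability with approximation uniform in x. It is stable under sums and
    uniform limits, and implies [is_bochner] because the total variation is finite. *)
Definition bochner_approx F h : Prop := forall e : R, 0 < e -> exists s,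
  (forall x, (Ldist mu p (F x) (Lsimple_fun s x) <= e%:E)%E) /\
  (Ldist mu p (Lsimple_integral nu s) h <= e%:E)%E.

Lemma bochner_approx_eq F F' h h' : (forall x y, F x y = F' x y) -> (forall y, h y = h' y) ->
  bochner_approx F h -> bochner_approx F' h'.
Proof.
move=> FF hh; have -> : F' = F by apply/funext => x; apply/funext => y; rewrite FF.
by have -> : h' = h by apply/funext => y; rewrite hh.
Qed.

Lemma Lsimple_fun_Lfun s x : Lsimple_fun s x \in Lfun mu p.
Proof. by apply: Lfun_sum => // i; apply: Lfun_scaler => //; exact: Lsimple_Lfun. Qed.

Lemma Lsimple_integral_Lfun s : Lsimple_integral nu s \in Lfun mu p.
Proof. by apply: Lfun_sum => // i; apply: Lfun_scaler => //; exact: Lsimple_Lfun. Qed.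

Lemma Ldist_triangle f g h : f \in Lfun mu p -> g \in Lfun mu p -> h \in Lfun mu p ->
  (Ldist mu p f h <= Ldist mu p f g + Ldist mu p g h)%E.
Proof.
move=> fp gp hp; rewrite /Ldist.
have /mem_LfunP[m1 _] := Lfun_sub p1 fp gp; have /mem_LfunP[m2 _] := Lfun_sub p1 gp hp.
rewrite (_ : EFin \o _ = EFin \o (fun y => (f y - g y) + (g y - h y))).
  exact: Lnorm_add.
by apply/funext => y /=; congr EFin; ring.
Qed.

Lemma Ldist_add f g f' g' : f \in Lfun mu p -> g \in Lfun mu p ->
  f' \in Lfun mu p -> g' \in Lfun mu p ->
  (Ldist mu p (fun y => f y + f' y)%R (fun y => g y + g' y)%R
     <= Ldist mu p f g + Ldist mu p f' g')%E.
Proof.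
move=> fp gp fp' gp'; rewrite /Ldist.
have /mem_LfunP[m1 _] := Lfun_sub p1 fp gp; have /mem_LfunP[m2 _] := Lfun_sub p1 fp' gp'.
rewrite (_ : EFin \o _ = EFin \o (fun y => (f y - g y) + (f' y - g' y))).
  exact: Lnorm_add.
by apply/funext => y /=; congr EFin; ring.
Qed.

Definition Lsimple_cat s s' : Lsimple (T := T) mu p := {|
  Lsimple_set := fun i : 'I_(Lsimple_size s + Lsimple_size s') =>
    match fintype.split i with inl j => Lsimple_set j | inr j => Lsimple_set j end;
  Lsimple_val := fun i : 'I_(Lsimple_size s + Lsimple_size s') =>
    match fintype.split i with inl j => @Lsimple_val _ _ _ _ _ mu p s j
                     | inr j => @Lsimple_val _ _ _ _ _ mu p s' j end;
  Lsimple_measurable := fun i => match fintype.split i as x return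
     measurable (match x with inl j => Lsimple_set j | inr j => Lsimple_set j end)
     with inl j => Lsimple_measurable j | inr j => Lsimple_measurable j end;
  Lsimple_Lfun := fun i => match fintype.split i as x return
     (match x with inl j => @Lsimple_val _ _ _ _ _ mu p s j
                     | inr j => @Lsimple_val _ _ _ _ _ mu p s' j end) \in Lfun mu p
     with inl j => Lsimple_Lfun j | inr j => Lsimple_Lfun j end |}.

Lemma Lsimple_fun_cat s s' x :
  Lsimple_fun (Lsimple_cat s s') x = fun y => Lsimple_fun s x y + Lsimple_fun s' x y.
Proof.
apply/funext => y; rewrite /Lsimple_fun /= big_split_ord /=.
by congr (_ + _); apply: eq_bigr => i _;
  [rewrite (unsplitK (inl i))|rewrite (unsplitK (inr i))].
Qed.

Lemma Lsimple_integral_cat s s' : Lsimple_integral nu (Lsimple_cat s s') =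
  fun y => Lsimple_integral nu s y + Lsimple_integral nu s' y.
Proof.
apply/funext => y; rewrite /Lsimple_integral /= big_split_ord /=.
by congr (_ + _); apply: eq_bigr => i _;
  [rewrite (unsplitK (inl i))|rewrite (unsplitK (inr i))].
Qed.

Lemma bochner_approx_add F F' h h' :
  (forall x, F x \in Lfun mu p) -> (forall x, F' x \in Lfun mu p) ->
  h \in Lfun mu p -> h' \in Lfun mu p ->
  bochner_approx F h -> bochner_approx F' h' ->
  bochner_approx (fun x y => F x y + F' x y) (fun y => h y + h' y).
Proof.
move=> Fp F'p hp h'p aF aF' e e0; have e2 : 0 < e / 2 by rewrite divr_gt0.
have [s [sF sh]] := aF _ e2; have [s' [s'F s'h]] := aF' _ e2.
exists (Lsimple_cat s s'); split=> [x|].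
  rewrite Lsimple_fun_cat; apply: le_trans (Ldist_add _ _ _ _) _ => //; try exact: Lsimple_fun_Lfun.
  by rewrite [e]splitr EFinD leeD.
rewrite Lsimple_integral_cat; apply: le_trans (Ldist_add _ _ _ _) _ => //; try exact: Lsimple_integral_Lfun.
by rewrite [e]splitr EFinD leeD.
Qed.

Lemma bochner_approx_lim F h :
  (forall x, F x \in Lfun mu p) -> h \in Lfun mu p ->
  (forall e : R, 0 < e -> exists F' h',
    [/\ forall x, F' x \in Lfun mu p, h' \in Lfun mu p, bochner_approx F' h',
        forall x, (Ldist mu p (F x) (F' x) <= e%:E)%E & (Ldist mu p h' h <= e%:E)%E]) ->
  bochner_approx F h.
Proof.
move=> Fp hp H e e0; have e2 : 0 < e / 2 by rewrite divr_gt0.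
have [F' [h' [F'p h'p aF' FF' hh']]] := H _ e2.
have [s [sF sh]] := aF' _ e2; exists s; split=> [x|].
  apply: le_trans (Ldist_triangle (g := F' x) _ _ _) _ => //; first exact: Lsimple_fun_Lfun.
  by rewrite [e]splitr EFinD leeD.
apply: le_trans (Ldist_triangle (g := h') _ _ _) _ => //; first exact: Lsimple_integral_Lfun.
by rewrite [e]splitr EFinD leeD.
Qed.

(** Values are rounded down to the grid of mesh e starting at -|B|; the sets are the level sets of
    this rounding. *)
Lemma bounded_simple (f : T -> R) (e : R) : bounded_meas f -> 0 < e ->
  exists (N : nat) (A : 'I_N -> set T) (c : 'I_N -> R), (forall i, measurable (A i)) /\
    forall x, `|f x - \sum_(i < N) \1_(A i) x * c i| <= e.
Proof.
move=> [mf [B hB]] e0.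
pose g x := (f x + `|B|) / e.
have mg : measurable_fun setT g by apply: measurable_funM => //; exact: measurable_funD.
have fB x : `|f x| <= `|B| by exact: le_trans (hB x) (ler_norm _).
have g0 x : 0 <= g x.
  by rewrite divr_ge0 ?(ltW e0)// -lerBlDr sub0r; have /ler_normlP[] := fB x; rewrite lerNl.
pose N := (Num.truncn ((`|B| + `|B|) / e)).+1.
pose A (i : 'I_N) := g @^-1` `[i%:R, i.+1%:R[%classic.
exists N, A, (fun i => i%:R * e - `|B|); split=> [i|x].
  by rewrite -[A i]setTI; apply: mg => //; exact: measurable_itv.
have /andP[t1 t2] := truncn_itv (g0 x).
set t := Num.truncn (g x) in t1 t2.
have tN : (t < N)%N.
  rewrite ltnS; apply: le_truncn; rewrite ler_pM2r ?invr_gt0// lerD2r.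
  exact: le_trans (ler_norm _) (fB x).
rewrite (bigD1 (Ordinal tN))//= big1 => [|i it]; last first.
  rewrite indicE memNset ?mul0r// /A /= in_itv /= => /andP[i1 i2].
  move/eqP : it; apply; apply/val_inj => /=; rewrite /t; apply/esym/truncn_def.
  by rewrite i1 i2.
rewrite addr0 indicE mem_set ?mul1r; last by rewrite /A /= in_itv /= t1 t2.
have -> : f x - (t%:R * e - `|B|) = (g x - t%:R) * e.
  by rewrite /g mulrBl divfK ?gt_eqF//; ring.
rewrite normrM (gtr0_norm e0) ger_pMl// ger0_norm ?subr_ge0//.
by rewrite lerBlDr (addrC 1) natr1; exact: ltW.
Qed.

Lemma bochner_approx_rank1 (f : T -> R) (v : U -> R) : bounded_meas f -> v \in Lfun mu p ->
  bochner_approx (fun x y => f x * v y) (fun y => charge_integral nu f * v y).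
Proof.
move=> bf vp e e0.
have /mem_LfunP[mv vy] := vp.
have vfin : 'N_p[v] \is a fin_num by rewrite ge0_fin_numE ?Lnorm_ge0.
pose n := fine 'N_p[v]; have n0 : 0 <= n by rewrite fine_ge0 ?Lnorm_ge0.
pose V := fine (variation_measure nu setT).
have Vfin : variation_measure nu setT \is a fin_num by rewrite ge0_fin_numE// variation_lty.
have V0 : 0 <= V by rewrite fine_ge0.
have D0 : 0 < (n + 1) * (V + 1) by rewrite mulr_gt0 ?ltr_wpDl.
(* The mesh serves two estimates at once: the pointwise distance needs the factor n, the distance of
   the integrals the factor n V. *)
pose d0 := e / ((n + 1) * (V + 1)).
have d00 : 0 < d0 by rewrite divr_gt0.
have [N [A [c [mA fA]]]] := bounded_simple bf d00.
have cvp i : (fun y => c i * v y) \in Lfun mu p by exact: Lfun_scaler.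
exists (@MkLsimple _ _ _ T U mu p N A (fun i y => c i * v y) mA cvp).
have small (a k : R) : 0 <= k -> `|a| <= d0 * k -> k * n <= (n + 1) * (V + 1) ->
    (Lnorm mu p (EFin \o (fun y => (a * v y)%R)) <= e%:E)%E.
  move=> k0 ad kn; rewrite Lnorm_scale// -(fineK vfin) -EFinM lee_fin -/n.
  apply: le_trans (ler_wpM2r n0 ad) _; rewrite -mulrA.
  apply: le_trans (ler_wpM2l (ltW d00) kn) _.
  by rewrite /d0 divfK ?gt_eqF.
split=> [x|].
  rewrite /Ldist (_ : (fun y => _) = (fun y => (f x - \sum_(i < N) \1_(A i) x * c i) * v y)); last first.
    apply/funext => y; rewrite /Lsimple_fun /= mulrBl mulr_suml.
    by congr (_ - _); apply: eq_bigr => i _; rewrite mulrA.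
  apply: (small _ 1) => //; first by rewrite mulr1.
  rewrite mul1r -[leLHS]mulr1; apply: ler_pM => //; first by rewrite lerDl.
  by rewrite lerDr.
have b1 (i : 'I_N) : bounded_meas (\1_(A i) : T -> R).
  split; first exact: measurable_indic.
  by exists 1 => x; rewrite indicE; case: (_ \in _); rewrite ?normr1 ?normr0.
have b2 (i : 'I_N) : bounded_meas (fun x => \1_(A i) x * c i).
  by under eq_fun do rewrite mulrC; exact: bounded_measZ.
have iE : \sum_(i < N) fine (nu (A i)) * c i =
    charge_integral nu (fun x => \sum_(i < N) \1_(A i) x * c i).
  rewrite charge_integral_sum//; apply: eq_bigr => i _.
  under eq_fun do rewrite mulrC.
  by rewrite charge_integralZ// charge_integral_indic// mulrC.
rewrite /Ldist (_ : (fun y => _) =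
  (fun y => (charge_integral nu (fun x => \sum_(i < N) \1_(A i) x * c i - f x)) * v y)); last first.
  apply/funext => y; rewrite charge_integralB//; last exact: bounded_meas_sum.
  rewrite -iE /Lsimple_integral [RHS]mulrBl mulr_suml /=.
  by congr (_ - _); apply: eq_bigr => i _; rewrite mulrA.
apply: (small _ V) => //.
  apply: charge_integral_bound; rewrite ?(ltW d00)//.
  - apply: measurable_funB; last by case: bf.
    by have [] := bounded_meas_sum (index_enum 'I_N) xpredT b2.
  - by move=> x; rewrite distrC.
  - by rewrite /V fineK.
by rewrite mulrC; apply: ler_pM; rewrite ?lerDl.
Qed.

Lemma bochner_approx0 : bochner_approx (fun _ _ => 0) (fun=> 0).
Proof.
have z : (fun _ : U => 0) \in Lfun mu p.
  by apply: (Lfun_bounded mu (B := 0)) => // y; rewrite normr0.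
have b0 : bounded_meas (fun _ : T => 0 : R).
  by split => //; exists 0 => x; rewrite normr0.
apply: bochner_approx_eq (bochner_approx_rank1 b0 z) => [x y|y].
  by rewrite mul0r.
by rewrite mulr0.
Qed.

Lemma bochner_approx_sum (J : nat) (f : nat -> T -> R) (v : nat -> U -> R) :
  (forall k, bounded_meas (f k)) -> (forall k, v k \in Lfun mu p) ->
  bochner_approx (fun x y => \sum_(k < J) f k x * v k y)
    (fun y => \sum_(k < J) charge_integral nu (f k) * v k y).
Proof.
move=> bf vp; elim: J => [|J ih].
  by apply: bochner_approx_eq bochner_approx0 => [x y|y]; rewrite big_ord0.
apply: bochner_approx_eq (bochner_approx_add _ _ _ _ ih (bochner_approx_rank1 (bf J) (vp J))).
- by move=> x y; rewrite big_ord_recr.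
- by move=> y; rewrite big_ord_recr.
- by move=> x; apply: Lfun_sum => // k; exact: Lfun_scaler.
- by move=> x; exact: Lfun_scaler.
- by apply: Lfun_sum => // k; exact: Lfun_scaler.
- exact: Lfun_scaler.
Qed.

(** The approximants within 1/(n+1) work: the integral of their distance to F is at most the total
    variation divided by n + 1. *)
Lemma bochner_approxP F h : h \in Lfun mu p -> bochner_approx F h -> is_bochner mu p nu F h.
Proof.
move=> hp aF; split => //.
have /choice[s hs] : forall n : nat, exists s,
    (forall x, (Ldist mu p (F x) (Lsimple_fun s x) <= (n.+1%:R^-1)%:E)%E) /\
    (Ldist mu p (Lsimple_integral nu s) h <= (n.+1%:R^-1)%:E)%E.
  by move=> n; apply: aF; rewrite invr_gt0.
have hc (c : R) : (c * n.+1%:R^-1)%:E @[n --> \oo] --> 0%E.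
  apply: cvg_EFin; first exact: nearW.
  rewrite -[X in _ --> X](mulr0 c); apply: cvgMr.
  exact: cvg_harmonic.
have h1 : (n.+1%:R^-1)%:E @[n --> \oo] --> (0%E : \bar R).
  by have := hc 1; under eq_fun do rewrite mul1r.
exists s; split.
- apply: aeW => x; apply: (squeeze_cvge _ (cvg_cst 0%E) h1).
  by apply: nearW => n; rewrite Lnorm_ge0/=; have [H _] := hs n; exact: H.
- have Vfin : variation_measure nu setT \is a fin_num by rewrite ge0_fin_numE// variation_lty.
  apply: (squeeze_cvge _ (cvg_cst 0%E) (hc (fine (variation_measure nu setT)))).
  apply: nearW => n; apply/andP; split; first by apply: integral_ge0 => x _; exact: Lnorm_ge0.
  apply: (@le_trans _ _ (\int[variation_measure nu]_x (n.+1%:R^-1)%:E)%E).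
    by apply: le_integral_ge0 => x; [exact: Lnorm_ge0|have [H _] := hs n; exact: H].
  by rewrite integral_cst// EFinM fineK// muleC.
apply: (squeeze_cvge _ (cvg_cst 0%E) h1).
by apply: nearW => n; rewrite Lnorm_ge0/=; have [_ H] := hs n.
Qed.

End bochner_theory.

(** * Pairing of L^p with L^p' and uniqueness of Bochner integrals *)

Section duality.
Context {R : realType} {d d' : measure_display}
  {T : measurableType d} {U : measurableType d'}.
Variables (mu : probability U R) (p : \bar R) (nu : {charge set T -> \bar R}).
Hypothesis p1 : (1 <= p)%E.
Local Notation p' := (hoelder_conjugate p).
Implicit Types (F : T -> U -> R) (g h : U -> R).

Local Notation "'N_ p [ f ]" := (Lnorm mu p (EFin \o f)).

Let p'1 : (1 <= p')%E. Proof. exact: hoelder_conj_ge1. Qed.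

Lemma pairing_integrable g h : g \in Lfun mu p -> h \in Lfun mu p' ->
  mu.-integrable setT (EFin \o (fun y => h y * g y)).
Proof.
move=> gp hp; have /mem_LfunP[mg gy] := gp; have /mem_LfunP[mh hy] := hp.
apply/integrableP; split; first by apply/measurable_EFinP; exact: measurable_funM.
have H : (\int[mu]_y (`|g y * h y|)%:E <= 'N_p[g] * 'N_p'[h])%E by exact: hoelder_fin.
apply: le_lt_trans (_ : _ <= 'N_p[g] * 'N_p'[h])%E _.
  by apply: le_trans H; under eq_integral do rewrite /= mulrC.
rewrite -[X in (X * _)%E]fineK ?ge0_fin_numE ?Lnorm_ge0//.
by rewrite lte_mul_pinfty ?lee_fin ?fine_ge0 ?Lnorm_ge0.
Qed.

Lemma pairing_bound g h : g \in Lfun mu p -> h \in Lfun mu p' ->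
  ((`|\int[mu]_y (h y * g y)|%R)%:E <= 'N_p[g] * 'N_p'[h])%E.
Proof.
move=> gp hp; have i := pairing_integrable gp hp.
rewrite /Rintegral -abse_EFin fineK; last exact: integrable_fin_num.
apply: le_trans (le_abse_integral mu measurableT (measurable_int mu i)) _.
apply: le_trans (_ : (\int[mu]_y (`|g y * h y|)%:E <= _)%E); last exact: hoelder_fin.
by under eq_integral do rewrite /= mulrC.
Qed.

Lemma pairingB g h h' : g \in Lfun mu p -> h \in Lfun mu p' -> h' \in Lfun mu p' ->
  (\int[mu]_y ((h y - h' y) * g y) = \int[mu]_y (h y * g y) - \int[mu]_y (h' y * g y))%R.
Proof.
move=> gp hp hp'; under eq_Rintegral do rewrite mulrBl.
by rewrite (RintegralB measurableT (pairing_integrable gp hp) (pairing_integrable gp hp')).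
Qed.

Lemma pairing_sum (I : Type) (r : seq I) (c : I -> R) (v : I -> U -> R) g :
  g \in Lfun mu p -> (forall i, v i \in Lfun mu p') ->
  (\int[mu]_y ((\sum_(i <- r) c i * v i y) * g y) =
   \sum_(i <- r) c i * \int[mu]_y (v i y * g y))%R.
Proof.
move=> gp vp; elim: r => [|i r ih].
  rewrite big_nil; under eq_Rintegral do rewrite big_nil mul0r.
  by rewrite /Rintegral integral0.
rewrite big_cons -ih -(RintegralZl _ measurableT (pairing_integrable gp (vp i))).
under eq_Rintegral do rewrite big_cons mulrDl -mulrA.
apply: (RintegralD measurableT).
  exact: (integrableZl measurableT (c i) (pairing_integrable gp (vp i))).
apply: pairing_integrable => //; apply: Lfun_sum => // j; exact: Lfun_scaler.
Qed.

Lemma Lsimple_pairing (s : Lsimple (T := T) mu p') g : g \in Lfun mu p ->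
  bounded_meas (fun x => \int[mu]_y (Lsimple_fun s x y * g y))%R /\
  (\int[mu]_y (Lsimple_integral nu s y * g y))%R =
    charge_integral nu (fun x => \int[mu]_y (Lsimple_fun s x y * g y))%R.
Proof.
move=> gp.
have E : (fun x => \int[mu]_y (Lsimple_fun s x y * g y))%R =
    fun x => \sum_i \1_(@Lsimple_set _ _ _ _ _ mu p' s i) x * (\int[mu]_y (Lsimple_val i y * g y))%R.
  apply/funext => x; rewrite (pairing_sum _ (fun i => \1_(Lsimple_set i) x) gp)//.
  by move=> i; exact: Lsimple_Lfun.
have b1 (i : 'I_(Lsimple_size s)) : bounded_meas (\1_(Lsimple_set i) : T -> R).
  split; first exact/measurable_indic/Lsimple_measurable.
  by exists 1 => x; rewrite indicE; case: (_ \in _); rewrite ?normr1 ?normr0.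
have b2 (c : 'I_(Lsimple_size s) -> R) i : bounded_meas (fun x => \1_(Lsimple_set i) x * c i).
  by under eq_fun do rewrite mulrC; exact: bounded_measZ.
split; first by rewrite E; apply: bounded_meas_sum => i; exact: (b2 (fun i => _)).
rewrite (pairing_sum _ (fun i => fine (nu (Lsimple_set i))) gp); last first.
  by move=> i; exact: Lsimple_Lfun.
rewrite E charge_integral_sum; last by move=> i; exact: (b2 (fun i => _)).
apply: eq_bigr => i _; set c := Rintegral _ _ _; under eq_fun do rewrite mulrC.
rewrite (charge_integralZ nu c (b1 i)) (charge_integral_indic nu (Lsimple_measurable i)).
exact: mulrC.
Qed.

Lemma cvg_real0 (u : nat -> \bar R) (c : R) (a : nat -> R) (l : R) : 0 < c ->
  u n @[n --> \oo] --> 0%E ->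
  (forall n, ((c * `|a n - l|)%:E <= u n)%E) -> a n @[n --> \oo] --> l.
Proof.
move=> c0 u0 ua; apply/cvgrPdist_lt => e e0.
have : (c * `|a n - l|)%:E @[n --> \oo] --> 0%E.
  apply: (squeeze_cvge _ (cvg_cst 0%E) u0); apply: nearW => n.
  by rewrite ua andbT lee_fin mulr_ge0// ltW.
move=> /fine_cvg /= /cvgrPdist_lt /(_ (c * e)); rewrite mulr_gt0// => /(_ isT).
apply: filterS => n; rewrite sub0r normrN normrM normr_id (gtr0_norm c0) distrC.
by rewrite ltr_pM2l.
Qed.

(* [x |-> Ldist (F x) (s x)] need not be measurable; only its lower integral,
   which dominates the integral of every smaller measurable function, is used. *)
Lemma bochner_pairing F h g : is_bochner mu p' nu F h -> (forall x, F x \in Lfun mu p') ->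
  g \in Lfun mu p -> bounded_meas (fun x => \int[mu]_y (F x y * g y))%R ->
  (\int[mu]_y (h y * g y))%R = charge_integral nu (fun x => \int[mu]_y (F x y * g y))%R.
Proof.
move=> [hp [s [_ s1 s2]]] Fp gp bF.
set B := (fun x => _) in bF *.
have /mem_LfunP[mg gy] := gp.
have gfin : 'N_p[g] \is a fin_num by rewrite ge0_fin_numE ?Lnorm_ge0.
have g0 : 0 <= fine 'N_p[g] by rewrite fine_ge0 ?Lnorm_ge0.
pose c := (fine 'N_p[g] + 1)^-1.
have c0 : 0 < c by rewrite invr_gt0 ltr_wpDl.
have cg (f : U -> R) : f \in Lfun mu p' ->
    ((c * `|\int[mu]_y (f y * g y)|%R)%:E <= 'N_p'[f])%E.
  move=> fp; have /mem_LfunP[_ fy] := fp.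
  have ffin : 'N_p'[f] \is a fin_num by rewrite ge0_fin_numE ?Lnorm_ge0.
  have := pairing_bound gp fp; rewrite -(fineK gfin) -(fineK ffin) -EFinM !lee_fin => H.
  rewrite mulrC ler_pdivrMr ?ltr_wpDl//; apply: le_trans H _.
  by rewrite mulrC ler_wpM2l ?fine_ge0 ?Lnorm_ge0// lerDl.
have I1 : (\int[mu]_y (Lsimple_integral nu (s n) y * g y))%R @[n --> \oo] -->
    (\int[mu]_y (h y * g y))%R.
  apply: (cvg_real0 c0 s2) => n; rewrite -pairingB//; last exact: Lsimple_integral_Lfun.
  by apply: cg; apply: Lfun_sub => //; exact: Lsimple_integral_Lfun.
have I2 : (\int[mu]_y (Lsimple_integral nu (s n) y * g y))%R @[n --> \oo] -->
    charge_integral nu B.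
  apply: (cvg_real0 c0 s1) => n; have [bs ->] := Lsimple_pairing (s n) gp.
  rewrite -charge_integralB//.
  have bsB : bounded_meas (fun x => (\int[mu]_y (Lsimple_fun (s n) x y * g y))%R - B x).
    have -> : (fun x => (\int[mu]_y (Lsimple_fun (s n) x y * g y))%R - B x) =
      (fun x => (\int[mu]_y (Lsimple_fun (s n) x y * g y))%R + (-1) * B x).
      by apply/funext => x; rewrite mulN1r.
    by apply: bounded_measD => //; exact: bounded_measZ.
  rewrite -[X in (X * _)%:E](gtr0_norm c0) -normrM -charge_integralZ//.
  apply: le_trans (le_charge_integral _ (bounded_measZ c bsB)) _.
  apply: le_integral_ge0 => x //; rewrite normrM (gtr0_norm c0) distrC /B.
  rewrite -pairingB//; last exact: Lsimple_fun_Lfun.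
  by apply: cg; apply: Lfun_sub => //; exact: Lsimple_fun_Lfun.
by rewrite -(cvg_lim (@Rhausdorff R) I1) (cvg_lim (@Rhausdorff R) I2).
Qed.

(** Pairing both integrals with g = sign(h - h') gives the same number, so h - h' has zero L^1 norm.
    Measurability is only asked of the pairings of F with bounded functions, not of F jointly. *)
Lemma bochner_unique F h h' : (forall x, F x \in Lfun mu p') ->
  (forall g, bounded_meas g -> bounded_meas (fun x => \int[mu]_y (F x y * g y))%R) ->
  is_bochner mu p' nu F h -> is_bochner mu p' nu F h' -> Ldist mu p' h h' = 0%E.
Proof.
move=> Fp bF bh bh'; have [hp _] := bh; have [hp' _] := bh'.
have /mem_LfunP[mD _] := Lfun_sub p'1 hp hp'.
pose g := sign (fun y => h y - h' y).
have bg : bounded_meas g by exact: bounded_meas_sign.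
have gp : g \in Lfun mu p.
  by have [mg [B hB]] := bg; exact: (Lfun_bounded mu p1 mg hB).
have := pairingB gp hp hp'; rewrite (bochner_pairing bh Fp gp (bF g bg)).
rewrite (bochner_pairing bh' Fp gp (bF g bg)) subrr.
under eq_Rintegral do rewrite mul_sign.
move=> H; have D1 := Lfun_Lfun1 p'1 (Lfun_sub p'1 hp hp').
have I0 : (\int[mu]_y `|(h y - h' y)%:E| = 0)%E.
  have i : mu.-integrable setT (fun y => `|(h y - h' y)%:E|%E).
    by apply: integrable_abse; exact/Lfun1_integrable.
  by rewrite -(fineK (integrable_fin_num measurableT i)); congr EFin.
have mDE : measurable_fun setT (fun y => (h y - h' y)%:E) by exact/measurable_EFinP.
have := (ae_eq_integral_abs mu measurableT mDE).1 I0.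
move=> ae0; rewrite /Ldist (eq_Lnorm_ae (g := fun=> 0) p'1 mD)//.
  apply/eqP; rewrite eq_le Lnorm_ge0 andbT.
  by apply: Lnorm_bounded => // y; rewrite normr0.
by apply: filterS ae0 => y /(_ Logic.I) [].
Qed.

End duality.

(** * The kernel as a potential, and its integral against a measure *)

Section kernel_potential.
Context {R : realType} (Xi : system R) (q : R) (Xi_dd : data_defined Xi q).
Variable S : nat.
Hypothesis qS : q < S%:R.
Variables (p : \bar R) (beta : R) (b : R -> R) (G : borel Xi -> borel Xi -> R).
Hypotheses (p1 : (1 <= p)%E) (beta_gt0 : 0 < beta) (q_beta : (q%:E / p < beta%:E)%E).
Hypothesis kb : kernel_mask S beta b.
Local Notation p' := (hoelder_conjugate p).
Hypothesis kG : forall x, Xspace p' (G x) /\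
  forall k, coef (G x) k = b (lam Xi k) * phi k x.
Implicit Types (f g : borel Xi -> R).

Local Notation mu := (mustar Xi).
Local Notation "'N_ p [ f ]" := (Lnorm mu p (EFin \o f)).
Local Notation rate := (rate q p beta).
Local Notation lowpot := (lowpot Xi_dd S b).

Let p'1 : (1 <= p')%E. Proof. exact: hoelder_conj_ge1. Qed.

(** G(x, .) is almost everywhere the potential of the unit mass at x, so the estimates for
    potentials apply to G, uniformly in x. *)
Definition point_mass (x : borel Xi) : signed_measure Xi R :=
  charge_of_finite_measure (@dirac _ (borel Xi) x R).

Lemma charge_integral_point x f : measurable_fun setT f ->
  charge_integral (point_mass x) f = f x.
Proof.
move=> mf; rewrite /point_mass charge_integral_measure /Rintegral integral_dirac//.
  by rewrite diracT mul1e.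
exact/measurable_EFinP.
Qed.

Lemma regular_point x : regular_at q 0 (point_mass x) 1 1.
Proof.
have dA A : measurable A -> variation_measure (point_mass x) A = @dirac _ (borel Xi) x R A.
  exact: variation_of_measure.
split => //; last by rewrite dA// diracT.
move=> z; rewrite expr0 invr1 powR1 mulr1 dA; last exact: measurable_cball Xi_dd z 1.
by rewrite diracE lee_fin; case: (_ \in _).
Qed.

Lemma approx_point m x y : lowpot m (point_mass x) y =
  \sum_(k < dimPi Xi_dd m) (lowpass S m (lam Xi k) * b (lam Xi k) * phi k x) * phi k y.
Proof.
apply: eq_bigr => k _; rewrite charge_integral_point//.
exact: measurable_phi Xi_dd k.
Qed.

(** G(x, .) and the potential of the unit mass both lie in X^p' and have the same coefficients, so
    they agree by [Xspace_eq0]; unit masses are regular at scale 1 with constants independent of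
    x. *)
Lemma kernel_approx : exists K : R, forall x m,
  ('N_p'[(fun y => G x y - lowpot m (point_mass x) y)%R] <= (K * rate ^+ m)%:E)%E.
Proof.
have [C C0 pot] := potential Xi_dd qS p1 q_beta kb.
exists (C * (1 + 1) * (2 ^+ 0) `^ (- beta) * rate) => x m.
have [h [hX hc hb]] := pot (point_mass x).
have [GX Gc] := kG x.
have hG : 'N_p'[(fun y => G x y - h y)%R] = 0%E.
  apply: (Xspace_eq0 Xi_dd qS p'1 (XspaceB Xi_dd p'1 GX hX)) => k.
  rewrite (coef_diff Xi_dd k (Lfun_Lfun1 p'1 GX.1) (Lfun_Lfun1 p'1 hX.1)) Gc hc.
  by rewrite charge_integral_point ?subrr//; exact: measurable_phi Xi_dd k.
have ap := approx_Lfun Xi_dd S b m (point_mass x) p'1.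
apply: le_trans (Ldist_triangle p'1 GX.1 hX.1 ap) _.
rewrite /Ldist hG add0e; apply: le_trans (hb 0%N m 1 1 (regular_point x) (leq0n _)) _.
by rewrite subn0 exprS mulrA.
Qed.

(** The pairing is a uniform limit of finite combinations of the phi_k. This supplies the
    measurability in x that no joint measurability of G provides. *)
Lemma bounded_meas_pairing g : g \in Lfun mu p ->
  bounded_meas (fun x => \int[mu]_y (G x y * g y))%R.
Proof.
move=> gp; have [K hK] := kernel_approx.
have /mem_LfunP[mg gy] := gp.
have gfin : 'N_p[g] \is a fin_num by rewrite ge0_fin_numE ?Lnorm_ge0.
pose a m x := (\int[mu]_y (lowpot m (point_mass x) y * g y))%R.
have ba m : bounded_meas (a m).
  have -> : a m = fun x => \sum_(k < dimPi Xi_dd m)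
      (lowpass S m (lam Xi k) * b (lam Xi k) * \int[mu]_y (phi k y * g y))%R * phi k x.
    apply/funext => x; rewrite /a; under eq_Rintegral do rewrite approx_point.
    have := @pairing_sum _ _ _ mu p p1 'I_(dimPi Xi_dd m) (index_enum _)
      (fun k => lowpass S m (lam Xi k) * b (lam Xi k) * phi k x) (fun k => phi k) g gp
      (fun k => phi_Lfun Xi_dd k p'1) => ->.
    by apply: eq_bigr => k _; rewrite mulrAC.
  by apply: bounded_meas_sum => k; apply: bounded_measZ; exact: bounded_meas_phi Xi_dd k.
have close m x : `|(\int[mu]_y (G x y * g y))%R - a m x| <= fine 'N_p[g] * K * rate ^+ m.
  have Gp := (kG x).1.1; have ap := approx_Lfun Xi_dd S b m (point_mass x) p'1.
  rewrite -(pairingB p1 gp Gp ap) -lee_fin.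
  apply: le_trans (pairing_bound p1 gp (Lfun_sub p'1 Gp ap)) _.
  apply: le_trans (lee_wpmul2l (Lnorm_ge0 _ _ _) (hK x m)) _.
  by rewrite -{1}(fineK gfin) -EFinM mulrA.
have K0 : 0 <= fine 'N_p[g] * K.
  by have := close 0%N point; rewrite mulr1; apply: le_trans.
split.
  apply: (@measurable_fun_cvg _ _ _ setT a) => [m|x _]; first by case: (ba m).
  have ur : (fine 'N_p[g] * K * rate ^+ n)%:E @[n --> \oo] --> 0%E.
    apply: cvg_EFin; first exact: nearW.
    have /andP[r0 r1] := rate01 p1 q_beta.
    rewrite -[X in _ --> X](mulr0 (fine 'N_p[g] * K)); apply: cvgMr.
    by apply: cvg_expr; rewrite ger0_norm.
  apply: (cvg_real0 ltr01 ur) => n.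
  by rewrite mul1r distrC lee_fin.
have [_ [A hA]] := ba 0%N; exists (A + fine 'N_p[g] * K) => x.
rewrite -[X in `|X|](subrK (a 0%N x)) addrC; apply: le_trans (ler_normD _ _) _.
by apply: lerD => //; have := close 0%N x; rewrite mulr1.
Qed.

(** G is a uniform limit of finite-rank kernels, whose integrals are the low-pass potentials of nu;
    hence the potential h of nu is a Bochner integral of G. By uniqueness, the representative picked
    by [bochner] has the same coefficients and estimates. *)
Lemma bochner_potential : exists2 C : R, 0 < C & forall nu,
  [/\ bochner mu p' nu G \in Lfun mu p',
    forall k, coef (bochner mu p' nu G) k = b (lam Xi k) * charge_integral nu (phi k) &
    forall m0 m D T, regular_at q m0 nu D T -> (m0 <= m.+1)%N ->
      ('N_p'[(fun y => bochner mu p' nu G y - lowpot m nu y)%R] <=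
        (C * (D + T) * (2 ^+ m0) `^ (- beta) * rate ^+ (m.+1 - m0))%:E)%E].
Proof.
have [C C0 pot] := potential Xi_dd qS p1 q_beta kb.
have [K hK] := kernel_approx.
exists C => // nu; have [h [hX hc hb]] := pot nu.
have rc := regular_crude Xi_dd nu.
set V := fine _ in rc.
have Gp x : G x \in Lfun mu p' := (kG x).1.1.
have bh : is_bochner mu p' nu G h.
  apply: (bochner_approxP hX.1); apply: (bochner_approx_lim p'1 Gp hX.1) => e e0.
  have [n1 _ h1] := @expr_small R rate K e (rate01 p1 q_beta) e0.
  have [n2 _ h2] := @expr_small R rate (C * (V + V) * (2 ^+ 0) `^ (- beta)) e (rate01 p1 q_beta) e0.
  pose n := maxn n1 n2.
  exists (fun x => lowpot n (point_mass x)), (lowpot n nu); split.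
  - by move=> x; exact: approx_Lfun.
  - exact: approx_Lfun.
  - have bk k : bounded_meas (fun x : borel Xi => lowpass S n (lam Xi k) * b (lam Xi k) * phi k x).
      by apply: bounded_measZ; exact: bounded_meas_phi Xi_dd k.
    have := bochner_approx_sum nu p'1 (dimPi Xi_dd n) bk (fun k => phi_Lfun Xi_dd k p'1).
    apply: bochner_approx_eq => [x y|y]; first by rewrite approx_point.
    apply: eq_bigr => k _; rewrite charge_integralZ//; exact: bounded_meas_phi Xi_dd k.
  - move=> x; apply: le_trans (hK x n) _; rewrite lee_fin; apply/ltW/h1 => /=.
    exact: leq_maxl.
  rewrite /Ldist Lnorm_distC; apply: le_trans (hb 0%N n V V rc (leq0n _)) _.
  rewrite lee_fin subn0; apply/ltW/h2 => /=.
  by rewrite (leq_trans (leq_maxr n1 n2)).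
have bb : is_bochner mu p' nu G (bochner mu p' nu G).
  exact: (@xgetPex _ (fun=> 0) [set h | is_bochner mu p' nu G h] (ex_intro _ h bh)).
have [Bp _] := bb.
have d0 : Ldist mu p' (bochner mu p' nu G) h = 0%E.
  apply: (bochner_unique p1 Gp _ bb bh) => g [mg [B hB]].
  exact: bounded_meas_pairing (Lfun_bounded mu p1 mg hB).
split => //.
- move=> k; rewrite -hc; apply/eqP; rewrite -subr_eq0 -normr_le0 -lee_fin.
  rewrite -(coef_diff Xi_dd k (Lfun_Lfun1 p'1 Bp) (Lfun_Lfun1 p'1 hX.1)).
  have [B B0 cB] := coef_bound Xi_dd k.
  apply: le_trans (cB _ _ p'1 (Lfun_sub p'1 Bp hX.1)) _.
  by rewrite -/(Ldist _ _ _ _) d0 mule0.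
move=> m0 m D T reg m0m.
have ap := approx_Lfun Xi_dd S b m nu p'1.
apply: le_trans (Ldist_triangle p'1 Bp hX.1 ap) _.
by rewrite d0 add0e; exact: hb.
Qed.

End kernel_potential.

(** * Inequality of Bernstein type for the inverse mask *)

Lemma powRD_gt0 (R : realType) (x a c : R) : 0 < x -> x `^ (a + c) = x `^ a * x `^ c.
Proof. by move=> x0; rewrite powRD// (gt_eqF x0) implybT. Qed.

Section bernstein.
Context {R : realType} (Xi : system R) (q : R) (Xi_dd : data_defined Xi q).
Variable S : nat.
Hypothesis qS : q < S%:R.
Variables (p : \bar R) (beta gamma r : R) (b : R -> R).
Hypotheses (p1 : (1 <= p)%E) (beta_gt0 : 0 < beta).
Hypothesis kb : kernel_mask S beta b.
Hypothesis gamma_beta : gamma < beta.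
Implicit Types (f g P : borel Xi -> R).

Local Notation mu := (mustar Xi).
Local Notation "'N_ p [ f ]" := (Lnorm mu p (EFin \o f)).

Lemma omega_ge0 f (d : R) : (0 <= omega r p f d)%E.
Proof.
apply: le_ereal_inf_tmp => _ [f1 [g [_ ->]]].
by rewrite adde_ge0 ?Lnorm_ge0// mule_ge0 ?Lnorm_ge0// lee_fin powR_ge0.
Qed.

Lemma omega_le_normH f (d : R) : 0 < d <= 1 ->
  (omega r p f d <= (d `^ gamma)%:E * normH r gamma p f)%E.
Proof.
move=> d01; have /andP[d0 _] := d01.
have -> : (omega r p f d = (d `^ gamma)%:E * ((d `^ (- gamma))%:E * omega r p f d))%E.
  by rewrite muleA -EFinM -powRD_gt0// subrr powRr0 mul1e.
apply: lee_wpmul2l; first by rewrite lee_fin powR_ge0.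
rewrite /normH -[leLHS]add0e; apply: leeD; first exact: Lnorm_ge0.
by apply: ereal_sup_ubound; exists d.
Qed.

Lemma normH_ge0 f : (0 <= normH r gamma p f)%E.
Proof.
rewrite adde_ge0 ?Lnorm_ge0//.
apply: (@le_trans _ _ ((1 `^ (- gamma))%:E * omega r p f 1)%E).
  by rewrite mule_ge0 ?omega_ge0// lee_fin powR_ge0.
by apply: ereal_sup_ubound; exists 1 => //=; rewrite ltr01 lexx.
Qed.

Lemma le_mule_ereal_inf (c : R) (x : \bar R) (A : set (\bar R)) : 0 < c ->
  (forall z, A z -> (x <= c%:E * z)%E) -> (x <= c%:E * ereal_inf A)%E.
Proof.
move=> c0 H.
have ci (z : \bar R) : (z = c%:E * (c^-1%:E * z))%E.
  by rewrite muleA -EFinM mulfV ?gt_eqF// mul1e.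
rewrite [leLHS]ci; apply: lee_wpmul2l; first by rewrite lee_fin ltW.
apply: le_ereal_inf_tmp => z /H xz.
have -> : z = (c^-1%:E * (c%:E * z))%E by rewrite muleA -EFinM mulVf ?gt_eqF// mul1e.
by apply: lee_wpmul2l => //; rewrite lee_fin invr_ge0 ltW.
Qed.

(** For each competitor f1 with r-th derivative g, the band of P divided by b is that of P - f1 plus
    a multiplier of g. With X = 2^(m+1) these have sizes X^beta and X^(beta - r), so the infimum
    over f1 is X^beta times the K-functional at 1/X. *)
Lemma band_piece : exists2 C : R, 0 < C & forall m P, P \in Lfun mu p ->
  ('N_p[(multop (dimPi Xi_dd m.+1) (fun k => band S m (lam Xi k) / b (lam Xi k)) P)%R]
    <= (C * (2 ^+ m.+1) `^ beta)%:E * omega r p P ((2 ^+ m.+1)^-1)%R)%E.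
Proof.
have [C C0 mb] := multop_bound Xi_dd qS.
have [M1 M10 k1] := inv_mask_kmask Xi_dd kb 0.
have [M2 M20 k2] := inv_mask_kmask Xi_dd kb r.
exists (C * (M1 + M2)); first by rewrite mulr_gt0// addr_gt0.
move=> m P Pp; set X : R := 2 ^+ m.+1.
have X0 : 0 < X by rewrite exprn_gt0.
have Xb0 : 0 < X `^ beta by rewrite powR_gt0.
apply: le_mule_ereal_inf; first by rewrite !mulr_gt0// addr_gt0.
move=> _ [f1 [g [[[f1p _] [gp _] gE] ->]]].
pose J := dimPi Xi_dd m.+1.
pose g1 k := band S m (lam Xi k) * ((b (lam Xi k))^-1 * (1 + lam Xi k) `^ (- 0)).
pose g2 k := band S m (lam Xi k) * ((b (lam Xi k))^-1 * (1 + lam Xi k) `^ (- r)).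
have E : multop J (fun k => band S m (lam Xi k) / b (lam Xi k)) P =
    fun y => multop J g1 (fun z => P z - f1 z) y + multop J g2 g y.
  apply/funext => y; rewrite /multop -big_split; apply: eq_bigr => k _ /=.
  rewrite -mulrDl; congr (_ * _).
  rewrite (coef_diff Xi_dd k (Lfun_Lfun1 p1 Pp) (Lfun_Lfun1 p1 f1p)) gE /g1 /g2.
  rewrite oppr0 powRr0 mulr1 (addrC (lam Xi k)).
  have l1 : (1 + lam Xi k) `^ (- r) * (1 + lam Xi k) `^ r = 1.
    by rewrite -powRD_gt0 ?addNr ?powRr0// ltr_wpDr ?(lam_ge0 Xi_dd).
  have ring1 (B I a c P' F : R) : a * c = 1 ->
    B * I * P' = B * I * (P' - F) + B * (I * a) * (c * F).
    by move=> ac; transitivity (B * I * (P' - F) + B * I * (a * c) * F); [rewrite ac|]; ring.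
  exact: ring1.
rewrite E; have P1 := Lfun_sub p1 Pp f1p.
have mo J' (g' : nat -> R) f' : measurable_fun setT (multop J' g' f').
  by case: (bounded_meas_multop Xi_dd J' g' f').
apply: le_trans (Lnorm_add mu p1 (mo _ _ _) (mo _ _ _)) _.
apply: le_trans (leeD (mb _ _ _ _ _ _ p1 (k1 m) P1) (mb _ _ _ _ _ _ p1 (k2 m) gp)) _.
rewrite /normp ge0_muleDr ?Lnorm_ge0 ?mule_ge0 ?Lnorm_ge0 ?lee_fin ?powR_ge0//.
rewrite -/X subr0 muleA -EFinM; apply: leeD; apply: lee_wpmul2r; rewrite ?Lnorm_ge0// lee_fin.
  rewrite mulrA ler_wpM2r ?(ltW Xb0)// ler_wpM2l ?(ltW C0)//.
  by rewrite lerDl ltW.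
have -> : (X^-1) `^ r = X `^ (- r).
  by rewrite -(powR_inv1 (ltW X0)) -powRrM mulN1r.
rewrite -[leRHS]mulrA -powRD_gt0// mulrA ler_wpM2r ?powR_ge0//.
by rewrite ler_wpM2l ?(ltW C0)// lerDr ltW.
Qed.

(** A crude bound whose constant depends on J and g; it serves only for the fixed piece of
    frequencies below 1. *)
Lemma low_piece J (g : nat -> R) : exists2 C : R, 0 <= C & forall P, P \in Lfun mu p ->
  ('N_p[multop J g P] <= C%:E * 'N_p[P])%E.
Proof.
have /choice[B hB] : forall k, exists B : R, 0 <= B /\ forall f, f \in Lfun mu p ->
    ((`|coef f k|)%:E <= B%:E * 'N_p[f])%E.
  move=> k; have [B B0 hB] := coef_bound Xi_dd k; exists B; split => // f fp.
  exact: hB.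
have /choice[A hA] := dd_phi_bounded Xi_dd.
exists (\sum_(k < J) `|g k| * B k * `|A k|).
  apply: sumr_ge0 => k _; rewrite !mulr_ge0//; by have [] := hB k.
move=> P Pp; have /mem_LfunP[mP Py] := Pp.
have Pfin : 'N_p[P] \is a fin_num by rewrite ge0_fin_numE ?Lnorm_ge0.
have P0 : 0 <= fine 'N_p[P] by rewrite fine_ge0 ?Lnorm_ge0.
have S0 : 0 <= \sum_(k < J) `|g k| * B k * `|A k|.
  by apply: sumr_ge0 => k _; rewrite !mulr_ge0//; have [] := hB k.
rewrite -(fineK Pfin) -EFinM; apply: Lnorm_bounded => //.
- by case: (bounded_meas_multop Xi_dd J g P).
- exact: mulr_ge0.
move=> y; apply: le_trans (ler_norm_sum _ _ _) _; rewrite mulr_suml; apply: ler_sum => k _.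
have [B0 /(_ P Pp)] := hB k; rewrite -(fineK Pfin) -EFinM lee_fin => cP.
rewrite !normrM -!mulrA ler_wpM2l// (mulrC `|A k|) mulrA.
by apply: ler_pM => //; apply: le_trans (hA k y) (ler_norm _).
Qed.

Lemma geometric_growth (t : R) M : 1 < t ->
  \sum_(i < M) t ^+ i.+1 <= t / (t - 1) * t ^+ M.
Proof.
move=> t1; have t0 : 0 < t - 1 by rewrite subr_gt0.
have tt : 0 < t by exact: lt_trans t1.
under eq_bigr do rewrite exprS.
rewrite -mulr_sumr -mulrA ler_wpM2l ?(ltW tt)// mulrC ler_pdivlMr// mulrC -subrX1.
by rewrite gerBl.
Qed.

(** Split P into its lowest piece and the bands up to 2^n. As the K-functional at d is at most
    d^gamma times the smoothness norm, the band at 2^(i+1) contributes 2^((i+1)(beta - gamma)), and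
    since gamma < beta the last band dominates the sum. *)
Lemma bernstein : exists2 C : R, 0 < C & forall (n : R) P m, 0 < n -> Pi (2 `^ n) P ->
  (forall k, (m <= k)%N -> coef P k = 0) ->
  ('N_p[(fun y => \sum_(k < m) coef P k / b (lam Xi k) * phi k y)%R] <=
    (C * 2 `^ (n * (beta - gamma)))%:E * normH r gamma p P)%E.
Proof.
have [C1 C10 lowp] := low_piece (dimPi Xi_dd 0) (fun k => lowpass S 0 (lam Xi k) / b (lam Xi k)).
have [C2 C20 bp] := band_piece.
pose t : R := 2 `^ (beta - gamma).
have bg : 0 < beta - gamma by rewrite subr_gt0.
have t1 : 1 < t.
  have := @powR2_lt1 R (- (beta - gamma)); rewrite oppr_lt0 => /(_ bg).
  by rewrite powRN invf_lt1// powR_gt0.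
have t0 : 0 < t by exact: lt_trans t1.
have tt : 0 < t / (t - 1) by rewrite divr_gt0// subr_gt0.
exists (C1 + C2 * (t / (t - 1) * t ^+ 2)).
  by rewrite ltr_wpDl// !mulr_gt0 ?exprn_gt0 ?invr_gt0 ?subr_gt0//.
move=> n P m n0 HP Pm.
have Pp := Pi_Lfun Xi_dd p1 HP.
have [m' [_ PN _]] := (PiP Xi_dd _ _).1 HP.
have H0 := normH_ge0 P.
have c_gt0 : 0 < (C1 + C2 * (t / (t - 1) * t ^+ 2)) * 2 `^ (n * (beta - gamma)).
  by rewrite mulr_gt0 ?powR_gt0// ltr_wpDl// !mulr_gt0 ?exprn_gt0 ?invr_gt0 ?subr_gt0//.
have [->|Hy] := eqVneq (normH r gamma p P) +oo%E.
  by rewrite gt0_muley ?leey// lte_fin.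
have Hfin : normH r gamma p P \is a fin_num by rewrite ge0_fin_numE// ltey.
set h := fine (normH r gamma p P).
have hE : normH r gamma p P = h%:E by rewrite /h fineK.
have h0 : 0 <= h by rewrite fine_ge0.
(* Since 2^M >= 2 * 2^n, the filter [lowpass M] equals 1 at every frequency of P. *)
pose m0 := Num.truncn n; pose M := m0.+2.
pose gb i k := band S i (lam Xi k) / b (lam Xi k).
pose gl k := lowpass S 0 (lam Xi k) / b (lam Xi k).
have E : (fun y => \sum_(k < m) coef P k / b (lam Xi k) * phi k y) =
    fun y => multop (dimPi Xi_dd 0) gl P y + \sum_(i < M) multop (dimPi Xi_dd i.+1) (gb i) P y.
  apply/funext => y.
  have tr J (g : nat -> R) : (forall k, (J <= k)%N -> g k = 0) ->
      multop J g P y = \sum_(k < m) g k * coef P k * phi k y.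
    move=> gJ; apply: (@sum_trunc _ (fun k => g k * coef P k * phi k y)) => k.
      by move=> /gJ ->; rewrite !mul0r.
    by move=> /Pm ->; rewrite mulr0 mul0r.
  rewrite tr; last by move=> k /dimPiP kJ; rewrite /gl lowpass_eq0 ?mul0r.
  have trb (i : 'I_M) : multop (dimPi Xi_dd i.+1) (gb i) P y =
      \sum_(k < m) gb i k * coef P k * phi k y.
    by apply: tr => k /dimPiP kJ; rewrite /gb band_eq0 ?mul0r.
  under [X in _ = _ + X]eq_bigr do rewrite trb.
  rewrite exchange_big -big_split; apply: eq_bigr => k _ /=.
  have [/PN ->|kn] := leP (2 `^ n) (lam Xi k).
    by rewrite mul0r mulr0 !mul0r add0r big1// => i _; rewrite mulr0 mul0r.
  rewrite -mulr_suml -mulrDl; congr (_ * _).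
  rewrite -mulr_suml -mulrDl /gl /gb -mulr_suml -mulrDl.
  have lE := @sum_band R S 0 M (lam Xi k) (leq0n _).
  rewrite big_mkord in lE; rewrite -lE lowpass_eq1 ?mul1r ?(mulrC (coef P k))//.
    exact: lam_ge0 Xi_dd k.
  rewrite /M exprS ler_wpM2l//; apply: le_trans (ltW kn) _.
  rewrite -powR_mulrn// ler_powR ?ler1n//; apply: ltW; exact: truncnS_gt.
have mo J' (g' : nat -> R) f' : measurable_fun setT (multop J' g' f').
  by case: (bounded_meas_multop Xi_dd J' g' f').
rewrite E; apply: le_trans (Lnorm_add mu p1 (mo _ _ _) _) _.
  by have [] := bounded_meas_sum (index_enum 'I_M) xpredT
    (fun i : 'I_M => bounded_meas_multop Xi_dd (dimPi Xi_dd i.+1) (gb i) P).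
apply: le_trans (leeD (lowp P Pp) (Lnorm_sum mu _ _ p1 (fun i : 'I_M => mo _ _ _))) _.
apply: (@le_trans _ _ (C1%:E * h%:E + \sum_(i < M) (C2 * t ^+ i.+1 * h)%:E)%E).
  apply: leeD.
    apply: lee_wpmul2l; first by rewrite lee_fin.
    rewrite -hE /normH -[leLHS]adde0; apply: leeD => //.
    apply: (@le_trans _ _ ((1 `^ (- gamma))%:E * omega r p P 1)%E).
      by rewrite mule_ge0 ?omega_ge0// lee_fin powR_ge0.
    by apply: ereal_sup_ubound; exists 1 => //=; rewrite ltr01 lexx.
  apply: lee_sum => i _; apply: le_trans (bp i P Pp) _.
  have X0 : 0 < (2 ^+ i.+1 : R) by rewrite exprn_gt0.
  have d01 : 0 < (2 ^+ i.+1 : R)^-1 <= 1.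
    by rewrite invr_gt0 X0/= invf_le1// exprn_ege1// ler1n.
  apply: le_trans (lee_wpmul2l _ (omega_le_normH P d01)) _.
    by rewrite lee_fin mulr_ge0 ?(ltW C20)// powR_ge0.
  rewrite hE -!EFinM lee_fin mulrA ler_wpM2r// -mulrA ler_wpM2l ?(ltW C20)//.
  rewrite -(powR_inv1 (ltW X0)) -powRrM mulN1r -powRD_gt0//.
  by rewrite powR_exp2.
rewrite sumEFin hE -!EFinM -EFinD lee_fin -mulr_suml -mulrDl ler_wpM2r//.
rewrite -mulr_sumr [leRHS]mulrDl; apply: lerD.
  by rewrite ler_peMr// -[leLHS](powRr0 2) ler_powR ?ler1n// mulr_ge0// ltW.
rewrite -mulrA ler_wpM2l ?(ltW C20)//; apply: le_trans (geometric_growth M t1) _.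
rewrite -[leRHS]mulrA ler_wpM2l ?(ltW tt)// /M -addn2 exprD mulrC ler_wpM2l ?exprn_ge0 ?(ltW t0)//.
rewrite /t -powR_mulrn ?powR_ge0// -powRrM ler_powR ?ler1n// mulrC ler_wpM2r ?(ltW bg)//.
by have /andP[] := truncn_itv (ltW n0).
Qed.

End bernstein.

(** * Quadrature measures, the error functional, and the conclusion *)

Section assembly.
Context {R : realType} (Xi : system R) (q : R) (Xi_dd : data_defined Xi q).
Variable S : nat.
Hypothesis qS : q < S%:R.
Variables (p : \bar R) (beta : R) (b : R -> R) (G : borel Xi -> borel Xi -> R).
Hypotheses (p1 : (1 <= p)%E) (beta_gt0 : 0 < beta) (q_beta : (q%:E / p < beta%:E)%E).
Hypothesis kb : kernel_mask S beta b.
Local Notation p' := (hoelder_conjugate p).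
Hypothesis kG : forall x, Xspace p' (G x) /\
  forall k, coef (G x) k = b (lam Xi k) * phi k x.

Local Notation mu := (mustar Xi).
Local Notation cmu := (charge_of_finite_measure mu).
Local Notation "'N_ p [ f ]" := (Lnorm mu p (EFin \o f)).

Let p'1 : (1 <= p')%E. Proof. exact: hoelder_conj_ge1. Qed.

Lemma pow2_truncn (n : R) : 0 <= n ->
  (2 ^+ Num.truncn n : R) <= 2 `^ n /\ 2 `^ n <= 2 ^+ (Num.truncn n).+1.
Proof.
move=> n0; have /andP[t1 t2] := truncn_itv n0.
by rewrite -!powR_mulrn// !ler_powR ?ler1n// ltW.
Qed.

(** The factor 2 leaves room to choose a witness, as the infimum need not be known to be attained;
    2^q pays for rounding the real scale 2^-n down to the dyadic one. *)
Lemma regnorm_regular (n C1 C2 : R) (nu : signed_measure Xi R) : 0 < n -> 0 < C1 -> 0 < C2 ->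
  (variation_measure nu setT <= C1%:E)%E -> (regnorm q (2 `^ (- n)) nu <= C2%:E)%E ->
  regular_at q (Num.truncn n).+1 nu (C2 * 2 * 2 `^ q) C1.
Proof.
move=> n0 C10 C20 nuC1 nuC2; have q0 := q_gt0 Xi_dd.
have [t1 t2] := pow2_truncn (ltW n0).
split=> //; rewrite ?mulr_ge0 ?powR_ge0 ?ltW//.
have : (regnorm q (2 `^ (- n)) nu < (C2 * 2)%:E)%E.
  by apply: le_lt_trans nuC2 _; rewrite lte_fin ltr_pMr// ltr1n.
move=> /ereal_inf_lt[_ [C hC <-]]; rewrite lte_fin => CC2 x.
have p0 : 0 < (2 ^+ (Num.truncn n).+1 : R) by rewrite exprn_gt0.
have h1 : (2 ^+ (Num.truncn n).+1 : R)^-1 <= 2 `^ (- n).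
  by rewrite powRN lef_pV2 ?posrE ?powR_gt0.
apply: le_trans (le_cball Xi_dd (variation_measure nu) x h1) _.
apply: le_trans (hC x) _; rewrite lee_fin.
apply: (@le_trans _ _ (C2 * 2 * (2 `^ (- n)) `^ q)).
  by rewrite ler_wpM2r ?powR_ge0// ltW.
rewrite -[leRHS]mulrA ler_wpM2l ?mulr_ge0 ?(ltW C20)//.
rewrite -powRM ?invr_ge0 ?exprn_ge0//.
apply: ge0_ler_powR; rewrite ?nnegrE ?powR_ge0 ?(ltW q0)//.
rewrite exprS invfM mulrA mulfV ?mul1r ?gt_eqF// powRN lef_pV2 ?posrE ?powR_gt0//.
Qed.

Lemma regular_mustar : exists2 D : R, 0 <= D & forall m0, regular_at q m0 cmu D 1.
Proof.
have [k2 k20 hk] := dd_ball_measure Xi_dd.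
exists k2; first exact: ltW.
move=> m0; split => //; first exact: ltW.
  move=> x; rewrite variation_of_measure; last exact: measurable_cball Xi_dd _ _.
  by apply: hk; rewrite invr_gt0 exprn_gt0.
by rewrite variation_of_measure// -(@probability_setT _ _ _ mu).
Qed.

Lemma Pi_phi k (N : R) : lam Xi k < N -> Pi N (phi k : borel Xi -> R).
Proof.
move=> kN; exists k.+1, (fun j => (j == k)%:R); apply/funext => z.
rewrite (bigD1 ord_max)//= eqxx mul1r big1 ?addr0// => j /andP[_ jk].
by rewrite (_ : (j == k :> nat) = false) ?mul0r//; apply: contraNF jk => /eqP jk; apply/eqP/val_inj.
Qed.

(** With m the integer part of n, a measure exact on Pi_(2^n) has the same low-pass potential at
    level m as mu. The two remainders are each of order 2^(-(m+1) beta), with both measures regular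
    at scale 2^-(m+1). *)
Lemma Mp_quadrature (C1 C2 : R) : 0 < C1 -> 0 < C2 -> exists2 C : R, 0 < C &
  forall (n : R) nu, 0 < n -> (variation_measure nu setT <= C1%:E)%E ->
    (regnorm q (2 `^ (- n)) nu <= C2%:E)%E -> quadrature_measure (2 `^ n) nu ->
    (Mp p G nu <= (C * (2 `^ n) `^ (- beta))%:E)%E.
Proof.
move=> C10 C20.
have [C C0 bp] := bochner_potential Xi_dd qS p1 q_beta kb kG.
have [D D0 rm] := regular_mustar.
pose D1 := C2 * 2 * 2 `^ q.
have D10 : 0 < D1 by rewrite !mulr_gt0// powR_gt0.
exists (C * (D1 + C1 + (D + 1))).
  by apply: mulr_gt0 => //; apply: addr_gt0; [exact: addr_gt0|exact: ltr_wpDl].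
move=> n nu n0 nuC1 nuC2 quad.
have [t1 t2] := pow2_truncn (ltW n0).
have reg := regnorm_regular n0 C10 C20 nuC1 nuC2.
set m := Num.truncn n in t1 t2 reg.
have [Bn _ /(_ m.+1 m _ _ reg (leqnn _))] := bp nu; rewrite subnn mulr1 => hn.
have [Bm _ /(_ m.+1 m _ _ (rm _) (leqnn _))] := bp cmu; rewrite subnn mulr1 => hm.
(* The filter kills frequencies from 2^m on, and phi_k with lam_k < 2^m <= 2^n is integrated
   exactly. *)
have eqlow : lowpot Xi_dd S b m nu = lowpot Xi_dd S b m cmu.
  apply/funext => y; apply: eq_bigr => k _.
  have [/lowpass_eq0 ->|kn] := leP (2 ^+ m) (lam Xi k); first by rewrite !mul0r.
  by rewrite (quad _ (Pi_phi (lt_le_trans kn t1))) charge_integral_measure.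
have ap := approx_Lfun Xi_dd S b m nu p'1.
rewrite /Mp; apply: le_trans (Ldist_triangle p'1 Bn ap Bm) _.
rewrite {2}eqlow {2}/Ldist Lnorm_distC.
apply: le_trans (leeD hn hm) _; rewrite -EFinD lee_fin -mulrDl -mulrDr.
rewrite ler_wpM2l//; first by rewrite mulr_ge0 ?(ltW C0)// !addr_ge0// ltW.
by rewrite !powRN lef_pV2 ?posrE ?powR_gt0// ?exprn_gt0//;
  apply: ge0_ler_powR; rewrite ?nnegrE ?powR_ge0 ?exprn_ge0 ?(ltW beta_gt0).
Qed.

(** Pair the difference of the two potentials with [Dp], the polynomial P divided by the mask: the
    masks cancel and the error of nu at P appears. Hoelder's inequality and [bernstein] conclude. *)
Lemma error_bound (gamma r : R) : gamma < beta -> exists2 C : R, 0 < C &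
  forall (n : R) P nu, 0 < n -> Pi (2 `^ n) P ->
  ((`|(\int[mu]_x P x)%R - charge_integral nu P|)%:E <=
    (C * 2 `^ (n * (beta - gamma)))%:E * normH r gamma p P * Mp p G nu)%E.
Proof.
move=> gamma_beta.
have [C C0 bern] := bernstein Xi_dd qS r p1 kb gamma_beta.
have [C' _ bp] := bochner_potential Xi_dd qS p1 q_beta kb kG.
exists C => // n P nu n0 HP.
have [m [Pm _ PE]] := (PiP Xi_dd _ _).1 HP.
have hD := bern n P m n0 HP Pm.
set Dp := (fun y : borel Xi => _) in hD.
have Dpp : Dp \in Lfun mu p.
  have ck k := Lfun_scaler (coef P k / b (lam Xi k)) p1 (phi_Lfun Xi_dd k p1).
  exact: (Lfun_sum (index_enum 'I_m) xpredT p1 (fun k : 'I_m => ck k)).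
have [Bn cn _] := bp nu; have [Bm cm _] := bp cmu.
pose H := (fun y => bochner mu p' nu G y - bochner mu p' cmu G y).
have Hp : H \in Lfun mu p' by exact: Lfun_sub.
have chE (ch : signed_measure Xi R) : charge_integral ch P =
    \sum_(k < m) coef P k * charge_integral ch (phi k).
  rewrite {1}PE charge_integral_sum; last first.
    by move=> k; apply: bounded_measZ; exact: bounded_meas_phi Xi_dd k.
  by apply: eq_bigr => k _; rewrite charge_integralZ//; exact: bounded_meas_phi Xi_dd k.
(* Only the coefficients of the potentials enter, since [Dp] is a finite sum; positivity of the mask
   allows the cancellation. *)
have E : (\int[mu]_y (H y * Dp y))%R = charge_integral nu P - (\int[mu]_x P x)%R.
  rewrite -(charge_integral_measure mu P) !chE -sumrB.
  under eq_Rintegral do rewrite mulrC.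
  have := @pairing_sum _ _ _ mu p' p'1 'I_m (index_enum _)
      (fun k => coef P k / b (lam Xi k)) (fun k => phi k) H Hp
      (fun k => phi_Lfun Xi_dd k (hoelder_conj_ge1 p'1)) => ->.
  apply: eq_bigr => k _; under eq_Rintegral do rewrite mulrC.
  have -> : (\int[mu]_y (H y * phi k y))%R = coef H k by [].
  rewrite (coef_diff Xi_dd k (Lfun_Lfun1 p'1 Bn) (Lfun_Lfun1 p'1 Bm)) cn cm -mulrBr.
  have bk := mask_gt0 Xi_dd qS beta_gt0 kb (lam_ge0 Xi_dd k).
  by rewrite mulrA divfK ?gt_eqF// mulrBr.
rewrite distrC -E; apply: le_trans (pairing_bound p1 Dpp Hp) _.
by rewrite /Mp /normp; apply: lee_wpmul2r hD; exact: Lnorm_ge0.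
Qed.

End assembly.

Theorem theorem3 (R : realType) (Xi : system R) (q : R)
    (Xi_dd : data_defined Xi q)
    (S : nat) (qS : q < S%:R)
    (p : \bar R) (p1 : (1%:E <= p)%E)
    (beta : R) (q_beta : (q%:E / p < beta%:E)%E)
    (G : borel Xi -> borel Xi -> R) (kerG : kernel_of_type S beta p G)
    (C1 C2 C3 : R) (C1_gt0 : 0 < C1) (C2_gt0 : 0 < C2) (C3_gt0 : 0 < C3)
    (gamma : R) (gamma_gt0 : 0 < gamma) (gamma_beta : gamma < beta)
    (r : R) (gamma_r : gamma < r) :
  exists2 A : R, 0 < A &
    forall (n : R) (tau : Topological (signed_measure Xi R))
      (K : set (signed_measure Xi R)),
    0 < n ->
    compact_for tau K ->
    (ereal_sup [set variation_measure nu setT | nu in K] <= C1%:E)%E ->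
    (ereal_sup [set regnorm q (2 `^ (- n)) nu | nu in K] <= C2%:E)%E ->
    (exists2 nustar, K nustar & quadrature_measure (2 `^ n) nustar) ->
    forall nu, K nu ->
    (Mp p G nu <= C3%:E * ereal_inf [set Mp p G nu' | nu' in K])%E ->
    (forall P : borel Xi -> R, Pi (2 `^ n) P ->
      (`|(\int[mustar Xi]_x P x)%R - charge_integral nu P|%:E <=
       A%:E * (normH r gamma p P / (2 `^ (n * gamma))%:E))%E) /\
    approx_quadrature_measure q r gamma p C1 C2 A (2 `^ n) nu.
Proof.
have beta_gt0 : 0 < beta by exact: lt_trans gamma_beta.
have [b kb kG] := kerG.
have [C C0 Mq] := Mp_quadrature Xi_dd qS p1 beta_gt0 q_beta kb kG C1_gt0 C2_gt0.
have [C' C'0 err] := error_bound Xi_dd qS p1 beta_gt0 q_beta kb kG r gamma_beta.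
exists (C' * (C3 * C)); first by rewrite !mulr_gt0.
move=> n tau K n0 _ KC1 KC2 [nus Knus quad] nu Knu opt.
have var nu' : K nu' -> (variation_measure nu' setT <= C1%:E)%E.
  by move=> K'; apply: le_trans KC1; apply: ereal_sup_ubound; exists nu'.
have reg nu' : K nu' -> (regnorm q (2 `^ (- n)) nu' <= C2%:E)%E.
  by move=> K'; apply: le_trans KC2; apply: ereal_sup_ubound; exists nu'.
(* The quadrature measure is a competitor in the infimum, so [nu] inherits its estimate up to C3. *)
have MB : (Mp p G nu <= (C3 * C * (2 `^ n) `^ (- beta))%:E)%E.
  apply: le_trans opt _; rewrite -mulrA EFinM; apply: lee_wpmul2l; first by rewrite lee_fin ltW.
  apply: le_trans (Mq n nus n0 (var _ Knus) (reg _ Knus) quad).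
  by apply: ereal_inf_lbound; exists nus.
have g0 : 0 < 2 `^ (n * gamma) by rewrite powR_gt0.
have bound P : Pi (2 `^ n) P ->
    (`|(\int[mustar Xi]_x P x)%R - charge_integral nu P|%:E <=
     (C' * (C3 * C))%:E * (normH r gamma p P * ((2 `^ (n * gamma))^-1)%:E))%E.
  move=> HP; apply: le_trans (err n P nu n0 HP) _.
  have H0 : (0 <= (C' * 2 `^ (n * (beta - gamma)))%:E * normH r gamma p P)%E.
    by rewrite mule_ge0 ?normH_ge0// lee_fin mulr_ge0 ?powR_ge0// ltW.
  apply: le_trans (lee_wpmul2l H0 MB) _.
  rewrite (muleC _ (normH r gamma p P)) -muleA -EFinM [leRHS]muleCA -EFinM.
  rewrite le_eqVlt; apply/orP; left; apply/eqP; congr (_ * _%:E)%E.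
  rewrite -!powRN -powRrM.
  (* The growth from [bernstein] times the decay of [Mp] leaves exactly 2^(-n gamma). *)
  have -> : 2 `^ (- (n * gamma)) = 2 `^ (n * (beta - gamma)) * 2 `^ (n * - beta) :> R.
    by rewrite -powRD_gt0//; congr (_ `^ _); ring.
  by set x := _ `^ _; set y := _ `^ _; ring.
split=> [P HP|].
  have := bound P HP.
  by rewrite [X in (_ * X)%E]/= inver gt_eqF.
split; first exact: var.
  by rewrite -powRN; exact: reg.
move=> P HP; have := bound P HP.
by rewrite muleA -powRrM mulrN powRN.
Qed.
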